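(* Let $\underline{\mathcal F}$ be an abelian $\tau$-sheaf over the finite field $\mathbb F_s$. Then there exists a finite field extension $\mathbb F_{s'}/\mathbb F_s$ whose degree is a power of $\mathrm{char}\,\mathbb F_s$ such that $\underline{\mathcal F}\otimes_{\mathbb F_s}\mathbb F_{s'}$ has an absolutely semisimple Frobenius endomorphism. Thus, if moreover the characteristic point $\varepsilon$ is different from $\infty$, then $\underline{\mathcal F}\otimes_{\mathbb F_s}\mathbb F_{s'}$ is semisimple.
   Context: Setting. $C$ is a smooth projective geometrically irreducible curve over the finite field $\mathbb F_q$, $\infty\in C(\mathbb F_q)$ a fixed point, $Q=\mathbb F_q(C)$ its function field. For a field $L\supset\mathbb F_q$: $C_L=C\times_{\mathbb F_q}L$, $\sigma=\mathrm{id}_C\times\mathrm{Spec}(\mathrm{Frob}_q)$ on $C_L$ ($\mathrm{Frob}_q:x\mapsto x^q$ on $L$). Abelian $\tau$-sheaves. Fix a morphism $c:\mathrm{Spec}\,L\to C$; let $\mathcal J$ be the ideal sheaf on $C_L$ of the graph of $c$, and $\varepsilon=c(\mathrm{Spec}\,L)\in C$ the characteristic point. An abelian $\tau$-sheaf $\underline{\mathcal F}=(\mathcal F_i,\Pi_i,\tau_i)_{i\in\mathbb Z}$ of rank $r$, dimension $d$ and characteristic $c$ over $L$ consists of locally free sheaves $\mathcal F_i$ of rank $r$ on $C_L$ and injective $\mathcal O_{C_L}$-morphisms $\Pi_i:\mathcal F_i\to\mathcal F_{i+1}$, $\tau_i:\sigma^*\mathcal F_i\to\mathcal F_{i+1}$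 such that $\Pi_{i+1}\circ\tau_i=\tau_{i+1}\circ\sigma^*\Pi_i$; there are integers $k,l>0$ with $ld=kr$ such that $\Pi_{i+l-1}\circ\cdots\circ\Pi_i$ identifies $\mathcal F_i$ with $\mathcal F_{i+l}(-k\cdot\infty)\subset\mathcal F_{i+l}$ for all $i$; $\mathrm{coker}\,\Pi_i$ has $L$-dimension $d$; $\mathrm{coker}\,\tau_i$ has $L$-dimension $d$ and is annihilated by $\mathcal J^d$. A morphism $f:\underline{\mathcal F}\to\underline{\mathcal F}'$ (same characteristic) is a family $f_i:\mathcal F_i\to\mathcal F'_i$ commuting with the $\Pi$'s and $\tau$'s; it is surjective (injective) if all $f_i$ are; it is an isogeny if it is injective and both sides have the same rank and dimension. For a divisor $D$ on $C$, $\underline{\mathcal F}(D)$ is obtained by tensoring with $\mathcal O(D)$. $\mathrm{QHom}(\underline{\mathcal F},\underline{\mathcal F}')=\varinjlim_D\mathrm{Hom}(\underline{\mathcal F},\underline{\mathcal F}'(D))$ over effective divisors $D$; quasi-isogenies are the elements represented by isogenies $\underline{\mathcal F}\to\underline{\mathcal F}'(D)$; $\mathrm{QEnd}(\underline{\mathcal F})=\mathrm{QHom}(\underline{\mathcal F},\underline{\mathcal F})$, a finite-dimensional $Q$-algebra. For a field extension $L'/L$, $\underline{\mathcal F}\otimes_LL'$ is the abelian $\tau$-sheaf over $L'$ obtained by pulling back all $\mathcal F_i,\Pi_i,\tau_i$ to $C_{L'}$. $\underline{\mathcal F}$ is simple if $\underline{\mathcal F}\neq0$ and it has no abelian factor $\tau$-sheaves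 (targets of surjective morphisms from $\underline{\mathcal F}$) other than $0$ and $\underline{\mathcal F}$ (up to isomorphism). It is semisimple if it is quasi-isogenous to a finite direct sum of simple abelian $\tau$-sheaves. Frobenius. If $L=\mathbb F_s$, $s=q^e$, then $(\sigma^* )^e\underline{\mathcal F}=\underline{\mathcal F}$ and the Frobenius endomorphism $\pi=(\pi_i)$, $\pi_i=\tau_{i+e-1}\circ\cdots\circ(\sigma^* )^{e-1}\tau_i:\mathcal F_i\to\mathcal F_{i+e}$, is regarded as an element of $\mathrm{QEnd}(\underline{\mathcal F})$ via $\mathcal F_{i+e}\subset\mathcal F_{i+nl}=\mathcal F_i(nk\cdot\infty)$ for $n$ with $nl\ge e$. It is called absolutely semisimple if for every field extension $K'/Q$ the algebra $Q[\pi]\otimes_QK'$ is semisimple (equivalently, the minimal polynomial of $\pi$ over $Q$ is separable). *)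

(* Defs.v *)
From HB Require Import structures.
From mathcomp Require Export all_boot all_order all_algebra.
From mathcomp Require Export boolp classical_sets functions cardinality fsbigop.

Set Implicit Arguments.
Unset Strict Implicit.
Unset Printing Implicit Defensive.

Import Order.TTheory GRing.Theory Num.Theory.

Local Open Scope classical_set_scope.
Local Open Scope ring_scope.

(**
  Curves and vector bundles in the language of function fields.

  - A regular projective curve over a (finite, hence perfect) field k is given
    by its function field K.  Its closed points are the valuation rings
    k <= O < K, the local ring at the point O is O itself, and the nonempty
    open subsets are the complements of finite sets of closed points (together
    with the generic point).

  - A locally free sheaf M of rank r is given through its embedding in the
    constant sheaf of its generic stalk, which is identified with K^r (row
    vectors): M is the family of its stalks M_P <= K^r.  A morphism of locally
    free sheaves is the K-linear map it induces on the generic stalks, i.e. a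
    matrix, acting on row vectors on the right, that maps the stalk M_P into
    N_P for every closed point P.

  - A dominant morphism of curves X' -> X is given by phi : K -> K' on function
    fields; it maps the closed point P' to phi^-1(P').
*)

(** ** Linear algebra *)

(* [linspan O S]: all linear combinations of elements of S, coefficients in O *)
Definition linspan (R : nzRingType) (V : lmodType R) (O : set R) (S : set V)
  : set V :=
  [set v | exists n (a : 'I_n -> R) (w : 'I_n -> V),
     [/\ forall j, O (a j), forall j, S (w j) & v = \sum_(j < n) a j *: w j]].

Definition is_basis (k A : nzRingType) (h : {rmorphism k -> A}) (n : nat)
    (b : 'I_n -> A) : Prop :=
  forall x, exists! a : {ffun 'I_n -> k}, x = \sum_(j < n) h (a j) * b j.

Definition ext_degree (k k' : fieldType) (h : {rmorphism k -> k'}) (n : nat) :=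
  exists b : 'I_n -> k', is_basis h b.

(* dim_k (N / M) = n, for k-subspaces M <= N of a vector space over K, where
   the scalars k act through h *)
Definition quotient_dim (k K : fieldType) (h : {rmorphism k -> K})
    (V : lmodType K) (N M : set V) (n : nat) : Prop :=
  exists b : 'I_n -> V, (forall j, N (b j)) /\
    forall v, N v -> exists! a : {ffun 'I_n -> k},
      M (v - \sum_(j < n) h (a j) *: b j).

(** ** Closed points and divisors *)

Definition is_point (k K : fieldType) (h : {rmorphism k -> K}) (O : set K)
  : Prop :=
  [/\ forall a, O (h a),
      forall x y, O x -> O y -> O (x - y),
      forall x y, O x -> O y -> O (x * y),
      forall x, O x \/ O x^-1
    & exists x, ~ O x].

Definition maxideal (K : fieldType) (O : set K) : set K :=
  [set x | O x /\ (x = 0 \/ ~ O x^-1)].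

Definition uniformizer (K : fieldType) (O : set K) (u : K) : Prop :=
  [/\ u != 0, maxideal O u & forall x, maxideal O x -> O (x / u)].

(* The residue field is the constant field k. *)
Definition rational_point (k K : fieldType) (h : {rmorphism k -> K})
    (O : set K) : Prop :=
  is_point h O /\ forall x, O x -> exists a, maxideal O (x - h a).

Definition is_divisor (k K : fieldType) (h : {rmorphism k -> K})
    (D : set K -> int) : Prop :=
  finite_set [set P | is_point h P /\ D P <> 0].

Definition effective (k K : fieldType) (h : {rmorphism k -> K})
    (D : set K -> int) : Prop :=
  is_divisor h D /\ forall P, is_point h P -> 0 <= D P.

(* the divisor n * P *)
Definition point_divisor (K : fieldType) (P : set K) (n : int) : set K -> int :=
  fun P' => if `[< P' = P >] then n else 0.

(* the stalk at P of the line bundle O(D): v_P(f) >= - D(P) *)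
Definition divisor_stalk (K : fieldType) (D : set K -> int) (P : set K)
  : set K :=
  [set f | exists u, uniformizer P u /\ P (f * u ^ D P)].

(** ** Locally free sheaves *)

Definition sheaf (K : fieldType) (r : nat) := set K -> set 'rV[K]_r.

(* Every closed point P has an open neighbourhood, the complement of Z, over
   which the sheaf is free on the rows of B. *)
Definition locally_free (k K : fieldType) (h : {rmorphism k -> K}) (r : nat)
    (M : sheaf K r) : Prop :=
  forall P, is_point h P ->
  exists (B : 'M[K]_r) (Z : set (set K)),
    [/\ B \in unitmx, finite_set Z, ~ Z P
      & forall P', is_point h P' -> ~ Z P' ->
          M P' = [set a *m B | a in [set a : 'rV[K]_r | forall j, P' (a 0 j)]]].

Definition pullback (K K' : fieldType) (phi : {rmorphism K -> K'}) (r : nat)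
    (M : sheaf K r) : sheaf K' r :=
  fun P' => linspan P' [set map_mx phi v | v in M (phi @^-1` P')].

(* M tensored with the pullback along iQ of the line bundle O(D) *)
Definition sheaf_twist (Q K : fieldType) (iQ : {rmorphism Q -> K})
    (D : set Q -> int) (r : nat) (M : sheaf K r) : sheaf K r :=
  fun P => linspan P [set w | exists f v,
    [/\ divisor_stalk D (iQ @^-1` P) f, M P v & w = iQ f *: v]].

Section SheafMorphisms.
Variables (k K : fieldType) (h : {rmorphism k -> K}).
Variables (r r' : nat) (M : sheaf K r) (N : sheaf K r') (A : 'M[K]_(r, r')).

Definition sheaf_image : sheaf K r' := fun P => [set v *m A | v in M P].

Definition sheaf_hom : Prop :=
  forall P, is_point h P -> sheaf_image P `<=` N P.

Definition sheaf_injective : Prop :=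
  forall P, is_point h P -> forall v, M P v -> v *m A = 0 -> v = 0.

Definition sheaf_surjective : Prop :=
  forall P, is_point h P -> sheaf_image P = N P.

(* dim_k H^0(coker A) = n, for a cokernel supported at finitely many closed
   points, i.e. equal to the direct sum of its stalks N_P / (M_P A) *)
Definition coker_dim (n : nat) : Prop :=
  exists delta : set K -> nat,
    [/\ forall P, is_point h P ->
          quotient_dim h (N P) (sheaf_image P) (delta P),
        finite_set [set P | is_point h P /\ delta P <> 0%N]
      & n = \sum_(P \in [set P | is_point h P]) delta P].

End SheafMorphisms.

(** ** The curve C over F_q, and C_L *)

(* The function field Q = F_q(C): finitely generated of transcendence degree 1
   over F_q.  Geometric irreducibility: for every finite extension F_q[X]/(f)
   of F_q, the ring Q[X]/(f), whose spectrum is the generic fibre of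
   C_{F_q[X]/(f)} -> C, is a field. *)
Record curve (F : finFieldType) := Curve {
  funfield :> fieldType;
  const : {rmorphism F -> funfield};
  curve_dim1 : exists x : funfield,
    (forall p : {poly F}, p != 0 -> (map_poly const p).[x] != 0) /\
    (exists n (b : 'I_n -> funfield), forall y,
       exists (g : {poly F}) (a : 'I_n -> {poly F}), g != 0 /\
         (map_poly const g).[x] * y =
           \sum_(j < n) (map_poly const (a j)).[x] * b j);
  curve_geom_irr : forall f : {poly F},
    irreducible_poly f -> irreducible_poly (map_poly const f) }.

(* For a finite field L containing F_q through jL, the curve C_L: its function
   field is Q (x)_{F_q} L, which is characterized by the fact that an F_q-basis
   of L is also a Q-basis.  The degree of L over F_q is [cl_deg], and
   [cl_sigma] = id (x) Frob_q is the comorphism of sigma. *)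
Record curve_over (F : finFieldType) (C : curve F) (L : finFieldType)
    (jL : {rmorphism F -> L}) := CurveOver {
  cl_field :> fieldType;
  cl_fun : {rmorphism C -> cl_field};
  cl_const : {rmorphism L -> cl_field};
  cl_agree : forall a, cl_fun (const C a) = cl_const (jL a);
  cl_deg : nat;
  cl_tensor : exists b : 'I_cl_deg -> L,
    is_basis jL b /\ is_basis cl_fun (fun j => cl_const (b j));
  cl_sigma : {rmorphism cl_field -> cl_field};
  cl_sigma_fun : forall f, cl_sigma (cl_fun f) = cl_fun f;
  cl_sigma_const : forall x, cl_sigma (cl_const x) = cl_const (x ^+ #|F|) }.

(* A morphism c : Spec L -> C over F_q: its image, and the local homomorphism
   from the local ring there to L.  The values of [char_ev] outside the local
   ring are irrelevant.  (As L is finite, the image is a closed point.) *)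
Record char_morphism (F : finFieldType) (C : curve F) (L : finFieldType)
    (jL : {rmorphism F -> L}) := CharMorphism {
  char_point : set C;
  char_pointP : is_point (const C) char_point;
  char_ev : C -> L;
  char_ev_const : forall a, char_ev (const C a) = jL a;
  char_evD : forall x y, char_point x -> char_point y ->
    char_ev (x + y) = char_ev x + char_ev y;
  char_evM : forall x y, char_point x -> char_point y ->
    char_ev (x * y) = char_ev x * char_ev y;
  char_ev_local : forall x, char_point x ->
    (char_ev x = 0 <-> maxideal char_point x) }.

(* the stalks of the ideal sheaf J on C_L of the graph of c, which is generated
   over the characteristic point by the differences a (x) 1 - 1 (x) c^*(a) *)
Definition graph_ideal (F : finFieldType) (C : curve F) (L : finFieldType)
    (jL : {rmorphism F -> L}) (CL : curve_over C jL) (c : char_morphism C jL)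
    (P : set CL) : set CL :=
  [set x | P x /\ (cl_fun CL @^-1` P = char_point c ->
    linspan (V := (CL : fieldType)^o) P
      [set cl_fun CL a - cl_const CL (char_ev c a) | a in char_point c] x)].

(** ** Abelian tau-sheaves *)

(* The data (F_i, Pi_i, tau_i) with a rank and a dimension; as the pullback of
   K^r along sigma is K^r, the tau_i : sigma^* F_i -> F_{i+1} are matrices. *)
Record tau_data (K : fieldType) := TauData {
  rank : nat;
  dimn : nat;
  shf : int -> sheaf K rank;
  Pi : int -> 'M[K]_rank;
  tau : int -> 'M[K]_rank }.

Arguments shf {K} _ _ _ _.
Arguments Pi {K} _ _.
Arguments tau {K} _ _.

(* Pi_{i+n-1} o ... o Pi_i *)
Fixpoint Pi_iter (K : fieldType) (X : tau_data K) (n : nat) (i : int)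
  : 'M[K]_(rank X) :=
  if n is n'.+1 then Pi_iter X n' i *m Pi X (i + n'%:Z) else 1%:M.

Section TauSheaves.
Variables (F : finFieldType) (C : curve F) (infty : set C).
Variables (L : finFieldType) (jL : {rmorphism F -> L}).
Variables (CL : curve_over C jL) (c : char_morphism C jL).

Local Notation pointL := (is_point (cl_const CL)).
Local Notation sigma := (cl_sigma CL).
Implicit Types X Y : tau_data CL.

Record abelian_tau X : Prop := AbelianTau {
  at_free : forall i, locally_free (cl_const CL) (shf X i);
  at_Pi_hom : forall i,
    sheaf_hom (cl_const CL) (shf X i) (shf X (i + 1)) (Pi X i);
  at_Pi_inj : forall i, sheaf_injective (cl_const CL) (shf X i) (Pi X i);
  at_tau_hom : forall i, sheaf_hom (cl_const CL)
    (pullback sigma (shf X i)) (shf X (i + 1)) (tau X i);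
  at_tau_inj : forall i,
    sheaf_injective (cl_const CL) (pullback sigma (shf X i)) (tau X i);
  at_comm : forall i,
    tau X i *m Pi X (i + 1) = map_mx sigma (Pi X i) *m tau X (i + 1);
  at_period : exists k l : nat,
    [/\ (0 < k)%N, (0 < l)%N, (l * dimn X = k * rank X)%N
      & forall i P, pointL P ->
          sheaf_image (shf X i) (Pi_iter X l i) P =
          sheaf_twist (cl_fun CL) (point_divisor infty (- k%:Z))
            (shf X (i + l%:Z)) P];
  at_coker_Pi : forall i, coker_dim (cl_const CL)
    (shf X i) (shf X (i + 1)) (Pi X i) (dimn X);
  at_coker_tau : forall i, coker_dim (cl_const CL)
    (pullback sigma (shf X i)) (shf X (i + 1)) (tau X i) (dimn X);
  at_char : forall i P, pointL P ->
    forall f : 'I_(dimn X) -> CL, (forall j, graph_ideal c P (f j)) ->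
    forall v, shf X (i + 1) P v ->
      sheaf_image (pullback sigma (shf X i)) (tau X i) P
        ((\prod_j f j) *: v) }.

Definition tau_family X Y := int -> 'M[CL]_(rank X, rank Y).

Definition tau_hom X Y (f : tau_family X Y) : Prop :=
  [/\ forall i, sheaf_hom (cl_const CL) (shf X i) (shf Y i) (f i),
      forall i, Pi X i *m f (i + 1) = f i *m Pi Y i
    & forall i, tau X i *m f (i + 1) = map_mx sigma (f i) *m tau Y i].

Definition tau_injective X Y (f : tau_family X Y) : Prop :=
  forall i, sheaf_injective (cl_const CL) (shf X i) (f i).

Definition tau_surjective X Y (f : tau_family X Y) : Prop :=
  forall i, sheaf_surjective (cl_const CL) (shf X i) (shf Y i) (f i).

Definition tau_iso X Y : Prop :=
  exists (f : tau_family X Y) (g : tau_family Y X),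
    [/\ tau_hom f, tau_hom g,
        forall i, f i *m g i = 1%:M & forall i, g i *m f i = 1%:M].

Definition isogeny X Y (f : tau_family X Y) : Prop :=
  [/\ tau_hom f, tau_injective f, rank X = rank Y & dimn X = dimn Y].

(* X(D) *)
Definition tau_twist (D : set C -> int) X : tau_data CL :=
  TauData (dimn X) (fun i => sheaf_twist (cl_fun CL) D (shf X i))
    (Pi X) (tau X).

(* The sheaves Y(D) are subsheaves of one constant sheaf, so that the direct
   limit QHom(X, Y) is the union of the Hom(X, Y(D)). *)
Definition quasi_isogeny X Y (f : tau_family X Y) : Prop :=
  exists D : set C -> int, effective (const C) D /\
    @isogeny X (tau_twist D Y) f.

Definition quasi_isogenous X Y : Prop :=
  exists f : tau_family X Y, quasi_isogeny f.

Definition simple_tau X : Prop :=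
  [/\ abelian_tau X, rank X <> 0%N
    & forall Y (f : tau_family X Y), abelian_tau Y -> tau_hom f ->
        tau_surjective f -> rank Y = 0%N \/ tau_iso X Y].

Definition tau_zero : tau_data CL :=
  @TauData CL 0 0 (fun _ _ => setT) (fun _ => 0) (fun _ => 0).

Definition tau_sum X Y : tau_data CL :=
  @TauData CL (rank X + rank Y) (dimn X + dimn Y)
    (fun i P => [set v | shf X i P (lsubmx v) /\ shf Y i P (rsubmx v)])
    (fun i => block_mx (Pi X i) 0 0 (Pi Y i))
    (fun i => block_mx (tau X i) 0 0 (tau Y i)).

(* A direct sum of abelian tau-sheaves need not be one (the quotients
   dimension / rank must agree), whence the condition on the sum. *)
Definition semisimple_tau X : Prop :=
  exists n (Y : 'I_n -> tau_data CL),
    [/\ forall j, simple_tau (Y j),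
        abelian_tau (\big[tau_sum/tau_zero]_(j < n) Y j)
      & quasi_isogenous X (\big[tau_sum/tau_zero]_(j < n) Y j)].

(** ** The Frobenius endomorphism *)

(* tau_{i+n-1} o sigma^* tau_{i+n-2} o ... o (sigma^* )^{n-1} tau_i *)
Fixpoint tau_iter X (n : nat) (i : int) : 'M[CL]_(rank X) :=
  if n is n'.+1 then map_mx sigma (tau_iter X n' i) *m tau X (i + n'%:Z)
  else 1%:M.

(* For L = F_s, s = q^e, the map pi_i : F_i -> F_{i+e} as an element of QEnd(X):
   all the inclusions F_i <= F_{i+e} <= F_{i+nl} = F_i(nk infty) are given by
   composites of the Pi's, so that on generic stalks the identification of
   F_{i+e} with a subsheaf of F_i(nk infty) is the inverse of
   Pi_{i+e-1} o ... o Pi_i, for every n. *)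
Definition frobenius X : tau_family X X :=
  fun i => tau_iter X (cl_deg CL) i *m invmx (Pi_iter X (cl_deg CL) i).

(* the ideal of all p in Q[X] with p(pi) = 0: Q[pi] is the quotient of Q[X] by
   this ideal (evaluation by hand, as the rank may be 0) *)
Definition frobenius_relations X : set {poly C} :=
  [set p | forall i,
     \sum_(j < size p) cl_fun CL p`_j *: frobenius X i ^+ j = 0].

End TauSheaves.

Definition is_ideal (R : nzRingType) (I : set R) : Prop :=
  [/\ I 0, forall x y, I x -> I y -> I (x + y)
    & forall a x, I x -> I (a * x)].

(* The ring R/I is semisimple: every ideal of R/I is a direct summand.  (The
   ideals of R/I are written as the ideals of R containing I.) *)
Definition semisimple_quotient (R : comNzRingType) (I : set R) : Prop :=
  forall J : set R, is_ideal J -> I `<=` J ->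
  exists J' : set R,
    [/\ is_ideal J', I `<=` J', J `&` J' `<=` I
      & forall x, exists y z, [/\ J y, J' z & x = y + z]].

(* For every field extension E / Q, with Q[pi] = Q[X]/I, the E-algebra
   Q[pi] (x)_Q E = E[X]/(I E[X]) is semisimple. *)
Definition frobenius_abs_semisimple (F : finFieldType) (C : curve F)
    (L : finFieldType) (jL : {rmorphism F -> L}) (CL : curve_over C jL)
    (X : tau_data CL) : Prop :=
  forall (E : fieldType) (g : {rmorphism C -> E}),
    semisimple_quotient (linspan (V := ({poly E})^o) setT
      [set map_poly g p | p in frobenius_relations X]).

(** ** Extension of the base field L *)

Section BaseChange.
Variables (F : finFieldType) (C : curve F) (L L' : finFieldType).
Variables (jL : {rmorphism F -> L}) (h : {rmorphism L -> L'}).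

(* phi is the comorphism of the projection C_{L'} -> C_L. *)
Definition is_projection (CL : curve_over C jL)
    (CL' : curve_over C (h \o jL : {rmorphism F -> L'}))
    (phi : {rmorphism CL -> CL'}) : Prop :=
  (forall f, phi (cl_fun CL f) = cl_fun CL' f) /\
  (forall x, phi (cl_const CL x) = cl_const CL' (h x)).

Definition tau_base_change (K K' : fieldType) (phi : {rmorphism K -> K'})
    (X : tau_data K) : tau_data K' :=
  TauData (dimn X) (fun i => pullback phi (shf X i))
    (fun i => map_mx phi (Pi X i)) (fun i => map_mx phi (tau X i)).

(* the composite Spec L' -> Spec L -> C *)
Definition char_base_change (c : char_morphism C jL) :
  char_morphism C (h \o jL : {rmorphism F -> L'}).
Proof.
refine (@CharMorphism F C L' _ (char_point c) (char_pointP c)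
  (fun x => h (char_ev c x)) _ _ _ _).
- by move=> a /=; rewrite char_ev_const.
- by move=> x y cx cy; rewrite (char_evD cx cy) rmorphD.
- by move=> x y cx cy; rewrite (char_evM cx cy) rmorphM.
- move=> x cx; rewrite -(char_ev_local cx); split=> [/eqP|->].
    by rewrite fmorph_eq0 => /eqP.
  by rewrite rmorph0.
Defined.

End BaseChange.

(* Main.v *)
(* Generically, an abelian tau-sheaf over F_s is one semilinear map T, and pi is
   conjugate to the e-th iterate A of T, a matrix over the function field K of
   C_L.  A nonzero polynomial f over Q kills A, and f divides g(X^(p^m)) for some
   separable g and some m.  Extending L by the degree N = p^m replaces A by A^N,
   which is killed by g: this makes pi absolutely semisimple.

   Let a separable g kill pi.  A linear section of a factor map X -> Y can be made
   to commute with pi because g is separable, and then with T by averaging over the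
   powers of sigma.  Hence X is generically the direct sum of Y and of the kernel,
   which is again abelian by the snake lemma, and the rank decreases.  A generic
   isomorphism of abelian tau-sheaves of the same dimension is a quasi-isogeny.

   The base change is abelian because the cokernels of the Pi_i and of the tau_i are
   supported at L-rational points of C_L, over which there is a single point of
   C_{L'}, with the residue field L'. *)
Require Import Defs.
From HB Require Import structures.
From mathcomp Require Import all_boot all_order all_algebra all_field fingroup cyclic pgroup.
From mathcomp Require abelian.
From mathcomp Require Import boolp classical_sets functions cardinality fsbigop.
From mathcomp Require Import ring zify.

Set Implicit Arguments.
Unset Strict Implicit.
Unset Printing Implicit Defensive.

Import GRing.Theory.
Local Open Scope classical_set_scope.
Local Open Scope ring_scope.

(** * Closed points of function fields *)

(** Four obstacles shape the development. A closed point is a bare valuation ring, so discreteness,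
    approximation and the finiteness of poles are all derived from one datum, a bound n on the
    degree over k(y), in the form of relations between n + 1 elements with coefficients in k[y]. The
    kernel of X -> Y inherits only annihilation by J^(dim X); the required power J^(dim X - dim Y)
    comes from the dimension of its cokernel, on which the elements of J act as commuting nilpotent
    operators. Periodicity of the kernel needs one period (k, l) for X and Y, that is, equal slopes
    dim / rank; comparing stalks above infty shows that a nonzero factor has the slope of X.
    Finally, dimensions of cokernels are compared point by point under base change, which works over
    rational points; at the support of coker tau rationality has to be proved, by showing that a
    point on the graph of c has residue field L. *)

Section Points.
Variables (k K : fieldType) (h : {rmorphism k -> K}) (O : set K).
Hypothesis hO : is_point h O.
Local Notation m := (maxideal O).

Lemma point_const a : O (h a). Proof. by case: hO. Qed.
Lemma pointB x y : O x -> O y -> O (x - y). Proof. by case: hO => _ H *; exact: H. Qed.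
Lemma pointM x y : O x -> O y -> O (x * y). Proof. by case: hO => _ _ H *; exact: H. Qed.
Lemma pointV x : O x \/ O x^-1. Proof. by case: hO. Qed.
Lemma point0 : O 0. Proof. by rewrite -(rmorph0 h); exact: point_const. Qed.
Lemma point1 : O 1. Proof. by rewrite -(rmorph1 h); exact: point_const. Qed.
Lemma pointN x : O x -> O (- x).
Proof. by move=> ?; rewrite -(sub0r x); apply: pointB => //; exact: point0. Qed.
Lemma pointD x y : O x -> O y -> O (x + y).
Proof. by move=> ? /pointN ?; rewrite -(opprK y); exact: pointB. Qed.
Lemma point_sum I (r : seq I) (Q : pred I) (f : I -> K) :
  (forall i, Q i -> O (f i)) -> O (\sum_(i <- r | Q i) f i).
Proof. by move=> H; elim/big_ind : _ => //; [exact: point0|exact: pointD]. Qed.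
Lemma point_prod I (r : seq I) (Q : pred I) (f : I -> K) :
  (forall i, Q i -> O (f i)) -> O (\prod_(i <- r | Q i) f i).
Proof. by move=> H; elim/big_ind : _ => //; [exact: point1|exact: pointM]. Qed.
Lemma pointX x n : O x -> O (x ^+ n).
Proof. by move=> ?; elim: n => [|n IH]; [exact: point1|rewrite exprS; exact: pointM]. Qed.
Lemma point_horner (p : {poly k}) x : O x -> O (map_poly h p).[x].
Proof.
move=> Ox; rewrite horner_coef; apply: point_sum => i _.
by rewrite coef_map; apply: pointM; [exact: point_const|exact: pointX].
Qed.

Lemma maxideal_sub x : m x -> O x. Proof. by case. Qed.
Lemma maxideal0 : m 0. Proof. by split; [exact: point0|left]. Qed.
Lemma maxideal1 : ~ m 1.
Proof. by case=> _ [/eqP|]; [rewrite oner_eq0|rewrite invr1 => /(_ point1)]. Qed.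

Lemma notpoint_inv x : ~ O x -> m x^-1.
Proof.
move=> nOx; split; first by case: (pointV x).
by right; rewrite invrK.
Qed.

Lemma maxidealMl x y : O y -> m x -> m (y * x).
Proof.
move=> Oy [Ox H]; split; first exact: pointM.
have [->|y0] := eqVneq y 0; first by rewrite mul0r; left.
have [->|x0] := eqVneq x 0; first by rewrite mulr0; left.
right; case: H => [/eqP|H]; first by rewrite (negbTE x0).
by move=> H'; apply: H; have := pointM Oy H'; rewrite invfM mulrA divff // mul1r.
Qed.
Lemma maxidealMr x y : O y -> m x -> m (x * y).
Proof. by rewrite mulrC; exact: maxidealMl. Qed.

Lemma maxidealD x y : m x -> m y -> m (x + y).
Proof.
move=> mx my.
have [->|x0] := eqVneq x 0; first by rewrite add0r.
have [->|y0] := eqVneq y 0; first by rewrite addr0.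
case: (pointV (x / y)) => H.
  have -> : x + y = (x / y + 1) * y by field.
  by apply: maxidealMl => //; apply: pointD => //; exact: point1.
have -> : x + y = (1 + (x / y)^-1) * x by field; exact/andP.
by apply: maxidealMl => //; apply: pointD => //; exact: point1.
Qed.
Lemma maxidealN x : m x -> m (- x).
Proof. by rewrite -mulN1r; apply: maxidealMl; apply: pointN; exact: point1. Qed.
Lemma maxidealB x y : m x -> m y -> m (x - y).
Proof. by move=> mx /maxidealN; exact: maxidealD. Qed.
Lemma maxideal_sum I (r : seq I) (Q : pred I) (f : I -> K) :
  (forall i, Q i -> m (f i)) -> m (\sum_(i <- r | Q i) f i).
Proof. by move=> H; elim/big_ind : _ => //; [exact: maxideal0|exact: maxidealD]. Qed.

Lemma maxidealM x y : O x -> O y -> m (x * y) -> m x \/ m y.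
Proof.
move=> Ox Oy mxy; case: (pselect (m x)) => [|nmx]; [by left|right].
have x0 : x != 0 by apply: contra_notN nmx => /eqP ->; exact: maxideal0.
have -> : y = x^-1 * (x * y) by field.
apply: maxidealMl => //.
case: (pselect (O x^-1)) => // H; exfalso; apply: nmx.
by rewrite -(invrK x); exact: notpoint_inv.
Qed.

Lemma maxidealXS x n : m x -> m (x ^+ n.+1).
Proof. by move=> mx; rewrite exprS; apply: maxidealMr => //; apply: pointX; exact: maxideal_sub. Qed.

Lemma maxideal_inv x : x != 0 -> m x -> ~ O x^-1.
Proof. by move=> x0 [_ [/eqP|//]]; rewrite (negbTE x0). Qed.
Lemma unit_inv x : O x -> ~ m x -> O x^-1.
Proof.
move=> Ox nmx; apply: contrapT => H; apply: nmx.
by rewrite -(invrK x); exact: notpoint_inv.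
Qed.
Lemma unit_neq0 x : ~ m x -> x != 0.
Proof. by move=> nmx; apply: contra_notN nmx => /eqP ->; exact: maxideal0. Qed.
Lemma inv_unit x : x != 0 -> O x^-1 -> ~ m x.
Proof. by move=> x0 H [_ [/eqP|//]]; rewrite (negbTE x0). Qed.
Lemma maxideal_const a : a != 0 -> ~ m (h a).
Proof. by move=> a0; apply: inv_unit; rewrite ?fmorph_eq0// -fmorphV; exact: point_const. Qed.

Lemma unitD x y : ~ m x -> m y -> ~ m (x + y).
Proof. by move=> nmx my H; apply: nmx; have := maxidealB H my; rewrite addrK. Qed.

(** Valuation rings are integrally closed: if x were outside [O], dividing by x^n would write the
    unit [a n] as a combination of positive powers of x^-1, which lies in the maximal ideal. *)
Lemma point_integral n (a : nat -> K) x : (forall i, O (a i)) ->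
  O (a n)^-1 -> a n != 0 -> \sum_(i < n.+1) a i * x ^+ i = 0 -> O x.
Proof.
move=> Oa Oan an0 E; apply: contrapT => nOx.
have x0 : x != 0 by apply: contra_notN nOx => /eqP ->; exact: point0.
have mx := notpoint_inv nOx.
have : m (a n).
  move: E; rewrite big_ord_recr /= addrC => /eqP; rewrite addr_eq0 => /eqP E.
  have -> : a n = - \sum_(i < n) a i * x^-1 ^+ (n - i).
    apply: (mulIf (expf_neq0 n x0)); rewrite E mulNr mulr_suml; congr (- _).
    apply: eq_bigr => i _; rewrite -mulrA; congr (_ * _).
    have -> : x ^+ n = x ^+ (n - i) * x ^+ i by rewrite -exprD subnK // ltnW.
    by rewrite mulrA -exprMn mulVf // expr1n mul1r.
  apply/maxidealN/maxideal_sum => i _; apply: maxidealMl => //.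
  by have := ltn_ord i; rewrite -subn_gt0; case: (n - i)%N => // ? _; exact: maxidealXS.
by move/(maxideal_inv an0).
Qed.

End Points.

(** * Linear relations over a polynomial ring *)

Section PolySpan.
Variables (k K : fieldType) (h : {rmorphism k -> K}).

(* [K] has degree at most [n] over [k(y)], [y] being transcendental: denominators are
   cleared in the linear relations. *)
Definition poly_dep (y : K) (n : nat) : Prop :=
  (forall p : {poly k}, p != 0 -> (map_poly h p).[y] != 0) /\
  forall v : 'I_n.+1 -> K, exists a : 'I_n.+1 -> {poly k},
    (exists i, a i != 0) /\ \sum_i (map_poly h (a i)).[y] * v i = 0.

Definition revp d (p : {poly k}) : {poly k} := \poly_(i < d.+1) p`_(d - i).

Lemma revp_horner d (p : {poly k}) y : y != 0 -> (size p <= d.+1)%N ->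
  (map_poly h (revp d p)).[y^-1] = (map_poly h p).[y] / y ^+ d.
Proof.
move=> y0 sp; rewrite !(@horner_coef_wide _ d.+1); last 2 first.
- by rewrite size_map_poly.
- by rewrite (leq_trans (size_poly _ _)) // size_poly.
rewrite (reindex_inj rev_ord_inj) /= mulr_suml; apply: eq_bigr => i _.
rewrite !coef_map coef_poly /= subSS.
have -> : (d - i < d.+1)%N by rewrite ltnS leq_subr.
rewrite subKn; last by rewrite -ltnS.
rewrite -mulrA; congr (_ * _).
have -> : y ^+ d = y ^+ (d - i) * y ^+ i by rewrite -exprD subnK // -ltnS.
by rewrite exprVn; field; rewrite !expf_neq0.
Qed.

Lemma revp_eq0 d (p : {poly k}) : (size p <= d.+1)%N -> p != 0 -> revp d p != 0.
Proof.
move=> sp p0; apply/eqP => /polyP /(_ (d - (size p).-1)%N).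
rewrite coef_poly coef0 ltnS leq_subr subKn.
  by move/eqP; rewrite -lead_coefE lead_coef_eq0 (negbTE p0).
by rewrite -ltnS prednK // lt0n size_poly_eq0.
Qed.

(** Coefficients are replaced by their reciprocal polynomials X^d p(1/X), for one d above all
    degrees. Every point contains y or y^-1, so arguments that need a coordinate integral at the
    point reach all points. *)
Lemma poly_depV y n : poly_dep y n -> poly_dep y^-1 n.
Proof.
move=> [tr dep]; have y0 : y != 0.
  by have := tr 'X; rewrite map_polyX hornerX polyX_eq0; exact.
split=> [p p0|v].
  have := revp_horner (d := size p) (p := p) (invr_neq0 y0) (leqnSn _).
  rewrite invrK => E; apply/eqP => E0; move: E; rewrite E0 mul0r => /eqP.
  by apply/negP/tr; apply: revp_eq0.
have [a [[i ai0] E]] := dep v.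
pose d := \max_i size (a i).
have ds j : (size (a j) <= d.+1)%N by apply: leqW; exact: leq_bigmax.
exists (fun j => revp d (a j)); split; first by exists i; exact: revp_eq0.
under eq_bigr do rewrite revp_horner // mulrAC.
by rewrite -mulr_suml E mul0r.
Qed.

End PolySpan.

(** Every nonzero z is a unit times a power of t. Discreteness is thus a property to be proved, as
    [is_point] only asks for a valuation ring. *)
Definition local_param (K : fieldType) (O : set K) (t : K) : Prop :=
  [/\ t != 0, maxideal O t
    & forall z, z != 0 -> exists j : int, O (z / t ^ j) /\ ~ maxideal O (z / t ^ j)].

(** * Closed points are discrete valuation rings *)

Section Dvr.
Variables (k K : fieldType) (h : {rmorphism k -> K}) (y : K) (n : nat).
Hypothesis dep : poly_dep h y n.
Local Notation ev p := (map_poly h p).[y].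

(** Take the last nonzero coefficient in a relation between the powers of z: wherever its value is a
    unit, z is integral. The polynomial depends on z only and serves all points at once. *)
Lemma pole_poly z : exists2 b : {poly k}, b != 0 &
  forall O, is_point h O -> O y -> ~ O z -> maxideal O (ev b).
Proof.
have [a [[i ai0] E]] := dep.2 (fun i => z ^+ i).
case: (@arg_maxnP _ i (fun i => a i != 0) val ai0) => j aj0 jmax.
exists (a j) => // O hO Oy nOz; apply: contrapT => nm.
pose a' (l : nat) := if (l < n.+1)%N then ev (a (inord l)) else 0.
have Oa' l : O (a' l).
  by rewrite /a'; case: ifP => _; [exact: (point_horner hO)|exact: (point0 hO)].
have a'j : a' j = ev (a j) by rewrite /a' ltn_ord inord_val.
apply: nOz; apply: (@point_integral _ _ _ _ hO j a') => //.
- by rewrite a'j; apply: (unit_inv hO) => //; exact: (point_horner hO).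
- by rewrite a'j; exact: dep.1.
rewrite -[RHS]E (big_ord_widen n.+1 (fun l => a' l * z ^+ l)) //.
rewrite big_mkcond; apply: eq_bigr => l _.
have a'l : a' l = ev (a l) by rewrite /a' ltn_ord inord_val.
rewrite ltnS a'l; case: leqP => // jl.
have [->|al0] := eqVneq (a l) 0; first by rewrite map_poly0 horner0 mul0r.
by have : (l <= j)%N := jmax _ al0; rewrite leqNgt jl.
Qed.

(** Common factors g are divided out, by descent on the degree of a nonzero coefficient. A primitive
    relation stays nontrivial after reduction at a place above g. *)
Lemma primitive_dep (g : {poly k}) (v : 'I_n.+1 -> K) : (1 < size g)%N ->
  exists a : 'I_n.+1 -> {poly k},
    (exists i, ~~ (g %| a i)) /\ \sum_i (ev (a i)) * v i = 0.
Proof.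
move=> sg; have [a [[i ai0] E]] := dep.2 v.
have g0 : g != 0 by rewrite -size_poly_gt0 (ltn_trans _ sg).
have [s] := ubnP (size (a i)); elim: s => // s IH in a ai0 E *; rewrite ltnS => sa.
have [[j ndj]|H] := pselect (exists j, ~~ (g %| a j)); first by exists a; split; [exists j|].
have dv j : g %| a j by apply: contrapT => /negP ?; apply: H; exists j.
apply: (IH (fun j => a j %/ g)).
- by rewrite dvdp_div_eq0.
- have /eqP : ev g * \sum_j ev (a j %/ g) * v j = 0.
    rewrite -[RHS]E mulr_sumr; apply: eq_bigr => j _.
    by rewrite -{2}(divpK (dv j)) rmorphM hornerM mulrA [ev g * _]mulrC.
  by rewrite mulf_eq0 (negbTE (dep.1 _ g0)) => /eqP.
rewrite (leq_trans _ sa) // size_divp // ltn_subrL size_poly_gt0 ai0 andbT.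
by rewrite -ltnS prednK // (ltn_trans _ sg).
Qed.

Section Fixed.
Variable O : set K.
Hypotheses (hO : is_point h O) (Oy : O y).
Local Notation m := (maxideal O).

(** [g] generates the contraction of [m] to k[y], and is found as a nonzero polynomial of least
    degree in it; one exists by [pole_poly] applied to an element outside [O]. *)
Lemma residue_poly : exists g : {poly k},
  [/\ (1 < size g)%N, m (ev g) & forall b, ~~ (g %| b) -> ~ m (ev b)].
Proof.
have [z nOz] : exists z, ~ O z by case: hO.
have [b b0 bP] := pole_poly z.
pose P s := `[< exists2 g : {poly k}, g != 0 & m (ev g) /\ size g = s >].
have exP : exists s, P s.
  by exists (size b); apply/asboolP; exists b => //; split => //; exact: bP.
case: (ex_minnP exP) => s /asboolP[g g0 [mg sg]] smin.
have small (b1 : {poly k}) : (size b1 < s)%N -> b1 != 0 -> ~ m (ev b1).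
  move=> bs b10 mb1; have := smin (size b1); rewrite leqNgt bs => H.
  by apply/notF/H/asboolP; exists b1.
exists g; split=> //.
  rewrite ltnNge; apply/negP => /size1_polyC E; move: mg.
  rewrite E map_polyC hornerC; apply: (maxideal_const hO).
  by apply: contraNneq g0; rewrite {2}E => ->.
move=> b1; rewrite {2}(divp_eq b1 g) rmorphD rmorphM hornerD hornerM addrC.
rewrite /dvdp => r0; apply: (unitD hO).
  by apply: small => //; rewrite -sg ltn_modp.
by apply: (maxidealMl hO) => //; exact: (point_horner hO).
Qed.

(** This bounds the ramification by n: the values of u 0, u 1, ... decrease strictly from v(g) and
    stay positive. In a primitive relation between u 1, ..., u (n+1), the last term whose
    coefficient is prime to g has the strictly smallest value: earlier ones have a larger u, later
    ones gain v(g). *)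
Lemma chain_false (g : {poly k}) (u : nat -> K) : (1 < size g)%N ->
  (forall b, ~~ (g %| b) -> ~ m (ev b)) ->
  u 0 = ev g -> (forall i, m (u i)) -> (forall i, u i != 0) ->
  (forall i, m (u i / u i.+1)) -> False.
Proof.
move=> sg gP u0E mu u0 mr.
have mr' i j : (i < j)%N -> m (u i / u j).
  elim: j => // j IH; rewrite ltnS leq_eqVlt => /orP[/eqP->//|ij].
  have -> : u i / u j.+1 = (u i / u j) * (u j / u j.+1) by field; rewrite !u0.
  by apply: (maxidealMr hO); [exact: maxideal_sub|exact: IH].
have [a [[i ai] E]] := primitive_dep (fun i => u i.+1) sg.
case: (@arg_maxnP _ i (fun i => ~~ (g %| a i)) val ai) => j aj jmax.
apply: (gP _ aj); rewrite (bigD1 j) //= in E.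
move/eqP: E; rewrite addr_eq0 => /eqP E.
have -> : ev (a j) = - \sum_(l < n.+1 | l != j) ev (a l) * (u l.+1 / u j.+1).
  apply: (mulIf (u0 j.+1)); rewrite E mulNr; congr (- _).
  by rewrite mulr_suml; apply: eq_bigr => l _; rewrite -!mulrA mulVf ?u0 // mulr1.
apply/(maxidealN hO)/(maxideal_sum hO) => l lj.
have [jl|lj'] := ltnP j l; last first.
  apply: (maxidealMl hO); first exact: (point_horner hO).
  by apply: mr'; rewrite ltnS ltn_neqAle lj' andbT; exact: lj.
have /divpK <- : g %| a l.
  by apply: contraTT jl => /jmax H; rewrite -leqNgt; exact: H.
rewrite rmorphM hornerM -mulrA; apply: (maxidealMl hO); first exact: (point_horner hO).
rewrite mulrCA; apply: (maxidealMl hO); last by rewrite -u0E; exact: mr'.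
exact: (maxideal_sub (mu _)).
Qed.

(** If [m] were not principal, choice would build an infinite chain as in [chain_false]. A generator
    t has finite order at g(y) by the same lemma, hence at every polynomial in y, and hence at every
    integral z, which divides the lowest nonzero coefficient of a relation between its powers. *)
Lemma dvr_of_coord : exists t, local_param O t.
Proof.
have [g [sg mg gP]] := residue_poly.
have g0 : g != 0 by rewrite -size_poly_gt0 (ltn_trans _ sg).
have [t [mt t0 tP]] : exists t, [/\ m t, t != 0 & forall x, m x -> O (x / t)].
  apply: contrapT => H.
  have step u : exists x, m u -> u != 0 -> m x /\ ~ O (x / u).
    have [|nmu] := pselect (m u); last by exists 0.
    have [->|u0 mu] := eqVneq u 0; first by exists 0.
    apply: contrapT => H'; apply: H; exists u; split => // x mx.
    apply: contrapT => nO; apply: H'; exists x => _ _; by split.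
  have [f fP] := choice step.
  pose u i := iter i f (ev g).
  have uP i : m (u i) /\ u i != 0.
    elim: i => [|i [mi i0]]; first by split => //; exact: dep.1.
    have [mf nO] := fP _ mi i0; split=> //; apply: contra_notN nO.
    by move/eqP; rewrite /u /= => ->; rewrite mul0r; exact: (point0 hO).
  apply: (@chain_false g u) => //; try by move=> i; case: (uP i).
  move=> i; have [mi i0] := uP i; have [_ nO] := fP _ mi i0.
  by rewrite -[_ / _]invrK invf_div; exact: (notpoint_inv hO).
have tX i : t ^+ i != 0 by rewrite expf_neq0.
have strip x : O x -> (exists i, ~ m (x / t ^+ i)) ->
    exists i, O (x / t ^+ i) /\ ~ m (x / t ^+ i).
  move=> Ox; case=> i; elim: i => [|i IH] nm.
    by exists 0%N; split => //; rewrite expr0 divr1.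
  have [mi|] := pselect (m (x / t ^+ i)); last exact: IH.
  exists i.+1; split=> //; have := tP _ mi.
  by rewrite exprSr invfM mulrA mulrAC -mulrA mulrC -mulrA mulrCA mulrA.
have [e [Oe nme]] : exists i, O (ev g / t ^+ i) /\ ~ m (ev g / t ^+ i).
  apply: strip; first exact: maxideal_sub.
  apply: contrapT => H.
  have mg' i : m (ev g / t ^+ i) by apply: contrapT => ?; apply: H; exists i.
  apply: (@chain_false g (fun i => ev g / t ^+ i)) => //.
  - by rewrite expr0 divr1.
  - by move=> i; rewrite mulf_neq0 ?invr_neq0 //; exact: dep.1.
  move=> i; have -> // : ev g / t ^+ i / (ev g / t ^+ i.+1) = t.
  by rewrite exprS; field; rewrite tX (dep.1 _ g0) t0.
have evE (p : {poly k}) : p != 0 -> exists j, ~ m (ev p / t ^+ j).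
  have [s] := ubnP (size p); elim: s p => // s IH p; rewrite ltnS => sp p0.
  have [dv|nd] := boolP (g %| p); last by exists 0%N; rewrite expr0 divr1; exact: gP.
  have q0 : p %/ g != 0 by rewrite dvdp_div_eq0.
  have [|j nm] := IH _ _ q0.
    rewrite (leq_trans _ sp) // size_divp // ltn_subrL size_poly_gt0 p0 andbT.
    by rewrite -ltnS prednK // (ltn_trans _ sg).
  exists (j + e)%N; rewrite -{1}(divpK dv) rmorphM hornerM exprD.
  have -> : ev (p %/ g) * ev g / (t ^+ j * t ^+ e)
    = (ev g / t ^+ e) * (ev (p %/ g) / t ^+ j) by field; rewrite !tX.
  move=> H; apply: nm.
  have ge0 : ev g / t ^+ e != 0 by exact: (unit_neq0 hO).
  have := maxidealMl hO (unit_inv hO Oe nme) H.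
  by rewrite (mulKf ge0).
exists t; split=> //.
have main z : z != 0 -> O z -> exists j : nat, O (z / t ^+ j) /\ ~ m (z / t ^+ j).
  move=> z0 Oz; apply: strip => //.
  have [a [[i ai0] E]] := dep.2 (fun i => z ^+ i).
  case: (@arg_minnP _ i (fun i => a i != 0) val ai0) => j aj0 jmin.
  have [d nd] := evE _ aj0.
  exists d => mz; apply: nd.
  rewrite (bigD1 j) //= in E; move/eqP: E; rewrite addr_eq0 => /eqP E.
  pose w := - \sum_(l < n.+1 | l != j) ev (a l) * z ^+ (l - j).-1.
  have Ow : O w.
    apply/(pointN hO)/(point_sum hO) => l _.
    by apply: (pointM hO); [exact: (point_horner hO)|exact: (pointX hO)].
  have -> : ev (a j) = z * w.
    apply: (mulIf (expf_neq0 j z0)); rewrite E mulrN mulNr; congr (- _).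
    rewrite mulr_sumr mulr_suml; apply: eq_bigr => l lj.
    have [->|al0] := eqVneq (a l) 0; first by rewrite map_poly0 horner0 !(mul0r, mulr0).
    have jl : (j < l)%N by rewrite ltn_neqAle eq_sym lj; exact: jmin.
    have -> : z ^+ l = z * z ^+ (l - j).-1 * z ^+ j.
      by rewrite -exprS -exprD prednK ?subn_gt0 // subnK // ltnW.
    by rewrite [in RHS]mulrCA !mulrA.
  by rewrite mulrAC; exact: (maxidealMr hO).
move=> z z0; case: (pointV hO z) => Oz.
  by have [j ?] := main _ z0 Oz; exists j%:Z.
have [j [Oj nj]] := main _ (invr_neq0 z0) Oz.
exists (- j%:Z); rewrite -exprnN invrK.
have E : z * t ^+ j = (z^-1 / t ^+ j)^-1 by rewrite invfM !invrK.
rewrite E; split; first exact: (unit_inv hO).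
by apply: inv_unit; rewrite ?invrK // invr_neq0 // (unit_neq0 hO nj).
Qed.

End Fixed.
End Dvr.

Lemma dvr (k K : fieldType) (h : {rmorphism k -> K}) y n (dep : poly_dep h y n)
  (O : set K) : is_point h O -> exists t, local_param O t.
Proof.
move=> hO; case: (pointV hO y) => Oy; first exact: (dvr_of_coord dep hO Oy).
exact: (dvr_of_coord (poly_depV dep) hO Oy).
Qed.

Lemma eventually_all (T : eqType) (s : seq T) (Q : T -> nat -> Prop) :
  (forall x, x \in s -> exists N, forall r, (N <= r)%N -> Q x r) ->
  exists N, forall x, x \in s -> forall r, (N <= r)%N -> Q x r.
Proof.
elim: s => [_|x s IH H]; first by exists 0%N.
have [|N1 H1] := IH; first by move=> y ys; apply: H; rewrite inE ys orbT.
have [N2 H2] := H x (mem_head _ _).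
exists (maxn N1 N2) => y; rewrite inE => ys r; rewrite geq_max => /andP[? ?].
by move: ys => /orP[/eqP->|?]; [exact: H2|exact: H1].
Qed.

(** * Approximation and finiteness of poles *)

Section Approximation.
Variables (k K : fieldType) (h : {rmorphism k -> K}).

(** A discrete valuation ring is a maximal proper subring: an x outside [O] is a unit times t^-j
    with j > 0, so [O'] would contain t^-1 and with it the whole field. *)
Lemma point_maximal (O O' : set K) t : is_point h O -> local_param O t ->
  is_point h O' -> (forall x, O x -> O' x) -> O = O'.
Proof.
move=> hO [t0 mt tP] hO' sub; apply/seteqP; split => // x O'x; apply: contrapT => nOx.
have x0 : x != 0 by apply: contra_notN nOx => /eqP->; exact: (point0 hO).
have [z nO'z] : exists z, ~ O' z by case: hO'.
have tV : O' t^-1.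
  have [[j|j] [Oj nj]] := tP _ x0.
    exfalso; apply: nOx; rewrite -[x](divfK (expfz_neq0 j t0)).
    by apply: (pointM hO) => //; apply: (pointX hO); exact: maxideal_sub.
  have tj : O' (t ^ (Negz j)).
    have e0 := unit_neq0 hO nj.
    have -> : t ^ Negz j = x * (x / t ^ Negz j)^-1 by rewrite invf_div mulrC divfK.
    apply: (pointM hO') => //.
    by apply/sub/(unit_inv hO).
  have -> : t^-1 = t ^+ j * t ^ (Negz j).
    by rewrite NegzE -exprnN exprSr; field; rewrite t0 expf_neq0.
  by apply: (pointM hO') => //; apply/sub/(pointX hO); exact: maxideal_sub.
have z0 : z != 0 by apply: contra_notN nO'z => /eqP->; exact: (point0 hO').
have [j [Oj _]] := tP _ z0; apply: nO'z.
rewrite -[z](divfK (expfz_neq0 j t0)); apply: (pointM hO'); first exact: sub.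
case: j {Oj} => j; first by apply: (@pointX _ _ _ _ hO' t j); apply: sub; exact: (maxideal_sub mt).
by rewrite NegzE -exprnN -exprVn; exact: (pointX hO').
Qed.

Variables (y : K) (n : nat).
Hypothesis dep : poly_dep h y n.
Local Notation ev p := (map_poly h p).[y].

Lemma point_incomparable (O O' : set K) : is_point h O -> is_point h O' ->
  O <> O' -> exists2 a, O a & ~ O' a.
Proof.
move=> hO hO' ne; apply: contrapT => H; apply: ne.
have [t tP] := dvr dep hO.
apply: (point_maximal hO tP hO') => x Ox.
by apply: contrapT => nx; apply: H; exists x.
Qed.

(* The exponent [r] below fails for at most one value at each place of [s]. *)
Lemma approximation (O1 : set K) (s : seq (set K)) : is_point h O1 ->
  (forall O, O \in s -> is_point h O /\ O1 <> O) ->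
  exists z, maxideal O1 z /\ forall O, O \in s -> ~ O z.
Proof.
move=> h1; elim: s => [_|O s IH H]; first by exists 0; split => //; exact: (maxideal0 h1).
have [hO ne] := H O (mem_head _ _).
have [|z [mz zP]] := IH; first by move=> O' O's; apply: H; rewrite inE O's orbT.
have [Oz|nOz] := pselect (O z); last by exists z; split => // O'; rewrite inE => /orP[/eqP->//|]; exact: zP.
have [a O1a nOa] := point_incomparable h1 hO ne.
have [b Ob nO1b] := point_incomparable hO h1 (nesym ne).
have b0 : b != 0 by apply: contra_notN nO1b => /eqP->; exact: (point0 h1).
pose c := a / b.
have mc : maxideal O1 c by apply: (maxidealMl h1) => //; exact: (notpoint_inv h1).
have nc : ~ O c.
  by move=> Oc; apply: nOa; rewrite -(divfK b0 a); exact: (pointM hO).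
have nX O' r : is_point h O' -> ~ O' c -> ~ O' (c ^+ r.+1).
  move=> h' nO' O'c; have c0 : c != 0 by apply: contra_notN nO' => /eqP->; exact: (point0 h').
  apply: (maxideal_inv _ _ (O := O') (x := c^-1 ^+ r.+1)).
  - by rewrite expf_neq0 // invr_neq0.
  - by apply: (maxidealXS h'); exact: (notpoint_inv h').
  - by rewrite exprVn invrK.
have [N NP] : exists N, forall O', O' \in s -> forall r, (N <= r)%N -> ~ O' (z + c ^+ r.+1).
  apply: eventually_all => O' O's.
  have [h' _] : is_point h O' /\ O1 <> O' by apply: H; rewrite inE O's orbT.
  have [[r0 Hr0]|H'] := pselect (exists r, O' (z + c ^+ r.+1)); last first.
    by exists 0%N => r _ Hr; apply: H'; exists r.
  have nO'X : ~ O' (c ^+ r0.+1).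
    by move=> ?; apply: (zP _ O's); rewrite -(addrK (c ^+ r0.+1) z); exact: (pointB h').
  have nO'c : ~ O' c by move=> ?; apply: nO'X; exact: (pointX h').
  have c0 : c != 0 by apply: contra_notN nO'c => /eqP->; exact: (point0 h').
  exists r0.+1 => r rr Hr; apply: (nX O' r h' nO'c).
  have := pointB h' Hr Hr0; rewrite opprD addrACA subrr add0r => D.
  pose w := 1 - c^-1 ^+ (r - r0).
  have Ow : O' w.
    apply: (pointB h'); first exact: (point1 h').
    by apply: (pointX h'); apply: maxideal_sub; exact: (notpoint_inv h').
  have nw : ~ maxideal O' w.
    apply: (unitD h'); first exact: (maxideal1 h').
    apply: (maxidealN h'); rewrite -(subnSK rr) exprS.
    apply: (maxidealMr h'); last exact: (notpoint_inv h').
    by apply: (pointX h'); apply: maxideal_sub; exact: (notpoint_inv h').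
  have w0 := unit_neq0 h' nw.
  have -> : c ^+ r.+1 = (c ^+ r.+1 - c ^+ r0.+1) / w.
    apply: (mulIf w0); rewrite divfK // /w mulrBr mulr1; congr (_ - _).
    have -> : c ^+ r.+1 = c ^+ r0.+1 * c ^+ (r - r0).
      by rewrite -exprD addSn subnKC // ltnW.
    by rewrite -mulrA -exprMn divff // expr1n mulr1.
  by apply: (pointM h') => //; exact: (unit_inv h').
exists (z + c ^+ N.+1); split.
  by apply: (maxidealD h1) => //; exact: (maxidealXS h1).
move=> O'; rewrite inE => /orP[/eqP->|O's]; last exact: NP.
by move=> D; apply: (nX O N hO nc); rewrite -(addKr z (c ^+ _)) addrC; exact: (pointB hO).
Qed.

(** At most n points lie over g. Given n + 1 of them, the functions (1 + z i)^-1 take the value 1 at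
    [P i] and vanish at the others; a primitive relation between them, reduced at [P i], puts a
    coefficient prime to g into the maximal ideal. *)
Lemma points_over_irreducible (g : {poly k}) : irreducible_poly g ->
  finite_set [set O | [/\ is_point h O, O y & maxideal O (ev g)]].
Proof.
move=> irr; apply: contrapT => /(@infinite_set_fset _ _ n.+1)[B BS nB].
pose P (i : 'I_n.+1) := nth set0 (finmap.enum_fset B) i.
have PB i : P i \in finmap.enum_fset B by apply: mem_nth; rewrite (leq_trans (ltn_ord i)).
have PS i := BS _ (PB i).
have Pinj i j : P i = P j -> i = j.
  move/eqP; rewrite /P nth_uniq ?finmap.fset_uniq ?(leq_trans (ltn_ord _)) //.
  by move/eqP/val_inj.
have ex i : exists z, maxideal (P i) z /\ forall j, j != i -> ~ P j z.
  have [hi _ _] := PS i.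
  have [|z [mz zP]] := @approximation (P i) [seq P j | j <- enum 'I_n.+1 & j != i] hi.
    move=> O /mapP[j]; rewrite mem_filter => /andP[ji _] ->.
    by have [hj _ _] := PS j; split=> // /Pinj E; rewrite E eqxx in ji.
  exists z; split=> // j ji; apply: zP; apply: map_f.
  by rewrite mem_filter ji mem_enum.
have [z zP] := choice ex.
have [a [[i ndi] E]] := primitive_dep dep (fun i => (1 + z i)^-1) irr.1.
have [hi Oy mg] := PS i.
have ni : ~ maxideal (P i) (1 + z i).
  by apply: (unitD hi); [exact: (maxideal1 hi)|case: (zP i)].
have : maxideal (P i) (ev (a i) * (1 + z i)^-1).
  move/eqP: E; rewrite (bigD1 i) //= addr_eq0 => /eqP ->.
  apply/(maxidealN hi)/(maxideal_sum hi) => j ji.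
  apply: (maxidealMl hi); first exact: (point_horner hi).
  apply: (notpoint_inv hi) => D; have [_ /(_ i)] := zP j; apply; first by rewrite eq_sym.
  by rewrite -(addKr 1 (z j)) addrC; apply: (pointB hi) => //; exact: (point1 hi).
move=> mi; have {mi} mi : maxideal (P i) (ev (a i)).
  rewrite -(divfK (unit_neq0 hi ni) (ev (a i))); apply: (maxidealMr hi) => //.
  by apply: (pointD hi); [exact: (point1 hi)|apply: maxideal_sub; case: (zP i)].
have := ndi; rewrite -irreducible_poly_coprime // => /Bezout_eq1_coprimepP[[u v] /= uv].
apply: (maxideal1 hi).
have -> : 1 = ev u * ev g + ev v * ev (a i).
  by rewrite -!hornerM -!rmorphM -hornerD -rmorphD uv rmorph1 hornerC.
by apply: (maxidealD hi); apply: (maxidealMl hi) => //; exact: (point_horner hi).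
Qed.

Lemma points_over_poly (g : {poly k}) : g != 0 ->
  finite_set [set O | [/\ is_point h O, O y & maxideal O (ev g)]].
Proof.
have [s] := ubnP (size g); elim: s g => // s IH g; rewrite ltnS => sg g0.
have [irr|nirr] := pselect (irreducible_poly g); first exact: points_over_irreducible.
have [s1|s1] := leqP (size g) 1.
  have -> : [set O | [/\ is_point h O, O y & maxideal O (ev g)]] = set0; last exact: finite_set0.
  apply/seteqP; split => // O [hO _]; rewrite (size1_polyC s1) map_polyC hornerC.
  apply: (maxideal_const hO); apply: contraNneq g0 => E.
  by rewrite (size1_polyC s1) E.
have [q [qs qg nq]] : exists q : {poly k}, [/\ size q != 1%N, q %| g & ~~ (q %= g)].
  apply: contrapT => H; apply: nirr; split=> // q sq qg.
  by apply: contrapT => /negP ?; apply: H; exists q.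
have E := divpK qg.
have q0 : q != 0 by apply: contraNneq g0 => q0; rewrite -E q0 mulr0.
have r0 : g %/ q != 0 by rewrite dvdp_div_eq0.
have szq : (size q < size g)%N.
  by rewrite ltn_neqAle dvdp_leq // andbT dvdp_size_eqp.
have szr : (size (g %/ q)%R < size g)%N.
  rewrite size_divp // ltn_subrL size_poly_gt0 g0 andbT.
  by move: qs q0; rewrite -size_poly_gt0; case: (size q) => [|[]].
apply: (@sub_finite_set _ _ ([set O | [/\ is_point h O, O y & maxideal O (ev q)]] `|`
    [set O | [/\ is_point h O, O y & maxideal O (ev (g %/ q))]])%classic).
  move=> O [hO Oy]; rewrite -{1}E rmorphM hornerM => /(maxidealM hO) H.
  by case: H; [exact: (point_horner hO)..| | ]; [right|left].
rewrite finite_setU; split; apply: IH => //; exact: leq_trans sg.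
Qed.

Lemma finite_poles_of_coord z :
  finite_set [set O | [/\ is_point h O, O y & ~ O z]].
Proof.
have [b b0 bP] := pole_poly dep z.
by apply: sub_finite_set (points_over_poly b0) => O [hO Oy nz]; split=> //; exact: bP.
Qed.

End Approximation.

Lemma finite_poles (k K : fieldType) (h : {rmorphism k -> K}) y n
  (dep : poly_dep h y n) z : finite_set [set O | is_point h O /\ ~ O z].
Proof.
apply: (@sub_finite_set _ _ ([set O | [/\ is_point h O, O y & ~ O z]] `|`
    [set O | [/\ is_point h O, O y^-1 & ~ O z]])%classic).
  by move=> O [hO nz]; case: (pointV hO y) => ?; [left|right].
rewrite finite_setU; split; first exact: (finite_poles_of_coord dep).
exact: (finite_poles_of_coord (poly_depV dep)).
Qed.

Lemma eventually_fin (I : finType) (Q : I -> nat -> Prop) :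
  (forall x, exists N, forall r, (N <= r)%N -> Q x r) ->
  exists N, forall x r, (N <= r)%N -> Q x r.
Proof.
move=> H; have [|N NP] := @eventually_all _ (enum I) Q; first by move=> x _.
by exists N => x; apply: NP; rewrite mem_enum.
Qed.

Lemma eventually_finite_set (T : choiceType) (S : set T) (Q : T -> nat -> Prop) :
  finite_set S -> (forall x, S x -> exists N, forall r, (N <= r)%N -> Q x r) ->
  exists N, forall x, S x -> forall r, (N <= r)%N -> Q x r.
Proof.
move=> fS H; have mS x : S x -> x \in finmap.enum_fset (fset_set S).
  by move=> Sx; rewrite in_fset_set // inE.
have [x|N NP] := @eventually_all _ (finmap.enum_fset (fset_set S)) Q.
  by rewrite in_fset_set // inE; exact: H.
by exists N => x /mS; exact: NP.
Qed.

(** * Lattices and locally free sheaves *)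

Definition intvec (K : fieldType) (O : set K) n : set 'rV[K]_n :=
  [set v | forall j, O (v 0 j)].

(** [B] is the coordinate matrix: [M] is free on the rows of [invmx B]. In this form preimages and
    pullbacks of lattices are matrix products. *)
Definition is_lattice (K : fieldType) (O : set K) n (M : set 'rV[K]_n) : Prop :=
  exists2 B : 'M[K]_n, B \in unitmx & forall v, M v <-> intvec O (v *m B).

Section Lattices.
Variables (k K : fieldType) (h : {rmorphism k -> K}) (O : set K).
Hypothesis hO : is_point h O.

Lemma intvec0 n : @intvec K O n 0.
Proof. by move=> j; rewrite mxE; exact: (point0 hO). Qed.
Lemma intvecD n (v w : 'rV_n) : intvec O v -> intvec O w -> intvec O (v + w).
Proof. by move=> H1 H2 j; rewrite mxE; exact: (pointD hO). Qed.
Lemma intvecZ n a (v : 'rV_n) : O a -> intvec O v -> intvec O (a *: v).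
Proof. by move=> H1 H2 j; rewrite mxE; exact: (pointM hO). Qed.
Lemma intvec_mul n p (v : 'rV_n) (A : 'M_(n, p)) :
  (forall i j, O (A i j)) -> intvec O v -> intvec O (v *m A).
Proof.
move=> OA Ov j; rewrite mxE; apply: (point_sum hO) => i _.
by apply: (pointM hO).
Qed.

(** Divisibility is a total order in a valuation ring; the index found is that of an entry of least
    value. *)
Lemma max_entry (I : finType) (x : I -> K) : (exists i, x i != 0) ->
  exists i, x i != 0 /\ forall l, O (x l / x i).
Proof.
case=> i0 xi0.
have [i [xi H]] : exists i, x i != 0 /\ forall l, l \in enum I -> O (x l / x i).
  elim: (enum I) => [|l s [i [xi IH]]]; first by exists i0.
  case: (pointV hO (x l / x i)) => Ol.
    by exists i; split=> // l'; rewrite inE => /orP[/eqP->|/IH].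
  have [xl|xl] := eqVneq (x l) 0.
    exists i; split=> // l'; rewrite inE => /orP[/eqP->|/IH//].
    by rewrite xl mul0r; exact: (point0 hO).
  exists l; split=> // l'; rewrite inE => /orP[/eqP->|/IH Ol'].
    by rewrite divff //; exact: (point1 hO).
  have -> : x l' / x l = (x l' / x i) * (x l / x i)^-1 by field; rewrite xl xi.
  exact: (pointM hO).
by exists i; split=> // l; apply: H; rewrite mem_enum.
Qed.

Lemma clear_denominators n (v : 'rV[K]_n) : exists2 c, c != 0 & intvec O (c *: v).
Proof.
have [[j vj]|H] := pselect (exists j, v 0 j != 0).
  have [|i [vi iP]] := @max_entry _ (fun j => v 0 j); first by exists j.
  by exists (v 0 i)^-1; [rewrite invr_neq0|move=> l; rewrite mxE mulrC].
exists 1; rewrite ?oner_neq0 // => j; rewrite scale1r.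
have [->|vj] := eqVneq (v 0 j) 0; first exact: (point0 hO).
by exfalso; apply: H; exists j.
Qed.

Section Lattice.
Variables (n : nat) (M : set 'rV[K]_n).
Hypothesis latM : is_lattice O M.

Lemma lattice0 : M 0.
Proof. by case: latM => B _ ->; rewrite mul0mx; exact: intvec0. Qed.
Lemma latticeD v w : M v -> M w -> M (v + w).
Proof. by case: latM => B _ H /H ? /H ?; apply/H; rewrite mulmxDl; exact: intvecD. Qed.
Lemma latticeZ a v : O a -> M v -> M (a *: v).
Proof. by case: latM => B _ H ? /H ?; apply/H; rewrite -scalemxAl; exact: intvecZ. Qed.
Lemma lattice_sum I (r : seq I) (Q : pred I) (f : I -> 'rV_n) :
  (forall i, Q i -> M (f i)) -> M (\sum_(i <- r | Q i) f i).
Proof. by move=> H; elim/big_ind : _ => //; [exact: lattice0|exact: latticeD]. Qed.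
Lemma lattice_denominator v : exists2 c, c != 0 & M (c *: v).
Proof.
case: latM => B _ H; have [c c0 cP] := clear_denominators (v *m B).
by exists c => //; apply/H; rewrite -scalemxAl.
Qed.
Lemma lattice_inj p (A : 'M_(n, p)) : (forall v, M v -> v *m A = 0 -> v = 0) ->
  forall v : 'rV_n, v *m A = 0 -> v = 0.
Proof.
move=> H v vA; have [c c0 Mc] := lattice_denominator v.
have := H _ Mc; rewrite -scalemxAl vA scaler0 => /(_ erefl)/eqP.
by rewrite scaler_eq0 (negbTE c0) => /eqP.
Qed.
End Lattice.

(** Gaussian elimination over a valuation ring. The pivot is an entry of least value in the top row,
    so that this row is [a 0 j] times an integral vector [a1]; subtracting multiples of [a1] clears
    column j below. Integrality of v A then splits into that of its entry j and that of v' A''. *)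
Lemma integral_preimage p n (A : 'M[K]_(p, n)) :
  (forall v : 'rV_p, v *m A = 0 -> v = 0) ->
  is_lattice O [set v | intvec O (v *m A)].
Proof.
elim: p A => [|p IH] A injA.
  exists 1%:M; first exact: unitmx1.
  by move=> v; rewrite /= [v]thinmx0 mul0mx; split=> _; [case|exact: intvec0].
move: A injA; rewrite -[p.+1]/(1 + p)%N => A injA.
have [a [A' AE]] : exists a A', A = col_mx a A'.
  by exists (usubmx A), (dsubmx A); rewrite vsubmxK.
have [|j [aj jmax]] := @max_entry _ (fun j => a 0 j).
  apply: contrapT => H; have a0 : a = 0.
    apply/rowP => j; rewrite mxE; apply/eqP/negPn/negP => ?; apply: H; by exists j.
  have := injA (row_mx 1%:M 0); rewrite AE mul_row_col a0 mulmx0 mul0mx addr0.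
  move=> /(_ erefl)/(congr1 lsubmx); rewrite row_mxKl => /rowP /(_ 0).
  by rewrite !mxE eqxx => /eqP; rewrite oner_eq0.
pose c := col j A'; pose a1 := (a 0 j)^-1 *: a.
have aE : a = a 0 j *: a1 by rewrite scalerA divff // scale1r.
have a1j : a1 0 j = 1 by rewrite mxE mulVf.
have Oa1 : intvec O a1 by move=> l; rewrite mxE mulrC.
pose A'' := A' - c *m a1.
have A''j : col j A'' = 0.
  by apply/colP => i; rewrite !mxE big_ord1 !mxE mulVf // mulr1 subrr.
have vE (v0 : 'rV_1) (v' : 'rV_p) :
    row_mx v0 v' *m A = (v0 *m (a 0 j)%:M + v' *m c) *m a1 + v' *m A''.
  rewrite AE mul_row_col {1}aE mulmxDl mulmxBr mulmxA addrA addrAC addrK.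
  by rewrite mul_mx_scalar -scalemxAl scalemxAr.
have [|G uG GP] := IH A''.
  move=> v' v'0; have := injA (row_mx (- (a 0 j)^-1 *: (v' *m c)) v').
  rewrite vE v'0 addr0 mul_mx_scalar scalerA mulrN divff // scaleN1r addNr mul0mx.
  by move=> /(_ erefl)/(congr1 rsubmx); rewrite row_mxKr => ->; rewrite raddf0.
exists (block_mx (a 0 j)%:M 0 c G).
  by rewrite unitmxE det_lblock det_scalar expr1 unitrM -unitmxE uG unitfE aj.
move=> v; rewrite /= -[v]hsubmxK vE mul_row_block mulmx0 add0r.
move: (lsubmx v) (rsubmx v) => v0 v'.
set s := v0 *m _ + _.
have jE : (s *m a1 + v' *m A'') 0 j = s 0 0.
  rewrite mxE -[X in _ + X]/((v' *m A'') 0 j).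
  have -> : (v' *m A'') 0 j = 0.
    rewrite mxE big1 // => i _; have /colP /(_ i) := A''j.
    by rewrite mxE [RHS]mxE => ->; rewrite mulr0.
  by rewrite addr0 mxE big_ord1 a1j mulr1.
have sE : s *m a1 = s 0 0 *: a1.
  by rewrite [in LHS](mx11_scalar s) mul_scalar_mx.
split=> H.
  have Os : O (s 0 0) by rewrite -jE; exact: H.
  have Ov' : intvec O (v' *m G).
    have E : v' *m A'' = (s *m a1 + v' *m A'') - s 0 0 *: a1.
      by rewrite sE addrC addKr.
    apply/GP; rewrite /= E -scaleNr; apply: intvecD => //; apply: intvecZ => //.
    exact: (pointN hO).
  move=> l; case: (split_ordP l) => l' ->.
    by rewrite row_mxEl ord1.
  by rewrite row_mxEr.
have Os : O (s 0 0) by have := H (lshift p 0); rewrite row_mxEl.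
apply: intvecD; first by rewrite sE; exact: intvecZ.
by apply/GP => l; have := H (rshift 1 l); rewrite row_mxEr.
Qed.

Lemma lattice_preimage p n (M : set 'rV[K]_n) (A : 'M[K]_(p, n)) :
  is_lattice O M -> (forall v : 'rV_p, v *m A = 0 -> v = 0) ->
  is_lattice O [set v | M (v *m A)].
Proof.
move=> [B uB H] injA; have [|G uG GP] := @integral_preimage _ _ (A *m B).
  move=> v; rewrite mulmxA => /(congr1 (mulmx^~ (invmx B))) /=.
  by rewrite mulmxK // mul0mx; exact: injA.
by exists G => // v; rewrite -GP /= H mulmxA.
Qed.

End Lattices.

Section LocallyFree.
Variables (k K : fieldType) (h : {rmorphism k -> K}) (y : K) (d : nat).
Hypothesis dep : poly_dep h y d.

Lemma finite_exists (I : finType) (T : Type) (Q : I -> set T) :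
  (forall i, finite_set (Q i)) -> finite_set [set P | exists i, Q i P].
Proof.
move=> H; apply: (@sub_finite_set _ _ (\bigcup_(i in [set: I]) Q i)).
  by move=> P [i Pi]; exists i.
by apply: bigcup_finite => //; exact: finite_finset.
Qed.

Lemma finite_poles_mx m n (A : 'M[K]_(m, n)) :
  finite_set [set P | is_point h P /\ exists i j, ~ P (A i j)].
Proof.
apply: (@sub_finite_set _ _ [set P | exists ij : 'I_m * 'I_n,
    [set P | is_point h P /\ ~ P (A ij.1 ij.2)] P]).
  by move=> P [hP [i [j nP]]]; exists (i, j).
by apply: finite_exists => ij; exact: (finite_poles dep).
Qed.

Lemma finite_nonunit n (B : 'M[K]_n) : B \in unitmx ->
  finite_set [set P | is_point h P /\ ~ (forall v, intvec P (v *m B) <-> intvec P v)].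
Proof.
move=> uB; apply: (@sub_finite_set _ _ (
    [set P | is_point h P /\ exists i j, ~ P (B i j)] `|`
    [set P | is_point h P /\ exists i j, ~ P ((invmx B) i j)])); last first.
  by rewrite finite_setU; split; exact: finite_poles_mx.
move=> P [hP H].
have [HB|HB] := pselect (exists i j, ~ P (B i j)); [by left|right].
split=> //; apply: contrapT => HB'; apply: H => v; split; last first.
  by apply: (intvec_mul hP) => i j; apply: contrapT => ?; apply: HB; exists i, j.
rewrite -{2}(mulmxK uB v).
by apply: (intvec_mul hP) => i j; apply: contrapT => ?; apply: HB'; exists i, j.
Qed.

(** A local basis at a single point agrees with the standard basis away from the poles of its matrix
    and of the inverse matrix. Local freeness thus becomes a condition at each point plus a
    finiteness statement. *)
Lemma locally_freeP n (M : sheaf K n) : locally_free h M <->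
  (forall P, is_point h P -> is_lattice P (M P)) /\
  finite_set [set P | is_point h P /\ ~ (forall v, M P v <-> intvec P v)].
Proof.
have imE P (B : 'M[K]_n) : B \in unitmx -> forall v,
    [set a *m B | a in [set a : 'rV[K]_n | forall j, P (a 0 j)]] v <->
    intvec P (v *m invmx B).
  move=> uB v; split=> [[a Pa <-]|H]; first by rewrite mulmxK.
  by exists (v *m invmx B) => //; rewrite mulmxKV.
split=> [lf|[lat fin]].
  split=> [P hP|].
    have [B [Z [uB _ nZ MP]]] := lf P hP.
    exists (invmx B); first by rewrite unitmx_inv.
    by move=> v; rewrite MP // imE.
  have [[P0 hP0]|H] := pselect (exists P, is_point h P); last first.
    apply: (@sub_finite_set _ _ set0) => // P [hP _]; exfalso; apply: H; by exists P.
  have [B [Z [uB fZ _ MP]]] := lf P0 hP0.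
  have uB' : invmx B \in unitmx by rewrite unitmx_inv.
  apply: (@sub_finite_set _ _ (Z `|`
    [set P | is_point h P /\ ~ (forall v, intvec P (v *m invmx B) <-> intvec P v)])); last first.
    by rewrite finite_setU; split=> //; exact: finite_nonunit.
  move=> P [hP H]; have [?|nZ] := pselect (Z P); [by left|right].
  split=> // H'; apply: H => v; rewrite -H' MP // imE //.
move=> P hP; have [B uB BP] := lat P hP.
have uB' : invmx B \in unitmx by rewrite unitmx_inv.
(* [P] is removed from the exceptional set: there [B] is a basis by choice, even if neither [M P]
   nor [B] is standard. *)
exists (invmx B), (([set P | is_point h P /\ ~ (forall v, M P v <-> intvec P v)] `|`
  [set P | is_point h P /\ ~ (forall v, intvec P (v *m B) <-> intvec P v)]) `&`
  [set P' | P' <> P]); split=> //.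
- by apply: finite_setIl; rewrite finite_setU; split=> //; exact: finite_nonunit.
- by case.
move=> P' hP' nZ; apply/seteqP; split=> v; rewrite imE // invmxK.
  have [->|ne] := pselect (P' = P); first by move/BP.
  move=> Mv; apply: contrapT => nv; apply: nZ; split => //.
  have [H|H] := pselect (forall v, M P' v <-> intvec P' v); [right|by left].
  by split=> // H'; apply: nv; apply/H'/H.
have [->|ne] := pselect (P' = P); first by move/BP.
move=> Iv; apply: contrapT => nv; apply: nZ; split => //.
have [H|H] := pselect (forall v, M P' v <-> intvec P' v); [right|by left].
by split=> // H'; apply: nv; apply/H/H'.
Qed.

End LocallyFree.

(** * Dimensions of quotients *)

Lemma ker_basis (F : fieldType) m n (G : 'M[F]_(m, n)) : row_full G ->
  exists (E : 'M_(m - n, m)) (E' : 'M_(m, m - n)),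
    [/\ E *m G = 0, E *m E' = 1%:M
      & forall p (V : 'M_(p, m)), V *m G = 0 -> V = V *m E' *m E].
Proof.
move=> fullG; have rk : \rank (kermx G) = (m - n)%N.
  by rewrite mxrank_ker (eqP fullG).
have := row_base_free (kermx G); have := eq_row_base (kermx G).
move: (row_base _); rewrite rk => E defE /row_freeP[E' EE'].
exists E, E'; split=> //.
  by apply/eqP; rewrite -sub_kermx -defE.
move=> p V /eqP; rewrite -sub_kermx -defE => /submxP[X ->].
by rewrite -(mulmxA X) EE' mulmx1.
Qed.

Section QuotientDim.
Variables (k K : fieldType) (h : {rmorphism k -> K}).

Definition ksubmod r (M : set 'rV[K]_r) : Prop :=
  [/\ M 0, forall v w, M v -> M w -> M (v + w) & forall a v, M v -> M (h a *: v)].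

Lemma ksubmodB r (M : set 'rV[K]_r) : ksubmod M -> forall v w, M v -> M w -> M (v - w).
Proof.
move=> [_ D Z] v w Mv Mw; apply: D => //.
by rewrite -scaleN1r -(rmorph1 h) -rmorphN; exact: Z.
Qed.

Lemma ksubmod_mul r n (M : set 'rV[K]_r) (b : 'M_(n, r)) (a : 'rV[k]_n) : ksubmod M ->
  (forall j, M (row j b)) -> M (map_mx h a *m b).
Proof.
move=> [M0 D Z] Mb; rewrite mulmx_sum_row.
by elim/big_ind : _ => // j _; rewrite mxE; exact: Z.
Qed.

Lemma lattice_ksubmod (O : set K) r (M : set 'rV[K]_r) : is_point h O ->
  is_lattice O M -> ksubmod M.
Proof.
move=> hO lM; split; first exact: (lattice0 hO).
  exact: (latticeD hO).
by move=> a v; apply: (latticeZ hO) => //; exact: (point_const hO).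
Qed.

(** Unique existence of coordinates is turned into spanning and independence, with the basis as the
    rows of a matrix, so that induced maps become matrices over k. *)
Lemma quotient_dimP r (N M : set 'rV[K]_r) n : ksubmod N -> ksubmod M ->
  quotient_dim h N M n <->
  exists b : 'M[K]_(n, r), [/\ forall j, N (row j b),
    forall v, N v -> exists a : 'rV[k]_n, M (v - map_mx h a *m b)
    & forall a : 'rV[k]_n, M (map_mx h a *m b) -> a = 0].
Proof.
move=> kN kM; have M0 : M 0 by case: kM.
have sumE (b : 'I_n -> 'rV[K]_r) (a : {ffun 'I_n -> k}) :
    \sum_j h (a j) *: b j = map_mx h (\row_j a j) *m (\matrix_j b j).
  by rewrite mulmx_sum_row; apply: eq_bigr => j _; rewrite !mxE rowK.
have rowE (a : 'rV[k]_n) : \row_j [ffun j0 => a 0 j0] j = a.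
  by apply/rowP => j; rewrite mxE ffunE.
split=> [[b [Nb H]]|[b [Nb H1 H2]]].
  exists (\matrix_j b j); split=> [j|v Nv|a Ma]; first by rewrite rowK.
    by have [a [Ma _]] := H v Nv; exists (\row_j a j); rewrite -sumE.
  have [|a0 [_ uniq]] := H (map_mx h a *m \matrix_j b j).
    by apply: ksubmod_mul => // j; rewrite rowK.
  have : a0 = [ffun=> 0].
    by apply: uniq; rewrite big1 ?subr0 // => j _; rewrite ffunE rmorph0 scale0r.
  rewrite (uniq [ffun j => a 0 j]); last by rewrite sumE rowE subrr.
  by move=> /ffunP E; apply/rowP => j; have := E j; rewrite !ffunE mxE.
exists (fun j => row j b); split=> // v Nv; have [a Ma] := H1 v Nv.
have bE : \matrix_j row j b = b by apply/row_matrixP => j; rewrite rowK.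
exists [ffun j => a 0 j]; split; first by rewrite sumE bE rowE.
move=> a'; rewrite sumE bE => Ma'.
have := ksubmodB kM Ma' Ma; rewrite opprB addrC addrA subrK -mulmxBl -raddfB => /H2.
by move=> /rowP E; apply/ffunP => j; have /eqP := E j; rewrite !mxE ffunE subr_eq0 => /eqP.
Qed.

Lemma quotient_dim_ext r (N M N' M' : set 'rV[K]_r) n :
  (forall v, N v <-> N' v) -> (forall v, M v <-> M' v) ->
  quotient_dim h N M n -> quotient_dim h N' M' n.
Proof.
move=> HN HM; suff [-> ->] : N = N' /\ M = M' by [].
by split; apply/seteqP; split=> v; [move/HN|move/HN|move/HM|move/HM].
Qed.

Lemma quotient_dim0 r (N : set 'rV[K]_r) : ksubmod N -> quotient_dim h N N 0.
Proof.
move=> kN; apply/quotient_dimP => //; exists 0; split=> [[]//|v Nv|a _].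
  by exists 0; rewrite mulmx0 subr0.
by rewrite [a]thinmx0.
Qed.

Lemma quotient_dim0_eq r (N M : set 'rV[K]_r) : quotient_dim h N M 0 ->
  forall v, N v -> M v.
Proof. by move=> [b [_ H]] v /H[a []]; rewrite big_ord0 subr0. Qed.

(* Dimensions are additive along [0 -> N0/M0 -> N1/M1 -> N2/M2 -> 0], the
   kernel of [g] being parametrized by [B]. *)
Lemma quotient_dim_ker r0 r1 r2 (N1 M1 : set 'rV[K]_r1) (N2 M2 : set 'rV[K]_r2)
    (B : 'M_(r0, r1)) (g : 'M_(r1, r2)) n1 n2 :
  ksubmod N1 -> ksubmod M1 -> ksubmod N2 -> ksubmod M2 ->
  (forall v, M1 v -> N1 v) ->
  (forall w, N2 w <-> exists2 v, N1 v & w = v *m g) ->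
  (forall w, M2 w <-> exists2 v, M1 v & w = v *m g) ->
  B *m g = 0 -> (forall v : 'rV_r1, v *m g = 0 -> exists w, v = w *m B) ->
  quotient_dim h N1 M1 n1 -> quotient_dim h N2 M2 n2 ->
  (n2 <= n1)%N /\
  quotient_dim h [set v | N1 (v *m B)] [set v | M1 (v *m B)] (n1 - n2).
Proof.
move=> kN1 kM1 kN2 kM2 sub1 gN gM Bg kerg.
have pre (M : set 'rV[K]_r1) : ksubmod M -> ksubmod [set v : 'rV_r0 | M (v *m B)].
  move=> [M0 MD MZ]; split; first by rewrite /= mul0mx.
    by move=> v w; rewrite /= mulmxDl; exact: MD.
  by move=> a v; rewrite /= -scalemxAl; exact: MZ.
move=> /(quotient_dimP _ kN1 kM1)[b1 [Nb1 ex1 un1]].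
move=> /(quotient_dimP _ kN2 kM2)[b2 [Nb2 ex2 un2]].
(* [G] is the matrix of the induced map N1/M1 -> N2/M2; it is surjective, and its kernel, with basis
   [E], is the quotient sought. *)
have [G GP] : exists G : 'M[k]_(n1, n2),
    forall j, M2 (row j (b1 *m g - map_mx h G *m b2)).
  have /choice[f fP] : forall j, exists a : 'rV[k]_n2,
      M2 (row j b1 *m g - map_mx h a *m b2).
    move=> j; by apply: ex2; apply/gN; exists (row j b1).
  exists (\matrix_j f j) => j.
  by rewrite raddfB /= !row_mul -map_row rowK.
have aG (a : 'rV[k]_n1) : M2 (map_mx h a *m b1 *m g - map_mx h (a *m G) *m b2).
  rewrite map_mxM -!mulmxA -mulmxBr; exact: ksubmod_mul.
have M1g v : M1 v -> M2 (v *m g) by move=> ?; apply/gM; exists v.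
have fullG : row_full G.
  apply/row_fullP.
  have /choice[f fP] : forall j, exists a : 'rV[k]_n1, a *m G = delta_mx 0 j.
    move=> j; have /gN[v Nv Ev] := Nb2 j.
    have [a Ma] := ex1 v Nv; exists a; apply/eqP; rewrite eq_sym -subr_eq0; apply/eqP/un2.
    rewrite raddfB /= mulmxBl map_delta_mx -rowE Ev.
    have [_ D _] := kM2; have := D _ _ (M1g _ Ma) (aG a).
    by rewrite mulmxBl addrA subrK.
  exists (\matrix_j f j); apply/row_matrixP => j.
  by rewrite row_mul rowK fP row1.
split; first by rewrite -(eqP fullG) rank_leq_row.
have [E [E' [EG EE' kerG]]] := ker_basis fullG.
apply/(quotient_dimP _ (pre _ kN1) (pre _ kM1)).
(* A row of [E] gives an element of N1 mapped into M2. As M2 is the image of M1, a correction by M1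
   moves this element into the kernel of g. *)
have [W WP] : exists W : 'M_(n1 - n2, r0),
    forall j, M1 (row j (W *m B - map_mx h E *m b1)).
  have /choice[f fP] : forall j, exists w : 'rV[K]_r0,
      M1 (w *m B - row j (map_mx h E *m b1)).
    move=> j; have := aG (row j E).
    rewrite -row_mul EG row0 map_mx0 mul0mx subr0 => /gM[m Mm mE].
    have [|w wE] := kerg (map_mx h (row j E) *m b1 - m).
      by rewrite mulmxBl mE subrr.
    exists w; rewrite -wE row_mul -map_row addrC addKr.
    by rewrite -sub0r; apply: (ksubmodB kM1) => //; case: kM1.
  by exists (\matrix_j f j) => j; rewrite raddfB /= row_mul rowK.
have aW (a : 'rV_(n1 - n2)) : M1 (map_mx h a *m W *m B - map_mx h (a *m E) *m b1).
  rewrite map_mxM -!mulmxA -mulmxBr; exact: ksubmod_mul.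
have [M10 M1D _] := kM1; have [_ N1D _] := kN1.
exists W; split=> [j|v Nv|a Ma].
- rewrite /= -row_mul -(subrK (map_mx h E *m b1) (W *m B)) raddfD /=.
  apply: N1D; first exact/sub1/WP.
  by rewrite row_mul -map_row; exact: ksubmod_mul.
- have [a Ma] := ex1 _ Nv.
  have aG0 : a *m G = 0.
    apply: un2; have := ksubmodB kM2 (_ : M2 0) (M1g _ Ma).
    rewrite mulmxBl -(mulmxA v) Bg mulmx0 !sub0r opprK => /(_ (let: And3 x _ _ := kM2 in x)) H.
    have := ksubmodB kM2 H (aG a).
    by rewrite opprB addrC subrK.
  have aE := kerG _ _ aG0; exists (a *m E').
  rewrite /= mulmxBl; have := ksubmodB kM1 Ma (aW (a *m E')).
  by rewrite -aE opprB addrA subrK.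
have : a *m E = 0.
  by apply: un1; have := ksubmodB kM1 Ma (aW a); rewrite opprB addrC subrK.
by move=> /(congr1 (mulmx^~ E')); rewrite -mulmxA EE' mulmx1 mul0mx.
Qed.

Lemma quotient_dim_sum r1 r2 (N1 M1 : set 'rV[K]_r1) (N2 M2 : set 'rV[K]_r2) n1 n2 :
  ksubmod N1 -> ksubmod M1 -> ksubmod N2 -> ksubmod M2 ->
  quotient_dim h N1 M1 n1 -> quotient_dim h N2 M2 n2 ->
  quotient_dim h [set v | N1 (lsubmx v) /\ N2 (rsubmx v)]
    [set v | M1 (lsubmx v) /\ M2 (rsubmx v)] (n1 + n2).
Proof.
move=> kN1 kM1 kN2 kM2.
have sumk (P1 : set 'rV[K]_r1) (P2 : set 'rV[K]_r2) : ksubmod P1 -> ksubmod P2 ->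
    ksubmod [set v | P1 (lsubmx v) /\ P2 (rsubmx v)].
  move=> [P10 P1D P1Z] [P20 P2D P2Z]; split; first by rewrite /= !raddf0.
    by move=> v w [? ?] [? ?]; rewrite /= !raddfD; split; [exact: P1D|exact: P2D].
  by move=> a v [? ?]; rewrite /= !linearZ; split; [exact: P1Z|exact: P2Z].
move=> /(quotient_dimP _ kN1 kM1)[b1 [Nb1 ex1 un1]].
move=> /(quotient_dimP _ kN2 kM2)[b2 [Nb2 ex2 un2]].
apply/(quotient_dimP _ (sumk _ _ kN1 kN2) (sumk _ _ kM1 kM2)).
have mulE (a1 : 'rV[k]_n1) (a2 : 'rV[k]_n2) :
    map_mx h (row_mx a1 a2) *m block_mx b1 0 0 b2 =
    row_mx (map_mx h a1 *m b1) (map_mx h a2 *m b2).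
  by rewrite map_row_mx mul_row_block !mulmx0 addr0 add0r.
exists (block_mx b1 0 0 b2); split=> [j|v [N1v N2v]|a].
- have [N10 _ _] := kN1; have [N20 _ _] := kN2.
  case: (split_ordP j) => i ->; rewrite /= ?rowKu ?rowKd row_row_mx row_mxKl row_mxKr.
    by rewrite row0.
  by rewrite row0.
- have [a1 Ma1] := ex1 _ N1v; have [a2 Ma2] := ex2 _ N2v.
  by exists (row_mx a1 a2); rewrite mulE /= !raddfB /= row_mxKl row_mxKr.
rewrite -[a]hsubmxK mulE /= row_mxKl row_mxKr => -[/un1 -> /un2 ->].
exact: row_mx0.
Qed.

End QuotientDim.

Lemma fsum_seq (T : choiceType) (D S : set T) (d : T -> nat) : finite_set S ->
  S `<=` D -> (forall P, D P -> d P <> 0%N -> S P) ->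
  (\sum_(P \in D) d P)%R = (\sum_(P <- finmap.enum_fset (fset_set S)) d P)%N.
Proof.
move=> fS SD supp; rewrite -(fsbig_widen S) //.
  by rewrite (fsbig_finite _ _ fS).
by move=> P [DP nS] /=; apply: contrapT => d0; apply: nS; exact: supp.
Qed.

Section Coker.
Variables (k K : fieldType) (h : {rmorphism k -> K}).

Lemma coker_dim_le r r' (M : sheaf K r) (N : sheaf K r') A n : coker_dim h M N A n ->
  forall P, is_point h P -> exists2 d, (d <= n)%N & quotient_dim h (N P) (sheaf_image M A P) d.
Proof.
move=> [d [dP fin ->]] P hP; exists (d P); last exact: dP.
have [d0|d0] := eqVneq (d P) 0%N; first by rewrite d0.
rewrite (fsum_seq fin) //; last by move=> ? [].
rewrite (big_rem P) ?leq_addr //=; rewrite in_fset_set // inE; split => //.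
exact/eqP.
Qed.

Lemma coker_dim_add r1 r1' (M1 : sheaf K r1) (N1 : sheaf K r1') A1 n1
    r2 r2' (M2 : sheaf K r2) (N2 : sheaf K r2') A2 n2
    r r' (M : sheaf K r) (N : sheaf K r') A :
  (forall P, is_point h P -> forall d1 d2,
    quotient_dim h (N1 P) (sheaf_image M1 A1 P) d1 ->
    quotient_dim h (N2 P) (sheaf_image M2 A2 P) d2 ->
    quotient_dim h (N P) (sheaf_image M A P) (d1 + d2)) ->
  coker_dim h M1 N1 A1 n1 -> coker_dim h M2 N2 A2 n2 -> coker_dim h M N A (n1 + n2).
Proof.
move=> H [d1 [d1P fin1 ->]] [d2 [d2P fin2 ->]].
have fin : finite_set ([set P | is_point h P /\ d1 P <> 0%N] `|`
  [set P | is_point h P /\ d2 P <> 0%N]) by rewrite finite_setU.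
exists (fun P => (d1 P + d2 P)%N); split=> [P hP||].
- by apply: H => //; [exact: d1P|exact: d2P].
- apply: sub_finite_set fin => P [hP /eqP]; rewrite addn_eq0 negb_and.
  by case/orP => /eqP ?; [left|right].
have sub : ([set P | is_point h P /\ d1 P <> 0%N] `|`
  [set P | is_point h P /\ d2 P <> 0%N]) `<=` [set P | is_point h P] by move=> P [] [].
have E (d : set K -> nat) : (forall P, d P <> 0%N -> d1 P <> 0%N \/ d2 P <> 0%N) ->
    (\sum_(P \in [set P | is_point h P]) d P)%R = (\sum_(P <- finmap.enum_fset
      (fset_set ([set P | is_point h P /\ d1 P <> 0%N] `|`
        [set P | is_point h P /\ d2 P <> 0%N]))) d P)%N.
  move=> H'; rewrite (fsum_seq fin sub) // => P hP /H'.
  by case; [left|right].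
rewrite !E; last 3 first.
- by move=> P /eqP; rewrite addn_eq0 negb_and; case/orP => /eqP ?; [left|right].
- by move=> P; right.
- by move=> P; left.
by rewrite big_split.
Qed.

Lemma coker_dim_sub r1 r1' (M1 : sheaf K r1) (N1 : sheaf K r1') A1 n1
    r2 r2' (M2 : sheaf K r2) (N2 : sheaf K r2') A2 n2
    r r' (M : sheaf K r) (N : sheaf K r') A :
  (forall P, is_point h P -> forall d1 d2,
    quotient_dim h (N1 P) (sheaf_image M1 A1 P) d1 ->
    quotient_dim h (N2 P) (sheaf_image M2 A2 P) d2 ->
    (d2 <= d1)%N /\ quotient_dim h (N P) (sheaf_image M A P) (d1 - d2)) ->
  coker_dim h M1 N1 A1 n1 -> coker_dim h M2 N2 A2 n2 ->
  (n2 <= n1)%N /\ coker_dim h M N A (n1 - n2).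
Proof.
move=> H [d1 [d1P fin1 ->]] [d2 [d2P fin2 ->]].
have le P : is_point h P -> (d2 P <= d1 P)%N by move=> hP; case: (H P hP _ _ (d1P P hP) (d2P P hP)).
have d20 P : is_point h P -> d2 P <> 0%N -> d1 P <> 0%N.
  by move=> hP d20 d10; have := le P hP; rewrite d10 leqn0 => /eqP.
have -> : \sum_(P \in [set P | is_point h P]) d1 P = (\sum_(P <- finmap.enum_fset
    (fset_set [set P | is_point h P /\ d1 P <> 0%N])) d1 P)%N.
  by rewrite (fsum_seq fin1) // => P [].
have -> : \sum_(P \in [set P | is_point h P]) d2 P = (\sum_(P <- finmap.enum_fset
    (fset_set [set P | is_point h P /\ d1 P <> 0%N])) d2 P)%N.
  by rewrite (fsum_seq fin1) // => [P []//|P hP ?]; split => //; exact: d20.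
have les P : P \in finmap.enum_fset (fset_set [set P | is_point h P /\ d1 P <> 0%N]) ->
    (d2 P <= d1 P)%N.
  by rewrite in_fset_set // inE => -[? _]; exact: le.
split; first by rewrite big_seq_cond [leqRHS]big_seq_cond leq_sum // => P /andP[/les].
exists (fun P => (d1 P - d2 P)%N); split=> [P hP||].
- by case: (H P hP _ _ (d1P P hP) (d2P P hP)).
- by apply: sub_finite_set fin1 => P [hP d0]; split=> // d10; apply: d0; rewrite d10.
rewrite (fsum_seq fin1) => [|P []//|P hP d0].
  by rewrite big_seq [X in (_ - X)%N]big_seq [RHS]big_seq -sumnB // => P /les.
by split=> // d10; rewrite d10 in d0.
Qed.
End Coker.

(** * Constant field extensions *)

(** Fraction-free elimination of the last column, so that the coefficients stay in the ring. It
    serves both for polynomial coefficients and for a field. *)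
Lemma idomain_dependent (R : idomainType) n (a : 'I_n.+1 -> 'I_n -> R) :
  exists u : 'I_n.+1 -> R, (exists i, u i != 0) /\ forall j, \sum_i u i * a i j = 0.
Proof.
elim: n a => [|n IH] a.
  by exists (fun=> 1); split; [exists 0; rewrite oner_neq0|case].
have [[i ai]|H] := pselect (exists i, a i ord_max != 0); last first.
  have a0 i : a i ord_max = 0 by apply/eqP/negPn/negP => ?; apply: H; exists i.
  have [u [[l ul] E]] := IH (fun l j => a (lift ord_max l) (lift ord_max j)).
  exists (fun i => if unlift ord_max i is Some l then u l else 0); split.
    by exists (lift ord_max l); rewrite /= liftK.
  move=> j; rewrite (bigD1_ord ord_max) //= unlift_none mul0r add0r.
  under eq_bigr => l0 _ do rewrite /= liftK.
  case: (unliftP ord_max j) => [j' ->|->]; first exact: E.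
  by rewrite big1 // => l' _; rewrite a0 mulr0.
pose a' l j := a i ord_max * a (lift i l) (lift ord_max j) -
  a (lift i l) ord_max * a i (lift ord_max j).
have [u [[l ul] E]] := IH a'.
exists (fun i' => if unlift i i' is Some l then a i ord_max * u l
  else - \sum_l u l * a (lift i l) ord_max); split.
  by exists (lift i l); rewrite /= liftK mulf_neq0.
move=> j; rewrite (bigD1_ord i) //= unlift_none.
rewrite [X in _ + X](eq_bigr (fun l => a i ord_max * u l * a (lift i l) j)); last first.
  by move=> l0 _; rewrite liftK.
rewrite mulNr mulr_suml addrC -sumrB.
case: (unliftP ord_max j) => [j' ->|->].
  rewrite -[RHS](E j'); apply: eq_bigr => l' _; rewrite /a'; ring.
by rewrite big1 // => l' _; ring.
Qed.

Definition function_field (k K : fieldType) (h : {rmorphism k -> K}) (x : K) : Prop :=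
  (forall p : {poly k}, p != 0 -> (map_poly h p).[x] != 0) /\
  exists n (b : 'I_n -> K), forall z, exists (g : {poly k}) (a : 'I_n -> {poly k}),
    g != 0 /\ (map_poly h g).[x] * z = \sum_(j < n) (map_poly h (a j)).[x] * b j.

Lemma function_field_dep (k K : fieldType) (h : {rmorphism k -> K}) x :
  function_field h x -> exists n, poly_dep h x n.
Proof.
move=> [tr [n [b sp]]]; exists n; split=> // v.
have /choice[g /choice[a gaP]] : forall i, exists g : {poly k}, exists a : 'I_n -> {poly k},
    g != 0 /\ (map_poly h g).[x] * v i = \sum_(j < n) (map_poly h (a j)).[x] * b j.
  by move=> i; exact: sp.
have [u [[i ui] E]] := idomain_dependent a.
exists (fun i => u i * g i); split.
  by exists i; rewrite mulf_neq0 //; case: (gaP i).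
have -> : \sum_i (map_poly h (u i * g i)).[x] * v i =
    \sum_i \sum_j (map_poly h (u i * a i j)).[x] * b j.
  apply: eq_bigr => l _; rewrite rmorphM hornerM -mulrA.
  have [_ ->] := gaP l; rewrite mulr_sumr; apply: eq_bigr => j _.
  by rewrite rmorphM hornerM mulrA.
rewrite exchange_big big1 //= => j _.
by rewrite -mulr_suml -horner_sum -rmorph_sum /= E rmorph0 horner0 mul0r.
Qed.

(** Encodes K' = K (x)_k k': a basis of k'/k is also a basis of K'/K. It covers both C_L over C and
    C_{L'} over C_L. *)
Definition const_ext (k k' K K' : fieldType) (j : {rmorphism k -> k'})
    (h : {rmorphism k -> K}) (h' : {rmorphism k' -> K'}) (phi : {rmorphism K -> K'})
    n (b : 'I_n -> k') : Prop :=
  [/\ forall a, phi (h a) = h' (j a), is_basis j b & is_basis phi (fun i => h' (b i))].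

Lemma basis_ex (k A : nzRingType) (f : {rmorphism k -> A}) n (b : 'I_n -> A) :
  is_basis f b -> forall x, exists a : 'I_n -> k, x = \sum_i f (a i) * b i.
Proof. by move=> H x; have [a [-> _]] := H x; exists a. Qed.

Lemma basis_inj (k A : nzRingType) (f : {rmorphism k -> A}) n (b : 'I_n -> A) :
  is_basis f b -> forall a a' : 'I_n -> k,
  \sum_i f (a i) * b i = \sum_i f (a' i) * b i -> a =1 a'.
Proof.
move=> H a a' E; have [a0 [_ un]] := H (\sum_i f (a i) * b i).
have E1 := un [ffun i => a i]; have E2 := un [ffun i => a' i].
have : [ffun i => a i] = [ffun i => a' i].
  rewrite -E1; last by apply: eq_bigr => i _; rewrite ffunE.
  by apply: E2; rewrite E; apply: eq_bigr => i _; rewrite ffunE.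
by move=> /ffunP Ea i; have := Ea i; rewrite !ffunE.
Qed.

Lemma basis_eq0 (k A : nzRingType) (f : {rmorphism k -> A}) n (b : 'I_n -> A) :
  is_basis f b -> forall a : 'I_n -> k, \sum_i f (a i) * b i = 0 -> forall i, a i = 0.
Proof.
move=> H a E; apply: (basis_inj H (a' := fun=> 0)).
by rewrite E big1 // => i _; rewrite rmorph0 mul0r.
Qed.

Section ConstExt.
Variables (k k' K K' : fieldType) (j : {rmorphism k -> k'}).
Variables (h : {rmorphism k -> K}) (h' : {rmorphism k' -> K'}) (phi : {rmorphism K -> K'}).
Variables (n : nat) (b : 'I_n -> k').
Hypothesis ce : const_ext j h h' phi b.

Lemma const_ext_agree a : phi (h a) = h' (j a). Proof. by case: ce. Qed.
Lemma const_ext_ex x : exists a : 'I_n -> K, x = \sum_i phi (a i) * h' (b i).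
Proof. by apply: basis_ex; case: ce. Qed.

Lemma const_ext_point P : is_point h' P -> is_point h (phi @^-1` P).
Proof.
move=> hP; split=> [a|x y|x y|x|] /=.
- by rewrite const_ext_agree; exact: (point_const hP).
- by rewrite rmorphB; exact: (pointB hP).
- by rewrite rmorphM; exact: (pointM hP).
- by rewrite fmorphV; exact: (pointV hP).
apply: contrapT => H; have [x nx] : exists x, ~ P x by case: hP.
apply: nx; have [a ->] := const_ext_ex x; apply: (point_sum hP) => i _.
apply: (pointM hP); last exact: (point_const hP).
by apply: contrapT => na; apply: H; exists (a i).
Qed.

Lemma maxideal_preimage P x : is_point h' P ->
  maxideal (phi @^-1` P) x <-> maxideal P (phi x).
Proof.
move=> hP; rewrite /maxideal /= fmorphV; split=> -[? [x0|?]]; split=> //; try by right.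
  by left; rewrite x0 rmorph0.
by left; apply/eqP; rewrite -(fmorph_eq0 phi) x0.
Qed.

(** Expanding coefficients in [b] turns a relation of phi x over k' into one over k for each
    coordinate. The products of the spanning elements [c] with [b] span K', with the product of the
    denominators as common denominator. *)
Lemma const_ext_function_field x : function_field h x -> function_field h' (phi x).
Proof.
move=> [tr [m [c sp]]]; have [_ bb bK] := ce.
have mapE (p : {poly k}) : (map_poly h' (map_poly j p)).[phi x] = phi (map_poly h p).[x].
  rewrite -horner_map -!map_poly_comp; congr (_.[_]).
  by apply: eq_map_poly => a /=; rewrite const_ext_agree.
split.
  move=> p; apply: contra_neq => E.
  have /choice[a aP] := fun i : nat => basis_ex bb p`_i.
  have pE : (map_poly h' p).[phi x] =
      \sum_(l < n) phi (map_poly h (\poly_(i < size p) a i l)).[x] * h' (b l).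
    rewrite horner_coef size_map_poly.
    under eq_bigr => i _.
      rewrite coef_map /= (aP i) rmorph_sum mulr_suml.
      under eq_bigr => l _ do rewrite rmorphM /= -const_ext_agree mulrAC -rmorphXn -rmorphM.
      over.
    rewrite exchange_big; apply: eq_bigr => l _ /=.
    rewrite -mulr_suml -rmorph_sum; congr (phi _ * _).
    rewrite (horner_coef_wide _ (n := size p)).
      by apply: eq_bigr => i _; rewrite coef_map coef_poly ltn_ord.
    by rewrite (leq_trans (size_poly _ _)) // size_poly.
  apply/polyP => i; rewrite coef0.
  have [ip|ip] := ltnP i (size p); last by rewrite nth_default.
  rewrite aP big1 // => l _.
  have := basis_eq0 bK (etrans (esym pE) E) l.
  move=> /eqP; apply: contraTeq => nz; apply: tr.
  apply: contraNneq nz => /polyP /(_ i).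
  by rewrite coef_poly ip coef0 => ->; rewrite rmorph0 mul0r.
exists #|{: 'I_m * 'I_n}|, (fun t => phi (c (enum_val t).1) * h' (b (enum_val t).2)) => z.
have [q ->] := const_ext_ex z.
have /choice[g /choice[a gaP]] : forall i, exists g : {poly k}, exists a : 'I_m -> {poly k},
    g != 0 /\ (map_poly h g).[x] * q i = \sum_(j < m) (map_poly h (a j)).[x] * c j.
  by move=> i; exact: sp.
exists (map_poly j (\prod_i g i)), (fun t => map_poly j
  ((\prod_(l < n | l != (enum_val t).2) g l) * a (enum_val t).2 (enum_val t).1)); split.
  by rewrite map_poly_eq0; apply/prodf_neq0 => i _; case: (gaP i).
rewrite mapE mulr_sumr -(big_enum_val (fun st : 'I_m * 'I_n =>
  (map_poly h' (map_poly j ((\prod_(l < n | l != st.2) g l) * a st.2 st.1))).[phi x] *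
   (phi (c st.1) * h' (b st.2)))) (eq_bigl xpredT) //=.
rewrite -(pair_bigA _ (fun s t =>
  (map_poly h' (map_poly j ((\prod_(l < n | l != t) g l) * a t s))).[phi x] *
   (phi (c s) * h' (b t)))) exchange_big /=.
apply: eq_bigr => t _; have [_ gq] := gaP t.
set G := fun t => \prod_(l < n | l != t) g l.
transitivity (phi ((map_poly h (G t)).[x] * ((map_poly h (g t)).[x] * q t)) * h' (b t)).
  rewrite (bigD1 t) //= -/(G t) rmorphM hornerM !(rmorphM phi); ring.
rewrite gq mulr_sumr rmorph_sum mulr_suml; apply: eq_bigr => s _.
by rewrite mapE (rmorphM (map_poly h)) hornerM !(rmorphM phi); ring.
Qed.

(** The ring P (x)_k k'. It need not be local in general; over a rational point its reduction is the
    field k', and it is the unique point above P. *)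
Definition point_lift (P : set K) : set K' :=
  [set x | exists a : 'I_n -> K, (forall i, P (a i)) /\ x = \sum_i phi (a i) * h' (b i)].

Lemma point_liftE (P : set K) (a : 'I_n -> K) :
  point_lift P (\sum_i phi (a i) * h' (b i)) <-> forall i, P (a i).
Proof.
have [_ _ bK] := ce; split=> [[a' [Pa' /(basis_inj bK) E]] i|Pa]; first by rewrite E.
by exists a.
Qed.

Section LiftRing.
Variable P : set K.
Hypothesis hP : is_point h P.

Lemma point_lift_phi x : P x -> point_lift P (phi x).
Proof.
move=> Px; have [a E] := basis_ex (let: And3 _ x _ := ce in x) 1.
exists (fun i => x * h (a i)); split=> [i|].
  by apply: (pointM hP) => //; exact: (point_const hP).
rewrite -[LHS]mulr1 -(rmorph1 h') E rmorph_sum mulr_sumr; apply: eq_bigr => i _.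
by rewrite !rmorphM /= const_ext_agree mulrA.
Qed.

Lemma point_lift_const x : point_lift P (h' x).
Proof.
have [a ->] := basis_ex (let: And3 _ x _ := ce in x) x.
exists (fun i => h (a i)); split=> [i|]; first exact: (point_const hP).
by rewrite rmorph_sum; apply: eq_bigr => i _; rewrite rmorphM /= const_ext_agree.
Qed.

Lemma point_lift0 : point_lift P 0.
Proof. by rewrite -(rmorph0 phi); apply/point_lift_phi/(point0 hP). Qed.

Lemma point_lift1 : point_lift P 1.
Proof. by rewrite -(rmorph1 h'); exact: point_lift_const. Qed.

Lemma point_liftB x y : point_lift P x -> point_lift P y -> point_lift P (x - y).
Proof.
move=> [a [Pa ->]] [a' [Pa' ->]]; exists (fun i => a i - a' i); split=> [i|].
  exact: (pointB hP).
by rewrite -sumrB; apply: eq_bigr => i _; rewrite rmorphB mulrBl.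
Qed.

Lemma point_liftD x y : point_lift P x -> point_lift P y -> point_lift P (x + y).
Proof.
move=> Lx Ly; rewrite -[y]opprK; apply: point_liftB => //; rewrite -sub0r.
by apply: point_liftB => //; exact: point_lift0.
Qed.

Lemma point_lift_sum I (r : seq I) (Q : pred I) (f : I -> K') :
  (forall i, Q i -> point_lift P (f i)) -> point_lift P (\sum_(i <- r | Q i) f i).
Proof. exact: (big_ind (point_lift P) point_lift0 (fun x y => @point_liftD x y)). Qed.

Lemma point_lift_phiM x y : P x -> point_lift P y -> point_lift P (phi x * y).
Proof.
move=> Px [a [Pa ->]]; exists (fun i => x * a i); split=> [i|]; first exact: (pointM hP).
by rewrite mulr_sumr; apply: eq_bigr => i _; rewrite rmorphM mulrA.
Qed.

Lemma point_liftM x y : point_lift P x -> point_lift P y -> point_lift P (x * y).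
Proof.
move=> [a [Pa ->]] [a' [Pa' ->]]; rewrite mulr_suml; apply: point_lift_sum => i _.
rewrite -mulrA; apply: point_lift_phiM => //; rewrite mulr_sumr; apply: point_lift_sum => l _.
by rewrite mulrCA; apply: point_lift_phiM => //; rewrite -rmorphM; exact: point_lift_const.
Qed.

Lemma point_lift_prod I (r : seq I) (Q : pred I) (f : I -> K') :
  (forall i, Q i -> point_lift P (f i)) -> point_lift P (\prod_(i <- r | Q i) f i).
Proof. exact: (big_ind (point_lift P) point_lift1 (fun x y => @point_liftM x y)). Qed.

(** A coordinate of least value is taken out; the remaining factor has a coordinate 1 and so is
    nonzero modulo the maximal ideal of P. *)
Lemma point_lift_factor y : y != 0 -> exists z (a : 'I_n -> K),
  [/\ z != 0, forall i, P (a i), y = phi z * \sum_i phi (a i) * h' (b i) & exists i, a i = 1].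
Proof.
have [_ _ bK] := ce; have [a ->] := basis_ex bK y => y0.
have [|l [al lmax]] := @max_entry _ _ _ _ hP _ a.
  apply: contrapT => H; move/eqP: y0; apply; rewrite big1 // => i _.
  have -> : a i = 0 by apply/eqP/negPn/negP => ?; apply: H; exists i.
  by rewrite rmorph0 mul0r.
exists (a l), (fun i => a i / a l); split=> //; last by exists l; rewrite divff.
rewrite mulr_sumr; apply: eq_bigr => i _.
by rewrite mulrA -rmorphM [a l * _]mulrC divfK.
Qed.

End LiftRing.

Section Rational.
Variable P : set K.
Hypothesis rP : rational_point h P.
Let hP : is_point h P := rP.1.
Let resid := rP.2.
Local Notation lift := (point_lift P).

(** The maximal ideal of P tensored with k'. By rationality the quotient of [lift] by it is k',
    which makes it prime; the valuation property then follows from [factor]. *)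
Let lift_max : set K' :=
  [set x | exists a : 'I_n -> K, (forall i, maxideal P (a i)) /\ x = \sum_i phi (a i) * h' (b i)].

Let maxB x y : lift_max x -> lift_max y -> lift_max (x - y).
Proof.
move=> [a [Pa ->]] [a' [Pa' ->]]; exists (fun i => a i - a' i); split=> [i|].
  exact: (maxidealB hP).
by rewrite -sumrB; apply: eq_bigr => i _; rewrite rmorphB mulrBl.
Qed.

Let max0 : lift_max 0.
Proof.
exists (fun=> 0); split=> [i|]; first exact: (maxideal0 hP).
by rewrite big1 // => i _; rewrite rmorph0 mul0r.
Qed.

Let maxD x y : lift_max x -> lift_max y -> lift_max (x + y).
Proof.
move=> Lx Ly; rewrite -[y]opprK; apply: maxB => //; rewrite -sub0r; exact: maxB.
Qed.

Let max_phiM x y : maxideal P x -> lift y -> lift_max (phi x * y).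
Proof.
move=> mx [a [Pa ->]]; exists (fun i => x * a i); split=> [i|]; first exact: (maxidealMr hP).
by rewrite mulr_sumr; apply: eq_bigr => i _; rewrite rmorphM mulrA.
Qed.

Let maxM x y : lift_max x -> lift y -> lift_max (x * y).
Proof.
move=> [a [ma ->]] Ly; rewrite mulr_suml.
apply: (big_ind lift_max max0 (fun x y => @maxD x y)) => i _.
by rewrite -mulrA; apply: max_phiM => //; apply: (point_liftM hP) => //; exact: (point_lift_const hP).
Qed.

Let max_const c : lift_max (h' c) -> c = 0.
Proof.
move=> [a [ma E]]; have [_ bb bK] := ce; have [a' ca'] := basis_ex bb c.
suff a'0 i : a' i = 0 by rewrite ca' big1 // => i _; rewrite a'0 rmorph0 mul0r.
apply/eqP/negPn/negP => /(maxideal_const hP); apply.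
have -> : h (a' i) = a i; last exact: ma.
apply: (basis_inj bK (a := fun i => h (a' i))); rewrite -E ca' rmorph_sum.
by apply: eq_bigr => l _; rewrite rmorphM const_ext_agree.
Qed.

Let lift_residue x : lift x -> exists c, lift_max (x - h' c).
Proof.
move=> [a [Pa ->]]; have /choice[c cP] := fun i => resid (Pa i).
exists (\sum_i j (c i) * b i), (fun i => a i - h (c i)); split=> //.
rewrite rmorph_sum -sumrB; apply: eq_bigr => i _ /=.
by rewrite rmorphM rmorphB const_ext_agree -mulrBl.
Qed.

Let lift_prime x y : lift x -> lift y -> lift_max (x * y) ->
  lift_max x \/ lift_max y.
Proof.
move=> Lx Ly Mxy; have [c Mc] := lift_residue Lx; have [c' Mc'] := lift_residue Ly.
have /max_const/eqP : lift_max (h' (c * c')).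
  have -> : h' (c * c') = x * y - ((x - h' c) * y + (y - h' c') * h' c).
    by rewrite rmorphM; ring.
  by apply: maxB => //; apply: maxD; apply: maxM => //; exact: (point_lift_const hP).
rewrite mulf_eq0 => /orP[/eqP E|/eqP E]; [left|right].
  by move: Mc; rewrite E rmorph0 subr0.
by move: Mc'; rewrite E rmorph0 subr0.
Qed.

Let max1 : ~ lift_max 1.
Proof. by rewrite -(rmorph1 h') => /max_const/eqP; rewrite oner_eq0. Qed.

Let lift_preimage x : lift (phi x) -> P x.
Proof.
move=> Lx; apply: contrapT => nx; apply: max1.
have x0 : x != 0 by apply: contra_notN nx => /eqP ->; exact: (point0 hP).
rewrite -[1](mulVf (x := phi x)) ?fmorph_eq0 // -fmorphV.
by apply: max_phiM; [exact: (notpoint_inv hP)|].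
Qed.

Let factor y : y != 0 -> exists z x, [/\ z != 0, y = phi z * x, lift x & ~ lift_max x].
Proof.
move=> /(point_lift_factor hP)[z [a [z0 Pa yE [l al]]]].
exists z, (\sum_i phi (a i) * h' (b i)); split=> //; first by exists a.
have [_ _ bK] := ce => -[a' [ma' /(basis_inj bK) E]]; apply: (maxideal1 hP).
by rewrite -al E.
Qed.

(** Write x^-1 = phi z * w with w outside [lift_max]: a pole of z would put x * w = phi z^-1 into
    this prime ideal. *)
Let lift_unit x : lift x -> ~ lift_max x -> lift x^-1.
Proof.
move=> Lx nx; have x0 : x != 0 by apply: contra_notN nx => /eqP->; exact: max0.
have [z [w [z0 xE Lw nw]]] := factor (invr_neq0 x0).
have [Pz|nPz] := pselect (P z); first by rewrite xE; exact: (point_lift_phiM hP).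
exfalso; have : lift_max (x * w).
  have -> : x * w = phi z^-1 * 1.
    apply: (mulfI (x := phi z)); rewrite ?fmorph_eq0 //.
    by rewrite mulrCA -xE divff // mulr1 fmorphV divff // fmorph_eq0.
  by apply: max_phiM; [exact: (notpoint_inv hP)|exact: (point_lift1 hP)].
by case/(lift_prime Lx Lw).
Qed.

Lemma rational_point_lift : rational_point h' lift.
Proof.
have max_sub x : lift_max x -> maxideal lift x.
  move=> Mx; split.
    by case: Mx => a [ma ->]; exists a; split=> // i; exact: maxideal_sub.
  have [->|x0] := eqVneq x 0; [by left|right=> Lx].
  by apply: max1; rewrite -(divff x0); exact: maxM.
split; last by move=> x /lift_residue[c ?]; exists c; exact: max_sub.
split=> [a|x y|x y|x|].
- exact: (point_lift_const hP).
- exact: (point_liftB hP).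
- exact: (point_liftM hP).
- have [->|x0] := eqVneq x 0.
    by left; exact: maxideal_sub (max_sub _ max0).
  have [z [w [z0 -> Lw nw]]] := factor x0.
  have [Pz|nPz] := pselect (P z); first by left; exact: (point_lift_phiM hP).
  right; rewrite invfM -fmorphV; apply: (point_lift_phiM hP); last exact: lift_unit.
  by case: (notpoint_inv hP nPz).
have [x nx] : exists x, ~ P x by case: hP.
by exists (phi x) => /lift_preimage.
Qed.

Lemma point_lift_preimage : phi @^-1` lift = P.
Proof. by apply/seteqP; split=> x; [exact: lift_preimage|exact: (point_lift_phi hP)]. Qed.

(** A point above P contains [lift]. Conversely each element of it is, up to a unit of [lift], the
    image of an element of K, where the two rings induce the same P. *)
Lemma point_lift_unique P' : is_point h' P' -> phi @^-1` P' = P -> P' = lift.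
Proof.
move=> hP' E; have sub x : lift x -> P' x.
  move=> [a [Pa ->]]; apply: (point_sum hP') => i _.
  by apply: (pointM hP'); [move: (Pa i); rewrite -E|exact: (point_const hP')].
apply/seteqP; split=> y; last exact: sub.
have [->|y0] := eqVneq y 0; first by move=> _; exact: (point_lift0 hP).
have [z [x [z0 -> Lx nx]]] := factor y0 => P'y.
apply: (point_lift_phiM hP) => //; rewrite -E /=.
have x0 : x != 0 by apply: contra_notN nx => /eqP->; exact: max0.
by rewrite -(mulfK x0 (phi z)); apply: (pointM hP') => //; exact/sub/lift_unit.
Qed.

End Rational.
End ConstExt.

(** * The curve over the constant field L *)

Section Uniformizer.
Variables (k K : fieldType) (h : {rmorphism k -> K}) (O : set K).
Hypothesis hO : is_point h O.

Lemma local_param_uniformizer t : local_param O t -> uniformizer O t.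
Proof.
move=> [t0 mt tP]; split=> // x mx.
have [->|x0] := eqVneq x 0; first by rewrite mul0r; exact: (point0 hO).
have tX i : O (t ^+ i) by apply: (pointX hO); exact: maxideal_sub.
have [[[|j]|j] [Oj nj]] := tP _ x0.
- by exfalso; apply: nj; rewrite expr0z divr1.
- have -> : x / t = x / t ^ j.+1 * t ^+ j.
    by rewrite -exprnP exprS; field; rewrite t0 expf_neq0.
  exact: (pointM hO).
exfalso; apply: nj; rewrite NegzE -exprnN invrK.
exact: (maxidealMr hO).
Qed.

Lemma uniformizer_exp t u (i : int) : uniformizer O t -> uniformizer O u ->
  O ((t / u) ^ i).
Proof.
move=> [t0 mt tP] [u0 mu uP].
case: i => i; first by apply: (@pointX _ _ _ _ hO _ i); exact: uP.
by rewrite NegzE -exprnN -exprVn invf_div; apply: (pointX hO); exact: tP.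
Qed.

Lemma absorb t u z : local_param O t -> maxideal O u -> exists n, O (u ^+ n * z).
Proof.
move=> tP mu; have [t0 _ tU] := local_param_uniformizer tP.
have [_ mt tV] := tP; have Ot := maxideal_sub mt.
have [->|z0] := eqVneq z 0; first by exists 0%N; rewrite mulr0; exact: (point0 hO).
have [[j|j] [Oj nj]] := tV _ z0.
  exists 0%N; rewrite expr0 mul1r -(divfK (expfz_neq0 j t0) z).
  by apply: (pointM hO) => //; apply: (@pointX _ _ _ _ hO _ j).
exists j.+1; move: Oj; rewrite NegzE -exprnN invrK => Oj.
have -> : u ^+ j.+1 * z = (u / t) ^+ j.+1 * (z * t ^+ j.+1).
  by rewrite expr_div_n; field; rewrite expf_neq0.
by apply: (pointM hO) => //; apply: (pointX hO); exact: tU.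
Qed.

End Uniformizer.

Lemma pullback_latticeE (k' K K' : fieldType)
    (h' : {rmorphism k' -> K'}) (phi : {rmorphism K -> K'}) r (M : sheaf K r) P B :
  is_point h' P -> B \in unitmx ->
  (forall v, M (phi @^-1` P) v <-> intvec (phi @^-1` P) (v *m B)) ->
  forall v, pullback phi M P v <-> intvec P (v *m map_mx phi B).
Proof.
move=> hP uB MB v; split=> [[n [a [w [Pa Sw ->]]]]|Iv].
  rewrite mulmx_suml => i; rewrite summxE; apply: (point_sum hP) => l _.
  rewrite -scalemxAl mxE; apply: (pointM hP) => //.
  by have [u /MB Iu <-] := Sw l; rewrite -map_mxM mxE; exact: Iu.
exists r, (fun i => (v *m map_mx phi B) 0 i), (fun i => map_mx phi (row i (invmx B))).
split=> //.
  move=> i; exists (row i (invmx B)) => //; apply/MB.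
  rewrite -row_mul mulVmx // => l; rewrite row1 mxE.
  case: (_ && _); rewrite /= ?rmorph1 ?rmorph0 /preimage /= ?rmorph1 ?rmorph0.
    exact: (point1 hP).
  exact: (point0 hP).
rewrite -[LHS](mulmxK (_ : map_mx phi B \in unitmx)) ?map_unitmx // mulmx_sum_row.
by apply: eq_bigr => i _; rewrite map_row map_invmx.
Qed.

Section Pullback.
Variables (k' K K' : fieldType).
Variables (h' : {rmorphism k' -> K'}) (phi : {rmorphism K -> K'}).
Variables (r : nat) (M : sheaf K r) (P : set K').
Hypotheses (hP : is_point h' P) (lM : is_lattice (phi @^-1` P) (M (phi @^-1` P))).

Lemma pullback_lattice : is_lattice P (pullback phi M P).
Proof.
have [B uB MB] := lM; exists (map_mx phi B); first by rewrite map_unitmx.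
by move=> v; exact: (pullback_latticeE hP uB MB).
Qed.

Lemma pullback_map w : pullback phi M P (map_mx phi w) <-> M (phi @^-1` P) w.
Proof.
have [B uB MB] := lM; rewrite (pullback_latticeE hP uB MB) MB -map_mxM.
by split=> H i; have := H i; rewrite !mxE.
Qed.

End Pullback.

Section Twist.
Variables (k k' Q K : fieldType) (h : {rmorphism k -> Q}) (h' : {rmorphism k' -> K}).
Variables (iQ : {rmorphism Q -> K}).
Variables (r : nat) (M : sheaf K r) (P : set K).
Hypotheses (hP : is_point h' P) (hp : is_point h (iQ @^-1` P)) (lM : is_lattice P (M P)).

(** Quotients of uniformizers are units, so the one hidden in [divisor_stalk] may be replaced by a
    fixed u; twisting then rescales the stalk by a power of u. *)
Lemma sheaf_twistE D u v : uniformizer (iQ @^-1` P) u ->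
  sheaf_twist iQ D M P v <-> M P (iQ (u ^ D (iQ @^-1` P)) *: v).
Proof.
move=> uu; have u0 : u != 0 by case: uu.
split=> [[n [a [w [Pa Sw ->]]]]|Mv].
  rewrite scaler_sumr; apply: (lattice_sum hP lM) => i _.
  have [f [x [[u' [uu' Df]] Mx ->]]] := Sw i.
  have u'0 : u' != 0 by case: uu'.
  rewrite !scalerA mulrAC mulrC; apply: (latticeZ hP lM) => //.
  apply: (pointM hP) => //; rewrite -rmorphM -[P _]/((iQ @^-1` P) _).
  have -> : u ^ D (iQ @^-1` P) * f = (f * u' ^ D (iQ @^-1` P)) * (u / u') ^ D (iQ @^-1` P).
    by rewrite expfzMl exprz_inv -invr_expz; field; rewrite expfz_neq0.
  by apply: (pointM hp) => //; exact: (uniformizer_exp hp).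
have uD0 : iQ (u ^ D (iQ @^-1` P)) != 0 by rewrite fmorph_eq0 expfz_neq0.
exists 1%N, (fun=> 1), (fun=> v); split=> [i|i|].
- exact: (point1 hP).
- exists (u ^ D (iQ @^-1` P))^-1, (iQ (u ^ D (iQ @^-1` P)) *: v); split=> //.
    exists u; split=> //; rewrite mulVf ?expfz_neq0 //; exact: (point1 hp).
  by rewrite scalerA -rmorphM mulVf ?expfz_neq0 // rmorph1 scale1r.
by rewrite big_ord1 scale1r.
Qed.

End Twist.

Lemma basis_card (k A : finFieldType) (f : {rmorphism k -> A}) n (b : 'I_n -> A) :
  is_basis f b -> #|A| = (#|k| ^ n)%N.
Proof.
move=> hb; pose g (a : {ffun 'I_n -> k}) := \sum_i f (a i) * b i.
have inj : injective g by move=> a a' /(basis_inj hb) E; apply/ffunP.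
rewrite -(card_ord n) -card_ffun.
have <- : #|codom g| = #|{: {ffun 'I_n -> k}}| by exact: card_codom.
apply: eq_card => x; rewrite inE; apply/esym/codomP.
by have [a [-> _]] := hb x; exists a.
Qed.

Lemma curve_function_field (F : finFieldType) (C : curve F) :
  exists x, function_field (const C) x.
Proof. by have [x [tr [n [b H]]]] := curve_dim1 C; exists x; split=> //; exists n, b. Qed.

Lemma curve_dvr (F : finFieldType) (C : curve F) P : is_point (const C) P ->
  exists t, local_param P t.
Proof.
have [x /function_field_dep[n dep]] := curve_function_field C.
exact: (dvr dep).
Qed.

Section CurveOver.
Variables (F : finFieldType) (C : curve F) (L : finFieldType) (jL : {rmorphism F -> L}).
Variable CL : curve_over C jL.
Local Notation sigma := (cl_sigma CL).
Local Notation e := (cl_deg CL).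
Local Notation iQ := (cl_fun CL).

Lemma cl_const_ext : exists b : 'I_e -> L,
  const_ext jL (const C) (cl_const CL) iQ b.
Proof. by have [b [H1 H2]] := cl_tensor CL; exists b; split=> //; exact: cl_agree. Qed.

Lemma cl_dep : exists y n, poly_dep (cl_const CL) y n.
Proof.
have [x ffx] := curve_function_field C; have [b ce] := cl_const_ext.
have [n dep] := function_field_dep (const_ext_function_field ce ffx).
by exists (iQ x), n.
Qed.

Lemma cl_point P : is_point (cl_const CL) P -> is_point (const C) (iQ @^-1` P).
Proof. by have [b ce] := cl_const_ext; exact: (const_ext_point ce). Qed.

Lemma cl_dvr P : is_point (cl_const CL) P -> exists t, local_param P t.
Proof. by have [y [n dep]] := cl_dep; exact: (dvr dep). Qed.

Lemma cl_finite_poles z : finite_set [set P | is_point (cl_const CL) P /\ ~ P z].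
Proof. by have [y [n dep]] := cl_dep; exact: (finite_poles dep). Qed.

Lemma cl_card : #|L| = (#|F| ^ e)%N.
Proof. by have [b [bb _]] := cl_tensor CL; exact: basis_card bb. Qed.

Lemma cl_deg_gt0 : (0 < e)%N.
Proof.
have := cl_card; case: e => // /eqP; rewrite expn0 => /eqP L1.
by have := card_finNzRing_gt1 L; rewrite L1.
Qed.

Lemma iter_sigma_fun n f : iter n sigma (iQ f) = iQ f.
Proof. by elim: n => //= n ->; exact: cl_sigma_fun. Qed.

Lemma iter_sigma_const n x : iter n sigma (cl_const CL x) = cl_const CL (x ^+ (#|F| ^ n)).
Proof. by elim: n => [|n IH] /=; rewrite ?expr1 // IH cl_sigma_const -exprM expnSr. Qed.

Lemma iter_sigmaM n x y : iter n sigma (x * y) = iter n sigma x * iter n sigma y.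
Proof. by elim: n => //= n ->; rewrite rmorphM. Qed.
Lemma iter_sigma_sum n I (r : seq I) (Q : pred I) (f : I -> CL) :
  iter n sigma (\sum_(i <- r | Q i) f i) = \sum_(i <- r | Q i) iter n sigma (f i).
Proof. by elim: n => //= n ->; rewrite rmorph_sum. Qed.

Lemma sigma_order x : iter e sigma x = x.
Proof.
have [b ce] := cl_const_ext; have [a ->] := const_ext_ex ce x.
rewrite iter_sigma_sum; apply: eq_bigr => i _.
by rewrite iter_sigmaM iter_sigma_fun iter_sigma_const -cl_card expf_card.
Qed.

Lemma sigma_surj x : exists y, x = sigma y.
Proof.
exists (iter e.-1 sigma x).
by rewrite -iterS prednK ?cl_deg_gt0 // sigma_order.
Qed.

Lemma map_sigma_order m n (A : 'M_(m, n)) : iter e (map_mx sigma) A = A.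
Proof.
apply/matrixP => i l; rewrite -[RHS]sigma_order.
by elim: e => //= n' <-; rewrite mxE.
Qed.

Lemma map_sigma_surj m n (A : 'M_(m, n)) : exists B, A = map_mx sigma B.
Proof.
exists (iter e.-1 (map_mx sigma) A).
by rewrite -iterS prednK ?cl_deg_gt0 // map_sigma_order.
Qed.

Lemma sigma_point P : is_point (cl_const CL) P -> is_point (cl_const CL) (sigma @^-1` P).
Proof.
move=> hP; split=> [a|x y|x y|x|] /=.
- by rewrite cl_sigma_const; exact: (point_const hP).
- by rewrite rmorphB; exact: (pointB hP).
- by rewrite rmorphM; exact: (pointM hP).
- by rewrite fmorphV; exact: (pointV hP).
have [x nx] : exists x, ~ P x by case: hP.
by have [y yE] := sigma_surj x; exists y; rewrite -yE.
Qed.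

(* The trace of [L / F] is a polynomial of degree [#|F| ^ e.-1 < #|L|]. *)
Lemma trace1 : exists lam : CL, \sum_(i < e) iter i sigma lam = 1.
Proof.
pose tr (x : L) := \sum_(i < e) x ^+ (#|F| ^ i).
have F1 : (1 < #|F|)%N := card_finNzRing_gt1 F.
have [x trx] : exists x, tr x != 0.
  apply: contrapT => H.
  pose p : {poly L} := \sum_(i < e) 'X^(#|F| ^ i).
  have p0 : p != 0.
    apply/eqP => /polyP /(_ 1%N); rewrite coef0 coef_sum.
    rewrite (bigD1 (Ordinal cl_deg_gt0)) //= big1 => [|i i0].
      by rewrite coefXn eqxx addr0 => /eqP; rewrite oner_eq0.
    rewrite coefXn; case: eqP => // /esym/eqP; rewrite -(expn0 #|F|) eqn_exp2l //.
    by move=> iE; rewrite -val_eqE /= iE in i0.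
  have sp : (size p <= (#|F| ^ e.-1).+1)%N.
    apply: (leq_trans (size_sum _ _ _)); apply/bigmax_leqP => i _.
    rewrite size_polyXn ltnS leq_exp2l // -ltnS prednK ?cl_deg_gt0 //.
  have := max_poly_roots p0 (rs := enum L) _ (enum_uniq _).
  rewrite -cardE cl_card; move=> /(_ _)/wrap[].
    apply/allP => y _; rewrite /root horner_sum; apply/eqP.
    transitivity (tr y); first by apply: eq_bigr => i _; rewrite hornerXn.
    by apply/eqP/negPn/negP => ?; apply: H; exists y.
  move=> lt; have := leq_trans lt sp; rewrite ltnS leq_exp2l //.
  by rewrite leqNgt ltn_predL cl_deg_gt0.
pose t := cl_const CL (tr x).
have t0 : t != 0 by rewrite fmorph_eq0.
have tE : \sum_(i < e) iter i sigma (cl_const CL x) = t.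
  by rewrite /t rmorph_sum; apply: eq_bigr => i _; rewrite iter_sigma_const.
have st : sigma t = t.
  rewrite -{1}tE rmorph_sum -tE.
  case: e (sigma_order (cl_const CL x)) => [|n] H; first by rewrite !big_ord0.
  rewrite big_ord_recr /= big_ord_recl /= addrC; congr (_ + _); exact: H.
exists (cl_const CL x / t).
rewrite -[RHS](divff t0) -{2}tE mulr_suml; apply: eq_bigr => i _.
rewrite iter_sigmaM; congr (_ * _).
by elim: (nat_of_ord i) => //= l ->; rewrite fmorphV st.
Qed.

End CurveOver.

(** * Generic triviality of abelian tau-sheaves *)

Lemma inj_unitmx (K : fieldType) n (A : 'M[K]_n) :
  (forall v : 'rV_n, v *m A = 0 -> v = 0) -> A \in unitmx.
Proof.
move=> inj; rewrite -row_free_unit -kermx_eq0; apply/eqP/row_matrixP => i.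
by rewrite row0; apply: inj; rewrite -row_mul mulmx_ker row0.
Qed.

Lemma invmx_mul (K : fieldType) n (A B : 'M[K]_n) : A \in unitmx -> B \in unitmx ->
  invmx (A *m B) = invmx B *m invmx A.
Proof.
move=> uA uB; have uAB : A *m B \in unitmx by rewrite unitmx_mul uA.
apply: (can_inj (mulKmx uAB)); rewrite mulmxV // mulmxA -(mulmxA A) mulmxV //.
by rewrite mulmx1 mulmxV.
Qed.

Lemma int_shift (P : int -> Prop) : P 0 -> (forall i, P i <-> P (i + 1)) -> forall i, P i.
Proof.
move=> P0 H; elim/int_rect => // n Pn; first by rewrite intS addrC; exact: (H _).1.
by apply: (H _).2; have -> : - n.+1%:Z + 1 = - n%:Z by lia.
Qed.

(** The matrix s^(n-1)(T) ... s(T) T of the n-th iterate of the semilinear map v -> s(v) T on row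
    vectors. *)
Fixpoint semilinear_pow (K : fieldType) (s : {rmorphism K -> K}) r (T : 'M[K]_r) n : 'M[K]_r :=
  if n is n'.+1 then map_mx s (semilinear_pow s T n') *m T else 1%:M.

Lemma semilinear_powD (K : fieldType) (s : {rmorphism K -> K}) r (T : 'M[K]_r) a b :
  semilinear_pow s T (a + b) =
    iter b (map_mx s) (semilinear_pow s T a) *m semilinear_pow s T b.
Proof.
elim: b => [|b IH]; first by rewrite addn0 mulmx1.
by rewrite addnS /= IH map_mxM mulmxA.
Qed.

Section Tau.
Variables (F : finFieldType) (C : curve F) (infty : set C).
Hypothesis infty_rat : rational_point (const C) infty.
Variables (L : finFieldType) (jL : {rmorphism F -> L}) (CL : curve_over C jL).
Variable c : char_morphism C jL.
Local Notation pointL := (is_point (cl_const CL)).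
Local Notation sigma := (cl_sigma CL).
Local Notation e := (cl_deg CL).
Local Notation iQ := (cl_fun CL).
Local Notation abelian := (abelian_tau infty c).
Implicit Types X Y : tau_data CL.

Lemma cl_point_ex : exists P, pointL P.
Proof.
have [b ce] := cl_const_ext CL; exists (point_lift (cl_const CL) iQ b infty).
by case: (rational_point_lift ce infty_rat).
Qed.

Lemma at_lattice X : abelian X -> forall i P, pointL P -> is_lattice P (shf X i P).
Proof.
move=> aX i; have [y [n dep]] := cl_dep CL.
by have [H _] := (locally_freeP dep (shf X i)).1 (at_free aX i).
Qed.

Lemma at_finite X : abelian X -> forall i,
  finite_set [set P | pointL P /\ ~ (forall v, shf X i P v <-> intvec P v)].
Proof.
move=> aX i; have [y [n dep]] := cl_dep CL.
by have [_ H] := (locally_freeP dep (shf X i)).1 (at_free aX i).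
Qed.

Lemma at_pullback X : abelian X -> forall i P, pointL P ->
  is_lattice P (pullback sigma (shf X i) P).
Proof.
by move=> aX i P hP; apply: (pullback_lattice hP); apply: at_lattice => //; exact: sigma_point.
Qed.

Lemma at_Pi_unit X : abelian X -> forall i, Pi X i \in unitmx.
Proof.
move=> aX i; have [P hP] := cl_point_ex; apply: inj_unitmx.
apply: (lattice_inj hP (at_lattice aX i hP)) => v.
exact: (at_Pi_inj aX (i := i) hP).
Qed.

Lemma at_tau_unit X : abelian X -> forall i, tau X i \in unitmx.
Proof.
move=> aX i; have [P hP] := cl_point_ex; apply: inj_unitmx.
apply: (lattice_inj hP (at_pullback aX i hP)) => v.
exact: (at_tau_inj aX (i := i) hP).
Qed.

(* The [W i] identify all the generic stalks with the one at [i = 0], so that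
   the tau-sheaf is generically the single semilinear map [T]. *)
Definition trivialization X (W : int -> 'M[CL]_(rank X)) (T : 'M[CL]_(rank X)) : Prop :=
  [/\ forall i, W i \in unitmx, T \in unitmx, forall i, W (i + 1) = W i *m Pi X i
    & forall i, map_mx sigma (W i) *m tau X i = T *m W (i + 1)].

(** T is read off at i = 0; compatibility of the Pi's with the tau's carries its defining equation
    to all other indices, in both directions. *)
Lemma trivialization_ex X : abelian X -> exists W T, @trivialization X W T.
Proof.
move=> aX; have uPi := at_Pi_unit aX.
(* On the negative side [W (-n)] is the inverse of the composite of the Pi's from -n to 0. *)
pose Wm := fix Wm n := if n is n'.+1 then Wm n' *m invmx (Pi X (- n'.+1%:Z)) else 1%:M.
pose W i := match i with Posz n => Pi_iter X n 0 | Negz n => Wm n.+1 end.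
have WS i : W (i + 1) = W i *m Pi X i.
  case: i => n.
    by rewrite -PoszD addn1 /= add0r.
  have -> : W (Negz n) = Wm n *m invmx (Pi X (Negz n)) by rewrite NegzE.
  rewrite mulmxKV //; case: n => [|n] //.
  by have -> : Negz n.+1 + 1 = Negz n by rewrite !NegzE; lia.
have uWm n : Wm n \in unitmx.
  by elim: n => [|n IH] /=; [exact: unitmx1|rewrite unitmx_mul IH unitmx_inv uPi].
have uW : forall i, W i \in unitmx.
  apply: int_shift => [|i]; first exact: unitmx1.
  by rewrite WS unitmx_mul uPi andbT.
exists W, (map_mx sigma (W 0) *m tau X 0 *m invmx (W 1)); split=> //.
  by rewrite !unitmx_mul map_unitmx !uW at_tau_unit // unitmx_inv uW.
apply: int_shift => [|i]; first by rewrite add0r mulmxKV.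
set T := _ *m invmx (W 1).
have -> : map_mx sigma (W (i + 1)) *m tau X (i + 1) =
    map_mx sigma (W i) *m tau X i *m Pi X (i + 1).
  by rewrite WS map_mxM -mulmxA -(at_comm aX) mulmxA.
rewrite (WS (i + 1)) (mulmxA T); split=> [->//|].
exact: (can_inj (mulmxK (uPi (i + 1)))).
Qed.

Section Trivialized.
Variables (X : tau_data CL) (W : int -> 'M[CL]_(rank X)) (T : 'M[CL]_(rank X)).
Hypothesis tX : trivialization W T.

Lemma Pi_iterE n i : Pi_iter X n i = invmx (W i) *m W (i + n%:Z).
Proof.
have [uW _ WS _] := tX; elim: n => [|n IH] /=; first by rewrite addr0 mulVmx.
by rewrite IH -mulmxA -WS -addrA -PoszD addn1.
Qed.

Lemma tau_iterE n i : iter n (map_mx sigma) (W i) *m tau_iter X n i =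
  semilinear_pow sigma T n *m W (i + n%:Z).
Proof.
have [uW _ WS tE] := tX; elim: n => [|n IH] /=; first by rewrite mulmx1 mul1mx addr0.
by rewrite mulmxA -map_mxM IH map_mxM -mulmxA tE mulmxA -addrA -PoszD addn1.
Qed.

Lemma frobeniusE i : frobenius X i = invmx (W i) *m semilinear_pow sigma T e *m W i.
Proof.
have [uW _ _ _] := tX.
have H := tau_iterE e i; rewrite map_sigma_order in H.
have {}H : tau_iter X e i = invmx (W i) *m semilinear_pow sigma T e *m W (i + e%:Z).
  by rewrite -(mulKmx (uW i) (tau_iter X e i)) H mulmxA.
rewrite /frobenius H Pi_iterE.
have -> : invmx (invmx (W i) *m W (i + e%:Z)) = invmx (W (i + e%:Z)) *m W i.
  by rewrite invmx_mul ?unitmx_inv // invmxK.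
by rewrite -!mulmxA mulKVmx.
Qed.

End Trivialized.
End Tau.

(** * Periodicity and quasi-isogenies *)

Section Period.
Variables (F : finFieldType) (C : curve F) (infty : set C).
Hypothesis infty_rat : rational_point (const C) infty.
Variables (L : finFieldType) (jL : {rmorphism F -> L}) (CL : curve_over C jL).
Variable c : char_morphism C jL.
Local Notation pointL := (is_point (cl_const CL)).
Local Notation sigma := (cl_sigma CL).
Local Notation iQ := (cl_fun CL).
Local Notation abelian := (abelian_tau infty c).
Implicit Types X Y : tau_data CL.

Section FixU.
Variable u : C.
Hypothesis uP : uniformizer infty u.

Lemma u_neq0 : u != 0. Proof. by case: uP. Qed.

(** u^-k above [infty] and 1 elsewhere: v lies in M(-k infty) exactly when its multiple by this
    factor lies in M. *)
Definition pole_factor (P : set CL) (k : nat) : CL :=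
  iQ (u ^ point_divisor infty (- k%:Z) (iQ @^-1` P)).

Lemma pole_factor_neq0 P k : pole_factor P k != 0.
Proof. by rewrite fmorph_eq0 expfz_neq0 // u_neq0. Qed.

Lemma pole_factorD P a b : pole_factor P (a + b) = pole_factor P a * pole_factor P b.
Proof.
rewrite /pole_factor /point_divisor; case: asboolP => _.
  by rewrite PoszD opprD expfzDr ?u_neq0 // rmorphM.
by rewrite expr0z rmorph1 mulr1.
Qed.

Lemma twist_infty r (M : sheaf CL r) P k : pointL P -> is_lattice P (M P) ->
  forall v, sheaf_twist iQ (point_divisor infty (- k%:Z)) M P v <->
            M P (pole_factor P k *: v).
Proof.
move=> hP lM v; rewrite /pole_factor.
have [E|ne] := pselect (iQ @^-1` P = infty).
  by apply: (sheaf_twistE hP (cl_point hP) lM); rewrite E.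
have [t /(local_param_uniformizer (cl_point hP)) tP] := curve_dvr (cl_point hP).
rewrite (sheaf_twistE hP (cl_point hP) lM _ _ tP) /point_divisor.
by case: asboolP => // _; rewrite !expr0z.
Qed.

Definition period X (k l : nat) : Prop := forall i P, pointL P -> forall v,
  shf X i P v <-> shf X (i + l%:Z) P (pole_factor P k *: (v *m Pi_iter X l i)).

Lemma period_spec X k l : (forall i P, pointL P -> is_lattice P (shf X i P)) ->
  (forall i, Pi_iter X l i \in unitmx) ->
  period X k l <-> forall i P, pointL P ->
    sheaf_image (shf X i) (Pi_iter X l i) P =
    sheaf_twist iQ (point_divisor infty (- k%:Z)) (shf X (i + l%:Z)) P.
Proof.
move=> lX uP'; split=> H i P hP.
  apply/seteqP; split=> v.
    by move=> [w /(H i P hP) Xw <-]; apply/twist_infty => //; exact: lX.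
  move=> /(twist_infty k hP (lX _ _ hP)) Xv; exists (v *m invmx (Pi_iter X l i)).
    by apply/(H i P hP); rewrite mulmxKV.
  by rewrite mulmxKV.
move=> v; rewrite -(twist_infty k hP (lX _ _ hP)) -H //.
split=> [Xv|[w Xw E]]; first by exists v.
by rewrite -(can_inj (mulmxK (uP' i)) E).
Qed.

Lemma Pi_iterD X a b i :
  Pi_iter X (a + b) i = Pi_iter X a i *m Pi_iter X b (i + a%:Z).
Proof.
elim: b => [|b IH]; first by rewrite addn0 mulmx1.
by rewrite addnS /= IH mulmxA -addrA -PoszD.
Qed.

Lemma period_mul X k l n : period X k l -> period X (n * k) (n * l).
Proof.
move=> H; elim: n => [|n IH] i P hP v.
  rewrite /= addr0 mulmx1 /pole_factor /point_divisor.
  by case: asboolP => _; rewrite ?oppr0 ?mul0n ?oppr0 expr0z rmorph1 scale1r.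
rewrite (IH i P hP) (H _ P hP) !mulSnr Pi_iterD pole_factorD -addrA -PoszD.
by rewrite -scalemxAl scalerA mulmxA [pole_factor P k * _]mulrC.
Qed.

Lemma period_rank0 X k l : (forall i P, pointL P -> is_lattice P (shf X i P)) ->
  rank X = 0%N -> period X k l.
Proof.
move=> lX r0 i P hP v; have -> : v = 0.
  by apply/rowP => j; exfalso; move: (ltn_ord j); rewrite [Z in (_ < Z)%N]r0.
by rewrite mul0mx scaler0; split=> _; exact: (lattice0 hP (lX _ _ hP)).
Qed.

Lemma Pi_iter_unit X : abelian X -> forall l i, Pi_iter X l i \in unitmx.
Proof.
by move=> aX; elim=> [|l IH] i /=; rewrite ?unitmx1 // unitmx_mul IH (at_Pi_unit infty_rat aX).
Qed.

Lemma period_ex X : abelian X -> exists k l,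
  [/\ (0 < k)%N, (0 < l)%N, (l * dimn X = k * rank X)%N & period X k l].
Proof.
move=> aX; have [k [l [k0 l0 E H]]] := at_period aX; exists k, l; split=> //.
apply/period_spec => //; last exact: Pi_iter_unit.
exact: (at_lattice aX).
Qed.

(** Equality of the slopes dimn / rank, which are k / l for any period (k, l); cross-multiplied
    because a rank may be 0. *)
Definition same_slope X Y : Prop := (rank X * dimn Y = dimn X * rank Y)%N.

(** Both periods are stretched to the length l1 l2, and equal slopes force l2 k1 = l1 k2. In rank 0
    every pair is a period, so the period of the other tau-sheaf serves. *)
Lemma common_period X Y : abelian X -> abelian Y -> same_slope X Y ->
  exists k l, [/\ (0 < k)%N, (0 < l)%N, (l * dimn X = k * rank X)%N,
    (l * dimn Y = k * rank Y)%N & period X k l /\ period Y k l].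
Proof.
move=> aX aY sl.
have [k1 [l1 [k10 l10 E1 p1]]] := period_ex aX.
have [k2 [l2 [k20 l20 E2 p2]]] := period_ex aY.
have [rX0|rX0] := posnP (rank X).
  have dX0 : dimn X = 0%N.
    by apply/eqP; move/eqP: E1; rewrite rX0 muln0 muln_eq0 -leqn0 leqNgt l10.
  exists k2, l2; split=> //; first by rewrite dX0 rX0 !muln0.
  by split=> //; apply: period_rank0 => //; exact: (at_lattice aX).
have [rY0|rY0] := posnP (rank Y).
  have dY0 : dimn Y = 0%N.
    by apply/eqP; move/eqP: E2; rewrite rY0 muln0 muln_eq0 -leqn0 leqNgt l20.
  exists k1, l1; split=> //; first by rewrite dY0 rY0 !muln0.
  by split=> //; apply: period_rank0 => //; exact: (at_lattice aY).
have kl : (l2 * k1 = l1 * k2)%N.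
  have r0 : (0 < rank X * rank Y)%N by rewrite muln_gt0 rX0.
  apply/eqP; rewrite -(eqn_pmul2r r0); apply/eqP.
  transitivity (l1 * l2 * (dimn X * rank Y))%N.
    by rewrite mulnA -(mulnA l2) -E1; lia.
  have -> : (l1 * k2 * (rank X * rank Y) = l1 * rank X * (k2 * rank Y))%N by lia.
  by rewrite -E2 -sl; lia.
exists (l2 * k1)%N, (l2 * l1)%N; split.
- by rewrite muln_gt0 l20.
- by rewrite muln_gt0 l20.
- by rewrite -mulnA E1 mulnA.
- by rewrite kl [(l2 * l1)%N]mulnC -mulnA E2 mulnA.
split; first exact: period_mul.
by rewrite kl [(l2 * l1)%N]mulnC; exact: period_mul.
Qed.

End FixU.

Definition generic_iso X Y : Prop :=
  exists (f : tau_family X Y) (g : tau_family Y X),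
    [/\ forall i, f i *m g i = 1%:M, forall i, g i *m f i = 1%:M,
        forall i, Pi X i *m f (i + 1) = f i *m Pi Y i
      & forall i, tau X i *m f (i + 1) = map_mx sigma (f i) *m tau Y i].

Lemma Pi_iter_comm X Y (f : tau_family X Y) :
  (forall i, Pi X i *m f (i + 1) = f i *m Pi Y i) ->
  forall l i, Pi_iter X l i *m f (i + l%:Z) = f i *m Pi_iter Y l i.
Proof.
move=> fPi; elim=> [|l IH] i /=; first by rewrite addr0 mulmx1 mul1mx.
by rewrite mulmxA -IH -!mulmxA -fPi -addrA -PoszD addn1.
Qed.

(** One divisor must bound the poles of all f i, i in Z. A common period reduces this to 0 <= i < l;
    for these, f i respects the stalks outside finitely many points, and D is a large multiple of
    the sum of the points of C below them. *)
Lemma quasi_isogeny_of_generic_iso X Y : abelian X -> abelian Y ->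
  dimn X = dimn Y -> generic_iso X Y -> quasi_isogenous X Y.
Proof.
move=> aX aY dXY [f [g [fg gf fPi ftau]]].
have rXY : rank X = rank Y.
  apply/eqP; rewrite eqn_leq; apply/andP; split.
    by rewrite -(mxrank1 CL (rank X)) -(fg 0) (leq_trans (mxrankM_maxr _ _)) // rank_leq_row.
  by rewrite -(mxrank1 CL (rank Y)) -(gf 0) (leq_trans (mxrankM_maxr _ _)) // rank_leq_row.
have [t /(local_param_uniformizer infty_rat.1) tP] := curve_dvr infty_rat.1.
have sl : same_slope X Y by rewrite /same_slope rXY dXY mulnC.
have [k [l [k0 l0 _ _ [pX pY]]]] := common_period tP aX aY sl.
(* The uniformizers are taken on C, since the twist is by a divisor of C; their pullbacks lie in the
   maximal ideals above, which is all that [absorb] asks for. *)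
have /choice[u uP] : forall p, exists u, is_point (const C) p -> uniformizer p u.
  move=> p; have [hp|nhp] := pselect (is_point (const C) p); last by exists 0.
  by have [u /(local_param_uniformizer hp) ?] := curve_dvr hp; exists u.
pose w P := iQ (u (iQ @^-1` P)).
pose cond i P n := forall v, shf X i P v -> shf Y i P (w P ^+ n *: (v *m f i)).
have mw P : pointL P -> maxideal P (w P).
  move=> hP; rewrite /w; apply/(maxideal_preimage _ _ hP).
  by have [] := uP _ (cl_point hP).
have condS i P : pointL P -> exists n0, forall n, (n0 <= n)%N -> cond i P n.
  move=> hP; have [tP' tP'P] := cl_dvr hP.
  have [A uA XA] := at_lattice aX i hP; have [B uB YB] := at_lattice aY i hP.
  have [|N NP] := @eventually_fin _ (fun ij n =>
      P (w P ^+ n * (invmx A *m f i *m B) ij.1 ij.2)).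
    move=> ij; have [n0 n0P] := absorb hP ((invmx A *m f i *m B) ij.1 ij.2) tP'P (mw P hP).
    exists n0 => n nn0; rewrite -(subnK nn0) exprD -mulrA; apply: (pointM hP) => //.
    by apply: (pointX hP); exact: maxideal_sub (mw P hP).
  exists N => n Nn v /XA Iv; apply/YB.
  have -> : w P ^+ n *: (v *m f i) *m B = v *m A *m (w P ^+ n *: (invmx A *m f i *m B)).
    by rewrite -scalemxAr -scalemxAl !mulmxA mulmxK.
  by apply: (intvec_mul hP) Iv => a b; rewrite mxE; exact: (NP (a, b)).
have fin i : finite_set [set P | pointL P /\ ~ cond i P 0].
  have [y [d dep]] := cl_dep CL.
  apply: (@sub_finite_set _ _ ([set P | pointL P /\ ~ (forall v, shf X i P v <-> intvec P v)] `|`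
    ([set P | pointL P /\ ~ (forall v, shf Y i P v <-> intvec P v)] `|`
     [set P | pointL P /\ exists a b, ~ P (f i a b)]))); last first.
    rewrite !finite_setU; split; first exact: (at_finite aX).
    by split; [exact: (at_finite aY)|exact: (finite_poles_mx dep)].
  move=> P [hP nc].
  have [XP|] := pselect (forall v, shf X i P v <-> intvec P v); last by left.
  have [YP|] := pselect (forall v, shf Y i P v <-> intvec P v); last by right; left.
  right; right; split=> //; apply: contrapT => nf; apply: nc => v /XP Iv.
  rewrite expr0 scale1r; apply/YP; apply: (intvec_mul hP) Iv => a b.
  by apply: contrapT => ?; apply: nf; exists a, b.
pose Bad := [set P | exists i : 'I_l, pointL P /\ ~ cond i%:Z P 0].
have finBad : finite_set Bad by apply: finite_exists => i; exact: fin.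
have [N NP] : exists N, forall P, Bad P -> forall n, (N <= n)%N ->
    forall i : 'I_l, cond i%:Z P n.
  apply: eventually_finite_set => // P [_ [hP _]].
  have [|N NP] := @eventually_fin _ (fun (i : 'I_l) n => cond i%:Z P n).
    by move=> i; exact: condS.
  by exists N => n Nn i; exact: NP.
pose D p : int := if `[< ((fun P => iQ @^-1` P) @` Bad) p >] then N%:Z else 0.
have condD P : pointL P -> forall i : 'I_l,
    forall v, shf X i P v -> shf Y i P (iQ (u (iQ @^-1` P) ^ D (iQ @^-1` P)) *: (v *m f i)).
  move=> hP i v Xv; rewrite /D; case: asboolP => H; last first.
    rewrite expr0z rmorph1 scale1r.
    have [c0|nc0] := pselect (cond i%:Z P 0).
      by have := c0 v Xv; rewrite expr0 scale1r.
    by exfalso; apply: H; exists P => //; exists i.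
  rewrite -exprnP rmorphXn -/(w P).
  have [BP|nBP] := pselect (Bad P); first exact: NP.
  have [c0|nc0] := pselect (cond i%:Z P 0); last by exfalso; apply: nBP; exists i.
  have := c0 v Xv; rewrite expr0 scale1r => Yv.
  apply: (latticeZ hP (at_lattice aY _ hP)) => //; apply: (pointX hP).
  exact: maxideal_sub (mw P hP).
have perD P : pointL P -> forall i v, shf X i P v ->
    shf Y i P (iQ (u (iQ @^-1` P) ^ D (iQ @^-1` P)) *: (v *m f i)).
  move=> hP; set z := iQ _.
  pose Q i := forall v, shf X i P v -> shf Y i P (z *: (v *m f i)).
  (* The isomorphism given by the period consists of Pi's and a scalar, both of which commute with
     f. *)
  have step i : Q i <-> Q (i + l%:Z).
    have uPi := Pi_iter_unit aX l i.
    have swap v : z *: (pole_factor t P k *: (v *m Pi_iter X l i) *m f (i + l%:Z)) =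
        pole_factor t P k *: (z *: (v *m f i) *m Pi_iter Y l i).
      rewrite -!scalemxAl -!mulmxA (Pi_iter_comm fPi) !scalerA mulrC //.
    split=> H v Xv; last by apply/(pY i P hP); rewrite -swap; apply: H; apply/(pX i P hP).
    pose v' := (pole_factor t P k)^-1 *: (v *m invmx (Pi_iter X l i)).
    have vE : v = pole_factor t P k *: (v' *m Pi_iter X l i).
      by rewrite -scalemxAl scalerA mulfV ?pole_factor_neq0 // scale1r mulmxKV.
    rewrite vE swap; apply/(pY i P hP)/H/(pX i P hP); by rewrite -vE.
  have lz : l%:Z != 0 by rewrite eqz_nat -lt0n.
  move=> i; rewrite (divz_eq i l%:Z) addrC.
  have [r ->] : exists r : 'I_l, (i %% l%:Z)%Z = r%:Z.
    have m0 := modz_ge0 i lz; have ml := ltz_mod i lz.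
    have rl : (`|(i %% l%:Z)%Z| < l)%N by rewrite -ltz_nat gez0_abs.
    by exists (Ordinal rl); rewrite /= gez0_abs.
  move: (i %/ l%:Z)%Z => q; rewrite -/(Q _); move: q.
  apply: int_shift => [|q]; first by rewrite mul0r addr0; exact: condD.
  by rewrite mulrDl mul1r addrA; exact: step.
have uN0 p : is_point (const C) p -> u p != 0 by move=> hp; case: (uP p hp).
exists f, D; split.
  split=> [|p _]; last by rewrite /D; case: ifP.
  apply: (@sub_finite_set _ _ ((fun P => iQ @^-1` P) @` Bad)); last exact: finite_image.
  by move=> p [_]; rewrite /D; case: asboolP.
split=> //.
  split=> // i P hP _ [v Xv <-].
  apply/(sheaf_twistE hP (cl_point hP) (at_lattice aY i hP) _ _ (uP _ (cl_point hP))).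
  exact: perD.
move=> i P hP v _ vf; have := congr1 (mulmx^~ (g i)) vf.
by rewrite -mulmxA fg mulmx1 mul0mx.
Qed.

End Period.

(** * Kernels and direct sums *)

(** Each factor lowers the rank: if A P had the rank of P, right multiplication by A would map the
    row space of P onto itself, and nilpotency would give P = 0. Hence n commuting nilpotent
    matrices of size n have product 0. *)
Lemma commuting_nilpotent_rank (F : fieldType) n (s : seq 'M[F]_n) :
  (forall A B, A \in s -> B \in s -> A *m B = B *m A) ->
  (forall A, A \in s -> exists D, iter D (mulmx A) 1%:M = 0) ->
  (\rank (foldr mulmx 1%:M s) <= n - size s)%N.
Proof.
elim: s => [|A s IH] comm nil; first by rewrite subn0 rank_leq_row.
have {}IH : (\rank (foldr mulmx 1%:M s) <= n - size s)%N.
  apply: IH => [U V Us Vs|U Us]; first by apply: comm; rewrite inE ?Us ?Vs orbT.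
  by apply: nil; rewrite inE Us orbT.
have AP : A *m foldr mulmx 1%:M s = foldr mulmx 1%:M s *m A.
  have : forall B, B \in s -> A *m B = B *m A.
    by move=> B Bs; apply: comm; rewrite inE ?eqxx // Bs orbT.
  elim: (s) => [|B s' IHs] cB /=; first by rewrite mulmx1 mul1mx.
  rewrite mulmxA cB ?mem_head // -!mulmxA IHs // => B' B's'.
  by apply: cB; rewrite inE B's' orbT.
rewrite /=; move: (foldr _ _ _) AP IH => P AP IH.
have [->|P0] := eqVneq P 0; first by rewrite mulmx0 mxrank0.
have lt : (\rank (A *m P) < \rank P)%N.
  rewrite ltn_neqAle mxrankM_maxr andbT; apply: contra P0 => /eqP rk.
  have : (P <= A *m P)%MS.
    by have := mxrank_leqif_sup (submxMl A P) => -[_ <-]; rewrite rk.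
  rewrite AP => /submxP[Z PZ]; have [D AD] := nil A (mem_head _ _).
  have : exists U, P = U *m P *m iter D (mulmx A) 1%:M.
    elim: D {AD} => [|d [U PU]]; first by exists 1%:M; rewrite mul1mx mulmx1.
    exists (U *m Z); by rewrite {1}PU {1}PZ /= !mulmxA.
  by rewrite AD => -[U ->]; rewrite mulmx0.
by rewrite subnS -ltnS (leq_trans lt) // (leq_trans IH) // leqSpred.
Qed.

Section NilpotentQuotient.
Variables (k K : fieldType) (h : {rmorphism k -> K}) (r n : nat) (N M : set 'rV[K]_r).
Hypotheses (kN : ksubmod h N) (kM : ksubmod h M) (qd : quotient_dim h N M n).

(** The scalars f j act on N/M, of dimension n <= m, by commuting nilpotent matrices [R j]. This
    improves annihilation by some high power of the graph ideal to the power that the dimension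
    prescribes. *)
Lemma nilpotent_quotient (O : set K) m (f : 'I_m -> K) :
  (forall a v, O a -> N v -> N (a *: v)) -> (forall a v, O a -> M v -> M (a *: v)) ->
  (forall j, O (f j)) -> (forall j, exists D, forall v, N v -> M (f j ^+ D *: v)) ->
  (n <= m)%N -> forall v, N v -> M ((\prod_j f j) *: v).
Proof.
move=> NZ MZ Of nil nm.
have [b [Nb ex un]] := (quotient_dimP n kN kM).1 qd.
have [M0 MD _] := kM.
have Nab (a : 'rV_n) : N (map_mx h a *m b) by apply: ksubmod_mul.
have /choice[R RP] : forall j, exists R : 'M[k]_n, forall i,
    M (row i (f j *: b - map_mx h R *m b)).
  move=> j; have /choice[R RP] : forall i, exists a : 'rV[k]_n,
      M (f j *: row i b - map_mx h a *m b) by move=> i; apply: ex; apply: NZ.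
  exists (\matrix_i R i) => i.
  have -> : row i (f j *: b - map_mx h (\matrix_i R i) *m b) =
      f j *: row i b - map_mx h (R i) *m b; last exact: RP.
    by rewrite raddfB /= row_mul -map_row rowK; congr (_ - _); apply/rowP => l; rewrite !mxE.
have act j (a : 'rV_n) : M (f j *: (map_mx h a *m b) - map_mx h (a *m R j) *m b).
  by rewrite map_mxM -mulmxA scalemxAr -mulmxBr; exact: ksubmod_mul.
have uniq (a a' : 'rV_n) v : M (v - map_mx h a *m b) -> M (v - map_mx h a' *m b) -> a = a'.
  move=> H1 H2; apply/eqP; rewrite -subr_eq0; apply/eqP/un.
  have := ksubmodB kM H2 H1.
  by rewrite opprB addrC addrA subrK raddfB mulmxBl.
have act2 i j (a : 'rV_n) :
    M ((f i * f j) *: (map_mx h a *m b) - map_mx h (a *m R j *m R i) *m b).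
  have H1 := MZ _ _ (Of i) (act j a); rewrite scalerBr scalerA in H1.
  by have := MD _ _ H1 (act i (a *m R j)); rewrite addrA subrK.
have comm i j : R i *m R j = R j *m R i.
  apply/row_matrixP => l; rewrite !rowE !mulmxA.
  apply: (uniq _ _ _ (act2 j i _)); rewrite mulrC; exact: act2.
have MX j D v : M v -> M (f j ^+ D *: v).
  move=> Mv; elim: D => [|D IH]; first by rewrite scale1r.
  by rewrite exprS -scalerA; exact: MZ.
have MP (s : seq 'I_m) v : M v -> M ((\prod_(j <- s) f j) *: v).
  move=> Mv; elim: s => [|i s IH]; first by rewrite big_nil scale1r.
  by rewrite big_cons -scalerA; exact: MZ.
have actX D j (a : 'rV_n) :
    M (f j ^+ D *: (map_mx h a *m b) - map_mx h (a *m iter D (mulmx (R j)) 1%:M) *m b).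
  elim: D a => [|D IH] a /=; first by rewrite scale1r mulmx1 subrr.
  have := MD _ _ (MX j D _ (act j a)) (IH (a *m R j)).
  by rewrite scalerBr addrA subrK scalerA -exprSr -mulmxA.
have nilR j : exists D, iter D (mulmx (R j)) 1%:M = 0.
  have [D HD] := nil j; exists D; apply/row_matrixP => l; rewrite row0 rowE; apply: un.
  have := ksubmodB kM (HD _ (Nab (delta_mx 0 l))) (actX D j (delta_mx 0 l)).
  by rewrite opprB addrC subrK.
have prodE : foldr mulmx 1%:M [seq R j | j <- enum 'I_m] = 0.
  apply/eqP; rewrite -mxrank_eq0 -leqn0.
  rewrite (leq_trans (commuting_nilpotent_rank _ _)) //.
  - by move=> _ _ /mapP[i _ ->] /mapP[j _ ->].
  - by move=> _ /mapP[i _ ->].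
  by rewrite size_map size_enum_ord leqn0 subn_eq0.
have actP (s : seq 'I_m) (a : 'rV_n) : M ((\prod_(j <- s) f j) *: (map_mx h a *m b) -
    map_mx h (a *m foldr mulmx 1%:M [seq R j | j <- s]) *m b).
  elim: s a => [|j s IH] a; first by rewrite big_nil scale1r mulmx1 subrr.
  rewrite big_cons /=.
  have := MD _ _ (MP s _ (act j a)) (IH (a *m R j)).
  by rewrite scalerBr addrA subrK scalerA mulrC mulmxA.
move=> v Nv; have [a Ma] := ex v Nv.
have := actP (enum 'I_m) a; rewrite prodE mulmx0 map_mx0 mul0mx subr0 big_enum /=.
have := MP (enum 'I_m) _ Ma; rewrite big_enum /=.
by move=> H1 H2; have := MD _ _ H1 H2; rewrite scalerBr subrK.
Qed.

End NilpotentQuotient.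

Lemma image_ksubmod (k K : fieldType) (h : {rmorphism k -> K}) r r' (S : set 'rV[K]_r)
    (A : 'M_(r, r')) : ksubmod h S -> ksubmod h [set v *m A | v in S].
Proof.
move=> [S0 SD SZ]; split.
- by exists 0; rewrite ?mul0mx.
- by move=> _ _ [v Sv <-] [w Sw <-]; exists (v + w); [exact: SD|rewrite mulmxDl].
by move=> a _ [v Sv <-]; exists (h a *: v); [exact: SZ|rewrite scalemxAl].
Qed.

(* The snake lemma for injective maps [AX : SX -> NX] and [AY : SY -> NY] and
   surjective [f0], [f1] with kernels spanned by [B0], [B1]. *)
Lemma quotient_dim_snake (k K : fieldType) (h : {rmorphism k -> K}) rX rY rZ
    (SX NX : set 'rV[K]_rX) (SY NY : set 'rV[K]_rY)
    (AX : 'M_rX) (AY : 'M_rY) (AZ : 'M_rZ) (f0 f1 : 'M_(rX, rY))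
    (B0 B1 : 'M_(rZ, rX)) (B0' B1' : 'M_(rX, rZ)) n1 n2 :
  ksubmod h SX -> ksubmod h NX -> ksubmod h SY -> ksubmod h NY ->
  (forall v, SX v -> NX (v *m AX)) ->
  (forall w, SY w <-> exists2 v, SX v & w = v *m f0) ->
  (forall w, NY w <-> exists2 v, NX v & w = v *m f1) ->
  AX *m f1 = f0 *m AY -> (forall v : 'rV_rY, v *m AY = 0 -> v = 0) ->
  (forall v : 'rV_rX, v *m f0 = 0 -> v = v *m B0' *m B0) ->
  B1 *m f1 = 0 -> B1 *m B1' = 1%:M ->
  (forall v : 'rV_rX, v *m f1 = 0 -> v = v *m B1' *m B1) ->
  AZ *m B1 = B0 *m AX ->
  quotient_dim h NX [set v *m AX | v in SX] n1 ->
  quotient_dim h NY [set v *m AY | v in SY] n2 ->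
  (n2 <= n1)%N /\ quotient_dim h [set v | NX (v *m B1)]
    [set v *m AZ | v in [set v | SX (v *m B0)]] (n1 - n2).
Proof.
move=> kSX kNX kSY kNY SN fS fN comm injAY ker0 Bf1 BB1 ker1 AZB q1 q2.
have SYf v : SX v -> SY (v *m f0) by move=> Sv; apply/fS; exists v.
have [|||le q] := quotient_dim_ker kNX (image_ksubmod AX kSX) kNY
    (image_ksubmod AY kSY) _ fN _ Bf1 _ q1 q2.
- by move=> _ [v Sv <-]; exact: SN.
- move=> w; split=> [[y /fS[v Sv ->] <-]|[_ [v Sv <-] ->]].
    by exists (v *m AX); [exists v|rewrite -!mulmxA comm].
  by exists (v *m f0); [exact: SYf|rewrite -!mulmxA comm].
- by move=> v /ker1 ->; exists (v *m B1').
(* Since AY is injective, an element of the image of AX killed by f1 already comes from the kernel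
   of f0; so the submodule delivered by [quotient_dim_ker] is the image of AZ. *)
split=> //; apply: quotient_dim_ext q => // v; split=> [[x Sx xE]|[w Sw <-]].
  have : x *m f0 = 0.
    by apply: injAY; rewrite -mulmxA -comm mulmxA xE -mulmxA Bf1 mulmx0.
  move=> /ker0 xB; exists (x *m B0'); first by rewrite /= -xB.
  have E : x *m B0' *m AZ *m B1 = v *m B1 by rewrite -mulmxA AZB mulmxA -xB.
  by rewrite -[LHS]mulmx1 -BB1 mulmxA E -mulmxA BB1 mulmx1.
by exists (w *m B0) => //; rewrite -!mulmxA AZB.
Qed.

Section Kernel.
Variables (F : finFieldType) (C : curve F) (infty : set C).
Hypothesis infty_rat : rational_point (const C) infty.
Variables (L : finFieldType) (jL : {rmorphism F -> L}) (CL : curve_over C jL).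
Variable c : char_morphism C jL.
Local Notation pointL := (is_point (cl_const CL)).
Local Notation sigma := (cl_sigma CL).
Local Notation iQ := (cl_fun CL).
Local Notation abelian := (abelian_tau infty c).
Variables (X Y : tau_data CL) (f : tau_family X Y).
Hypotheses (aX : abelian X) (aY : abelian Y) (fhom : tau_hom f) (fsurj : tau_surjective f).

Lemma surj_stalk i P : pointL P -> forall w, shf Y i P w <-> exists2 v, shf X i P v & w = v *m f i.
Proof.
move=> hP w; rewrite -(fsurj i hP).
by split=> [[v Xv <-]|[v Xv ->]]; exists v.
Qed.

(** sigma is an automorphism of the function field, so every vector is the image of one under sigma,
    and the claim is surjectivity at the point sigma^-1(P). *)
Lemma surj_pullback i P : pointL P -> forall w, pullback sigma (shf Y i) P w <->
  exists2 v, pullback sigma (shf X i) P v & w = v *m map_mx sigma (f i).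
Proof.
move=> hP w; have hP' := sigma_point hP.
have pX := pullback_map hP (at_lattice aX i hP'); have pY := pullback_map hP (at_lattice aY i hP').
have [w' ->] := map_sigma_surj w; rewrite pY; split=> [/(surj_stalk i hP')[v Xv ->]|[v]].
  by exists (map_mx sigma v); [apply/pX|rewrite map_mxM].
have [v' ->] := map_sigma_surj v; rewrite pX -map_mxM => Xv' E.
apply/surj_stalk => //; exists v' => //.
by apply/matrixP => a b; have /matrixP /(_ a b) := E; rewrite !mxE => /fmorph_inj.
Qed.

Lemma surj_row_full i : row_full (f i).
Proof.
have [P hP] := cl_point_ex infty_rat CL.
rewrite -sub1mx; apply/row_subP => j.
have [a a0 Ya] := lattice_denominator hP (at_lattice aY i hP) (row j 1%:M).
have [v _ E] := (surj_stalk i hP _).1 Ya.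
by apply/submxP; exists (a^-1 *: v); rewrite -scalemxAl -E scalerA mulVf // scale1r.
Qed.

Lemma surj_rank : (rank Y <= rank X)%N.
Proof. by rewrite -(eqP (surj_row_full 0)) rank_leq_row. Qed.

(** Stretched to the length l1 l2, the periods have exponents l2 k1 for X and l1 k2 for Y.
    Surjectivity transports that of X to Y; if the exponents differed, a stalk of Y above [infty]
    would be stable under t^-d with d > 0, impossible for a nonzero lattice. *)
Lemma surj_same_slope : rank Y <> 0%N -> same_slope X Y.
Proof.
move=> rY0; have [fst fPi _] := fhom.
have [t /(local_param_uniformizer infty_rat.1) tP] := curve_dvr infty_rat.1.
have [k1 [l1 [k10 l10 E1 p1]]] := period_ex infty_rat tP aX.
have [k2 [l2 [k20 l20 E2 p2]]] := period_ex infty_rat tP aY.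
have pX := period_mul tP l2 p1; have pY := period_mul tP l1 p2.
rewrite [(l2 * l1)%N]mulnC in pX.
have [b ce] := cl_const_ext CL.
pose P := point_lift (cl_const CL) iQ b infty.
have [hP _] := rational_point_lift ce infty_rat.
have PQ : iQ @^-1` P = infty := point_lift_preimage ce infty_rat.
have t0 : t != 0 by case: tP.
have mt : maxideal P (iQ t).
  by apply/(maxideal_preimage _ _ hP); rewrite PQ; case: tP.
have pfE n : pole_factor infty t P n = (iQ t)^-1 ^+ n.
  by rewrite /pole_factor PQ /point_divisor asboolT // -exprnN rmorphV ?unitfE ?expf_neq0 // rmorphXn exprVn.
have key y : shf Y (l1 * l2)%:Z P (pole_factor infty t P (l2 * k1) *: y) <->
    shf Y (l1 * l2)%:Z P (pole_factor infty t P (l1 * k2) *: y).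
  have uPi := Pi_iter_unit infty_rat aY (l1 * l2) 0.
  rewrite -(mulmxKV uPi y); set y' := y *m _.
  have := pY 0 P hP y'; rewrite add0r => <-.
  have fPil := Pi_iter_comm fPi (l1 * l2) 0; rewrite add0r in fPil.
  split=> [/(surj_stalk _ hP)[v Xv E]|/(surj_stalk _ hP)[v Xv ->]].
    have uPiX := Pi_iter_unit infty_rat aX (l1 * l2) 0.
    pose v' := (pole_factor infty t P (l2 * k1))^-1 *: (v *m invmx (Pi_iter X (l1 * l2) 0)).
    have vE : v = pole_factor infty t P (l2 * k1) *: (v' *m Pi_iter X (l1 * l2) 0).
      by rewrite -scalemxAl scalerA mulfV ?pole_factor_neq0 // scale1r mulmxKV.
    apply/(surj_stalk _ hP); exists v'.
      by apply/(pX 0 P hP); rewrite add0r -vE.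
    apply: (can_inj (mulmxK uPi)); apply: (scalerI (pole_factor_neq0 tP P (l2 * k1))).
    by rewrite E vE -scalemxAl -!mulmxA fPil.
  apply/(surj_stalk _ hP); exists (pole_factor infty t P (l2 * k1) *: (v *m Pi_iter X (l1 * l2) 0)).
    by have /(pX 0 P hP) := Xv; rewrite add0r.
  by rewrite -scalemxAl -!mulmxA fPil.
have kl : (l2 * k1 = l1 * k2)%N.
  apply/eqP; apply: contrapT => /negP ne.
  have [a [d [d0 adE]]] : exists a d, (0 < d)%N /\
     (forall y, shf Y (l1 * l2)%:Z P (pole_factor infty t P a *: y) <->
    shf Y (l1 * l2)%:Z P (pole_factor infty t P (a + d) *: y)).
    move: ne; rewrite neq_ltn => /orP[lt|lt].
      exists (l2 * k1)%N, (l1 * k2 - l2 * k1)%N; rewrite subn_gt0; split=> // y.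
      by rewrite (subnKC (ltnW lt)).
    exists (l1 * k2)%N, (l2 * k1 - l1 * k2)%N; rewrite subn_gt0; split=> // y.
    by rewrite (subnKC (ltnW lt)) key.
  have lY := at_lattice aY (l1 * l2)%:Z hP.
  have stepY y : shf Y (l1 * l2)%:Z P y -> shf Y (l1 * l2)%:Z P ((iQ t)^-1 ^+ d *: y).
    have pa0 := pole_factor_neq0 tP P a.
    rewrite -{1}[y](scalerKV pa0) adE pole_factorD // [_ a * _]mulrC -scalerA scalerKV //.
    by rewrite pfE.
  have [B uB YB] := lY.
  have [rk|rk] := posnP (rank Y); first by rewrite rk in rY0.
  pose j0 : 'I_(rank Y) := Ordinal rk.
  (* A basis vector of the lattice: its multiple by t^-d has a coordinate that is not integral. *)
  pose y := (delta_mx 0 j0 : 'rV_(rank Y)) *m invmx B.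
  have Yy : shf Y (l1 * l2)%:Z P y.
    apply/YB; rewrite mulmxKV // => j; rewrite mxE.
    by case: (_ && _); [exact: (point1 hP)|exact: (point0 hP)].
  have := (YB _).1 (stepY _ Yy) j0.
  rewrite -scalemxAl mulmxKV // !mxE !eqxx mulr1 exprVn.
  apply: maxideal_inv; first by rewrite expf_neq0 // fmorph_eq0.
  by rewrite -(prednK d0); exact: (maxidealXS hP).
rewrite /same_slope.
have l0 : (0 < l1 * l2)%N by rewrite muln_gt0 l10.
apply/eqP; rewrite -(eqn_pmul2l l0); apply/eqP.
have -> : (l1 * l2 * (rank X * dimn Y) = l1 * rank X * (l2 * dimn Y))%N by lia.
have -> : (l1 * l2 * (dimn X * rank Y) = (l1 * dimn X) * (l2 * rank Y))%N by lia.
rewrite E1 E2.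
have -> : (l1 * rank X * (k2 * rank Y) = (l1 * k2) * (rank X * rank Y))%N by lia.
by rewrite -kl; lia.
Qed.

Hypothesis slope : same_slope X Y.

Local Notation rZ := (rank X - rank Y)%N.

Lemma kernel_bases : exists (B : int -> 'M[CL]_(rZ, rank X)) (B' : int -> 'M[CL]_(rank X, rZ)),
  forall i, [/\ B i *m f i = 0, B i *m B' i = 1%:M
    & forall p (V : 'M_(p, rank X)), V *m f i = 0 -> V = V *m B' i *m B i].
Proof.
have /choice[B /choice[B' H]] : forall i, exists (B : 'M[CL]_(rZ, rank X)), exists (B' : 'M[CL]_(rank X, rZ)),
  [/\ B *m f i = 0, B *m B' = 1%:M
    & forall p (V : 'M_(p, rank X)), V *m f i = 0 -> V = V *m B' *m B].
  by move=> i; exact: ker_basis (surj_row_full i).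
by exists B, B'.
Qed.

Variables (B : int -> 'M[CL]_(rZ, rank X)) (B' : int -> 'M[CL]_(rank X, rZ)).
Hypothesis BP : forall i, [/\ B i *m f i = 0, B i *m B' i = 1%:M
    & forall p (V : 'M_(p, rank X)), V *m f i = 0 -> V = V *m B' i *m B i].

(** The generic kernel of f i is identified with row vectors through the basis [B i], the stalks
    being the vectors of the kernel that lie in X. The right inverse [B'] reads off coordinates, so
    Pi and tau are the restrictions of those of X. *)
Definition kernel_tau : tau_data CL :=
  @TauData CL rZ (dimn X - dimn Y)
    (fun i P => [set v | shf X i P (v *m B i)])
    (fun i => B i *m Pi X i *m B' (i + 1))
    (fun i => map_mx sigma (B i) *m tau X i *m B' (i + 1)).
Local Notation Z := kernel_tau.

Lemma kernel_Pi i : Pi Z i *m B (i + 1) = B i *m Pi X i.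
Proof.
have [_ fPi _] := fhom; have [Bf _ _] := BP i; have [_ _ ker] := BP (i + 1).
by rewrite /= -ker // -mulmxA fPi mulmxA Bf mul0mx.
Qed.

Lemma kernel_tauE i : tau Z i *m B (i + 1) = map_mx sigma (B i) *m tau X i.
Proof.
have [_ _ ftau] := fhom; have [Bf _ _] := BP i; have [_ _ ker] := BP (i + 1).
by rewrite /= -ker // -mulmxA ftau mulmxA -map_mxM Bf map_mx0 mul0mx.
Qed.

Lemma kernel_inj i p (V W : 'M_(p, rZ)) : V *m B i = W *m B i -> V = W.
Proof.
have [_ BB _] := BP i => /(congr1 (mulmx^~ (B' i))).
by rewrite -!mulmxA BB !mulmx1.
Qed.

Lemma kernel_eq0 i p (V : 'M_(p, rZ)) : V *m B i = 0 -> V = 0.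
Proof. by move=> E; apply: (@kernel_inj i); rewrite mul0mx. Qed.

Lemma kernel_lattice i P : pointL P -> is_lattice P (shf Z i P).
Proof.
move=> hP; apply: (lattice_preimage hP (at_lattice aX i hP)) => v; exact: kernel_eq0.
Qed.

Lemma kernel_pullback i P : pointL P -> forall v,
  pullback sigma (shf Z i) P v <-> pullback sigma (shf X i) P (v *m map_mx sigma (B i)).
Proof.
move=> hP v; have hP' := sigma_point hP; have [w ->] := map_sigma_surj v.
rewrite -map_mxM (pullback_map hP (kernel_lattice i hP')).
by rewrite (pullback_map hP (at_lattice aX i hP')).
Qed.

Lemma kernel_free i : locally_free (cl_const CL) (shf Z i).
Proof.
have [y [n dep]] := cl_dep CL; apply/(locally_freeP dep); split; first exact: kernel_lattice.
apply: (@sub_finite_set _ _ ([set P | pointL P /\ ~ (forall v, shf X i P v <-> intvec P v)] `|`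
  ([set P | pointL P /\ exists a b, ~ P (B i a b)] `|`
   [set P | pointL P /\ exists a b, ~ P (B' i a b)]))); last first.
  rewrite !finite_setU; split; first exact: (at_finite aX).
  by split; exact: (finite_poles_mx dep).
move=> P [hP nZ]; have [XP|] := pselect (forall v, shf X i P v <-> intvec P v); last by left.
have [nB|HB] := pselect (exists a b, ~ P (B i a b)); first by right; left.
have [nB'|HB'] := pselect (exists a b, ~ P (B' i a b)); first by right; right.
exfalso; apply: nZ => v; rewrite /= XP; split=> H.
  have [_ BB _] := BP i; rewrite -[v]mulmx1 -BB mulmxA; apply: (intvec_mul hP) H => a b.
  by apply: contrapT => ?; apply: HB'; exists a, b.
apply: (intvec_mul hP) H => a b.
by apply: contrapT => ?; apply: HB; exists a, b.
Qed.

Lemma map_kernel i : [/\ map_mx sigma (B i) *m map_mx sigma (f i) = 0,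
  map_mx sigma (B i) *m map_mx sigma (B' i) = 1%:M
  & forall p (V : 'M_(p, rank X)), V *m map_mx sigma (f i) = 0 ->
      V = V *m map_mx sigma (B' i) *m map_mx sigma (B i)].
Proof.
have [Bf BB ker] := BP i; rewrite -!map_mxM Bf BB map_mx0 map_mx1; split=> // p V.
have [V' ->] := map_sigma_surj V; rewrite -!map_mxM => E; congr (map_mx _ _).
apply: ker; apply/matrixP => a b; have /matrixP /(_ a b) := E.
by rewrite !mxE => /eqP; rewrite fmorph_eq0 => /eqP.
Qed.

Let kX i P (hP : pointL P) := lattice_ksubmod hP (at_lattice aX i hP).
Let kY i P (hP : pointL P) := lattice_ksubmod hP (at_lattice aY i hP).
Let kpX i P (hP : pointL P) := lattice_ksubmod hP (at_pullback aX i hP).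
Let kpY i P (hP : pointL P) := lattice_ksubmod hP (at_pullback aY i hP).

Lemma kernel_coker_Pi i : (dimn Y <= dimn X)%N /\
  coker_dim (cl_const CL) (shf Z i) (shf Z (i + 1)) (Pi Z i) (dimn Z).
Proof.
have [_ fPi _] := fhom; have [Bf0 BB0 ker0] := BP i; have [Bf1 BB1 ker1] := BP (i + 1).
apply: coker_dim_sub (at_coker_Pi aX i) (at_coker_Pi aY i) => P hP d1 d2.
apply: (@quotient_dim_snake _ _ _ _ _ _ (shf X i P) (shf X (i + 1) P) (shf Y i P) (shf Y (i + 1) P)
  (Pi X i) (Pi Y i) (Pi Z i) (f i) (f (i + 1)) (B i) (B (i + 1)) (B' i) (B' (i + 1))) => //.
- exact: kX.
- exact: kX.
- exact: kY.
- exact: kY.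
- by move=> v Xv; apply: (at_Pi_hom aX (i := i) hP); exists v.
- exact: surj_stalk.
- exact: surj_stalk.
- move=> v /(congr1 (mulmx^~ (invmx (Pi Y i)))) /=.
  by rewrite mulmxK ?(at_Pi_unit infty_rat aY) // mul0mx.
- exact: ker0.
- exact: ker1.
exact: kernel_Pi.
Qed.

Lemma kernel_coker_tau i :
  coker_dim (cl_const CL) (pullback sigma (shf Z i)) (shf Z (i + 1)) (tau Z i) (dimn Z).
Proof.
have [_ _ ftau] := fhom; have [Bf0 BB0 ker0] := map_kernel i; have [Bf1 BB1 ker1] := BP (i + 1).
suff : (dimn Y <= dimn X)%N /\ coker_dim (cl_const CL) (pullback sigma (shf Z i)) (shf Z (i + 1)) (tau Z i) (dimn Z) by case.
apply: coker_dim_sub (at_coker_tau aX i) (at_coker_tau aY i) => P hP d1 d2 q1 q2.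
have [||||||||||||le q] := @quotient_dim_snake _ _ _ _ _ _ (pullback sigma (shf X i) P) (shf X (i + 1) P)
  (pullback sigma (shf Y i) P) (shf Y (i + 1) P)
  (tau X i) (tau Y i) (tau Z i) (map_mx sigma (f i)) (f (i + 1)) (map_mx sigma (B i)) (B (i + 1))
  (map_mx sigma (B' i)) (B' (i + 1)) d1 d2 (kpX i hP) (kX (i + 1) hP) (kpY i hP) (kY (i + 1) hP) => //.
- by move=> v Xv; apply: (at_tau_hom aX (i := i) hP); exists v.
- exact: surj_pullback.
- exact: surj_stalk.
- move=> v /(congr1 (mulmx^~ (invmx (tau Y i)))) /=.
  by rewrite mulmxK ?(at_tau_unit infty_rat aY) // mul0mx.
- exact: ker0.
- exact: ker1.
- exact: kernel_tauE.
split=> //; apply: quotient_dim_ext q => // v.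
by split=> -[w /(kernel_pullback i hP) Sw <-]; exists w.
Qed.

Lemma kernel_abelian : abelian Z.
Proof.
have [_ fPi _] := fhom.
have gPi v i : v *m Pi Z i = 0 -> v = 0 :> 'rV_rZ.
  move=> E; apply: (@kernel_eq0 i); apply: (can_inj (mulmxK (at_Pi_unit infty_rat aX i))).
  by rewrite mul0mx -mulmxA -kernel_Pi mulmxA E mul0mx.
have gtau v i : v *m tau Z i = 0 -> v = 0 :> 'rV_rZ.
  move=> E; have [_ BB _] := map_kernel i.
  have : v *m map_mx sigma (B i) = 0.
    apply: (can_inj (mulmxK (at_tau_unit infty_rat aX i))).
    by rewrite mul0mx -mulmxA -kernel_tauE mulmxA E mul0mx.
  by move=> /(congr1 (mulmx^~ (map_mx sigma (B' i)))); rewrite -mulmxA BB mulmx1 mul0mx.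
split.
- exact: kernel_free.
- move=> i P hP _ [v Zv <-]; rewrite /= -mulmxA -[_ *m _ *m B' _]/(Pi Z i) kernel_Pi mulmxA.
  by apply: (at_Pi_hom aX (i := i) hP); exists (v *m B i).
- by move=> i P hP v _; exact: gPi.
- move=> i P hP _ [v /(kernel_pullback i hP) Zv <-].
  rewrite /= -mulmxA -[_ *m _ *m B' _]/(tau Z i) kernel_tauE mulmxA.
  by apply: (at_tau_hom aX (i := i) hP); exists (v *m map_mx sigma (B i)).
- by move=> i P hP v _; exact: gtau.
- move=> i; apply: (@kernel_inj (i + 1 + 1)).
  have H1 : tau Z i *m Pi Z (i + 1) *m B (i + 1 + 1) = map_mx sigma (B i) *m tau X i *m Pi X (i + 1).
    by rewrite -mulmxA kernel_Pi mulmxA kernel_tauE.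
  have H2 : map_mx sigma (Pi Z i) *m tau Z (i + 1) *m B (i + 1 + 1) =
      map_mx sigma (B i) *m tau X i *m Pi X (i + 1).
    by rewrite -mulmxA kernel_tauE mulmxA -map_mxM kernel_Pi map_mxM -!mulmxA (at_comm aX).
  exact: etrans H1 (esym H2).
- have [t /(local_param_uniformizer infty_rat.1) tP] := curve_dvr infty_rat.1.
  have [k [l [k0 l0 E1 E2 [pX pY]]]] := common_period infty_rat tP aX aY slope.
  have BPi := Pi_iter_comm (X := Z) (Y := X) (f := B) kernel_Pi.
  exists k, l; split=> //; first by rewrite /= mulnBr E1 E2 mulnBr.
  apply/(period_spec tP) => [i P hP|i|i P hP v]; first exact: kernel_lattice.
    apply: inj_unitmx => v E; apply: (@kernel_eq0 i).
    apply: (can_inj (mulmxK (Pi_iter_unit infty_rat aX l i))).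
    by rewrite mul0mx -mulmxA -BPi mulmxA E mul0mx.
  rewrite /= (pX i P hP); rewrite -scalemxAl -!mulmxA.
  by rewrite -BPi.
- by move=> i; case: (kernel_coker_Pi i).
- exact: kernel_coker_tau.
(* The cokernel of tau on the kernel has local dimension at most [dimn Z], so nilpotency of each
   factor suffices for a product of [dimn Z] of them to vanish. *)
move=> i P hP g gJ v Zv.
have [d dle qd] := coker_dim_le (kernel_coker_tau i) hP.
have kZ : ksubmod (cl_const CL) (shf Z (i + 1) P).
  by apply: (lattice_ksubmod hP); exact: kernel_lattice.
have lpZ : is_lattice P (pullback sigma (shf Z i) P).
  by apply: (pullback_lattice hP); apply/kernel_lattice/sigma_point.
have kM := image_ksubmod (tau Z i) (lattice_ksubmod hP lpZ).
apply: (nilpotent_quotient kZ kM qd (O := P)) => //.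
- by move=> a w Pa Zw; apply: (latticeZ hP (kernel_lattice (i + 1) hP)).
- move=> a _ Pa [w Sw <-]; exists (a *: w); last by rewrite scalemxAl.
  exact: (latticeZ hP lpZ).
- by move=> j; case: (gJ j).
(* The exponent comes from the condition on X for the constant family g j. The preimage x under tau
   is killed by f because tau of Y is injective, so it lies in the kernel. *)
move=> j; exists (dimn X) => w Zw.
have [x Sx xE] := at_char aX hP (f := fun=> g j) (fun=> gJ j) Zw.
rewrite prodr_const card_ord in xE.
have [_ _ ftau] := fhom; have [Bf _ _] := BP (i + 1).
have [_ _ ker] := map_kernel i.
have : x *m map_mx sigma (f i) = 0.
  apply: (can_inj (mulmxK (at_tau_unit infty_rat aY i))).
  by rewrite mul0mx -mulmxA -ftau mulmxA xE -scalemxAl -mulmxA Bf mulmx0 scaler0.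
move=> /ker xB; exists (x *m map_mx sigma (B' i)).
  by apply/(kernel_pullback i hP); rewrite -xB.
apply: (@kernel_inj (i + 1)).
by rewrite -mulmxA kernel_tauE mulmxA -xB xE scalemxAl.
Qed.

End Kernel.

(** * Direct sums of equal slope *)

Section DirectSum.
Variables (F : finFieldType) (C : curve F) (infty : set C).
Hypothesis infty_rat : rational_point (const C) infty.
Variables (L : finFieldType) (jL : {rmorphism F -> L}) (CL : curve_over C jL).
Variable c : char_morphism C jL.
Local Notation pointL := (is_point (cl_const CL)).
Local Notation sigma := (cl_sigma CL).
Local Notation abelian := (abelian_tau infty c).

Lemma mul_block_diag (K : fieldType) m n p q (v : 'rV[K]_(m + n)) (A : 'M_(m, p)) (D : 'M_(n, q)) :
  v *m block_mx A 0 0 D = row_mx (lsubmx v *m A) (rsubmx v *m D).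
Proof. by rewrite -{1}[v]hsubmxK mul_row_block !mulmx0 addr0 add0r. Qed.

Lemma intvec_row (K : fieldType) (O : set K) m n (v : 'rV[K]_(m + n)) :
  intvec O v <-> intvec O (lsubmx v) /\ intvec O (rsubmx v).
Proof.
split=> [H|[Hl Hr] j].
  by split=> j; rewrite mxE; exact: H.
by case: (split_ordP j) => i ->; [have := Hl i|have := Hr i]; rewrite !mxE.
Qed.

Section Sum.
Variables (X Y : tau_data CL).
Hypotheses (aX : abelian X) (aY : abelian Y) (slope : same_slope X Y).
Local Notation Z := (tau_sum X Y).

Lemma sum_lattice i P : pointL P -> is_lattice P (shf Z i P).
Proof.
move=> hP; have [A uA XA] := at_lattice aX i hP; have [B uB YB] := at_lattice aY i hP.
exists (block_mx A 0 0 B); first by rewrite unitmxE det_ublock unitrM -!unitmxE uA.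
by move=> v; rewrite /= XA YB mul_block_diag intvec_row row_mxKl row_mxKr.
Qed.

Lemma sum_free i : locally_free (cl_const CL) (shf Z i).
Proof.
have [y [n dep]] := cl_dep CL; apply/(locally_freeP dep); split; first exact: sum_lattice.
apply: (@sub_finite_set _ _ ([set P | pointL P /\ ~ (forall v, shf X i P v <-> intvec P v)] `|`
  [set P | pointL P /\ ~ (forall v, shf Y i P v <-> intvec P v)])); last first.
  by rewrite finite_setU; split; [exact: (at_finite aX)|exact: (at_finite aY)].
move=> P [hP nZ]; have [XP|] := pselect (forall v, shf X i P v <-> intvec P v); last by left.
have [YP|] := pselect (forall v, shf Y i P v <-> intvec P v); last by right.
by exfalso; apply: nZ => v; rewrite /= XP YP intvec_row.
Qed.

Lemma sum_pullback i P : pointL P -> forall v, pullback sigma (shf Z i) P v <->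
  pullback sigma (shf X i) P (lsubmx v) /\ pullback sigma (shf Y i) P (rsubmx v).
Proof.
move=> hP v; have hP' := sigma_point hP; have [w ->] := map_sigma_surj v.
rewrite -map_lsubmx -map_rsubmx (pullback_map hP (sum_lattice i hP')).
by rewrite (pullback_map hP (at_lattice aX i hP')) (pullback_map hP (at_lattice aY i hP')).
Qed.

Lemma sum_image m n (SX : sheaf CL m) (SY : sheaf CL n) (A : 'M_m) (B : 'M_n) P v :
  sheaf_image (fun P => [set v | SX P (lsubmx v) /\ SY P (rsubmx v)]) (block_mx A 0 0 B) P v <->
  sheaf_image SX A P (lsubmx v) /\ sheaf_image SY B P (rsubmx v).
Proof.
split=> [[w [Xw Yw] <-]|[[x Xx xE] [y Yy yE]]].
  by rewrite mul_block_diag row_mxKl row_mxKr; split; [exists (lsubmx w)|exists (rsubmx w)].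
exists (row_mx x y); first by rewrite /= row_mxKl row_mxKr.
by rewrite mul_block_diag row_mxKl row_mxKr xE yE hsubmxK.
Qed.

Lemma sum_inj m n (A : 'M[CL]_m) (B : 'M[CL]_n) : A \in unitmx -> B \in unitmx ->
  forall v : 'rV_(m + n), v *m block_mx A 0 0 B = 0 -> v = 0.
Proof.
move=> uA uB v; have u : block_mx A 0 0 B \in unitmx.
  by rewrite unitmxE det_ublock unitrM -!unitmxE uA.
by move=> /(congr1 (mulmx^~ (invmx (block_mx A 0 0 B)))); rewrite mulmxK // mul0mx.
Qed.

Lemma sum_Pi_iter l i : Pi_iter Z l i = block_mx (Pi_iter X l i) 0 0 (Pi_iter Y l i).
Proof.
elim: l => [|l IH] /=; first by rewrite -scalar_mx_block.
by rewrite IH mulmx_block !mulmx0 !mul0mx !addr0 !add0r.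
Qed.

Let kX i P (hP : pointL P) := lattice_ksubmod hP (at_lattice aX i hP).
Let kY i P (hP : pointL P) := lattice_ksubmod hP (at_lattice aY i hP).
Let kpX i P (hP : pointL P) := lattice_ksubmod hP (at_pullback aX i hP).
Let kpY i P (hP : pointL P) := lattice_ksubmod hP (at_pullback aY i hP).

Lemma sum_abelian : abelian Z.
Proof.
split.
- exact: sum_free.
- move=> i P hP v /sum_image[Xv Yv]; split; first exact: (at_Pi_hom aX (i := i) hP).
  exact: (at_Pi_hom aY (i := i) hP).
- move=> i P hP v _; apply: sum_inj; [exact: (at_Pi_unit infty_rat aX)|exact: (at_Pi_unit infty_rat aY)].
- move=> i P hP _ [v /(sum_pullback i hP)[Xv Yv] <-].
  rewrite /= mul_block_diag row_mxKl row_mxKr; split.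
    by apply: (at_tau_hom aX (i := i) hP); exists (lsubmx v).
  by apply: (at_tau_hom aY (i := i) hP); exists (rsubmx v).
- move=> i P hP v _; apply: sum_inj; [exact: (at_tau_unit infty_rat aX)|exact: (at_tau_unit infty_rat aY)].
- move=> i; rewrite /= map_block_mx !map_mx0 !mulmx_block !mulmx0 !mul0mx !addr0 !add0r.
  by rewrite (at_comm aX) (at_comm aY).
- have [t /(local_param_uniformizer infty_rat.1) tP] := curve_dvr infty_rat.1.
  have [k [l [k0 l0 E1 E2 [pX pY]]]] := common_period infty_rat tP aX aY slope.
  exists k, l; split=> //; first by rewrite /= !mulnDr E1 E2.
  apply/(period_spec tP) => [i P hP|i|i P hP v]; first exact: sum_lattice.
    rewrite sum_Pi_iter unitmxE det_ublock unitrM -!unitmxE.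
    by rewrite (Pi_iter_unit infty_rat aX) (Pi_iter_unit infty_rat aY).
  rewrite /= (pX i P hP) (pY i P hP) sum_Pi_iter mul_block_diag.
  by rewrite scale_row_mx row_mxKl row_mxKr.
- move=> i; apply: coker_dim_add (at_coker_Pi aX i) (at_coker_Pi aY i) => P hP d1 d2 q1 q2.
  have := quotient_dim_sum (kX (i + 1) hP) (image_ksubmod (Pi X i) (kX i hP))
    (kY (i + 1) hP) (image_ksubmod (Pi Y i) (kY i hP)) q1 q2.
  apply: quotient_dim_ext => // v.
  by rewrite -[X in _ <-> X]/(sheaf_image _ _ P v) sum_image.
- move=> i; apply: coker_dim_add (at_coker_tau aX i) (at_coker_tau aY i) => P hP d1 d2 q1 q2.
  have := quotient_dim_sum (kX (i + 1) hP) (image_ksubmod (tau X i) (kpX i hP))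
    (kY (i + 1) hP) (image_ksubmod (tau Y i) (kpY i hP)) q1 q2.
  apply: quotient_dim_ext => // v; rewrite -[X in X <-> _]/(sheaf_image _ _ P _ /\ sheaf_image _ _ P _).
  rewrite -sum_image; split=> -[w Sw <-]; exists w => //.
    by apply/(sum_pullback i hP).
  by apply/(sum_pullback i hP).
move=> i P hP g gJ v [Xv Yv].
have Og j : P (g j) by case: (gJ j).
rewrite /= in g gJ Og *; rewrite big_split_ord /=.
have lX := at_lattice aX (i + 1) hP; have lY := at_lattice aY (i + 1) hP.
(* The first [dimn X] factors kill the cokernel of X and the others that of Y; on either summand the
   remaining factors are just integral scalars. *)
have Pr : P (\prod_(j < dimn Y) g (rshift (dimn X) j)) by apply: (point_prod hP) => j _; exact: Og.
have Pl : P (\prod_(j < dimn X) g (lshift (dimn Y) j)) by apply: (point_prod hP) => j _; exact: Og.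
have [x Sx xE] := at_char aX hP (f := fun j => g (lshift _ j)) (fun j => gJ _)
  (latticeZ hP lX Pr Xv).
have [y Sy yE] := at_char aY hP (f := fun j => g (rshift _ j)) (fun j => gJ _)
  (latticeZ hP lY Pl Yv).
exists (row_mx x y); first by apply/(sum_pullback i hP); rewrite row_mxKl row_mxKr.
rewrite mul_block_diag row_mxKl row_mxKr xE yE !scalerA [X in row_mx _ (X *: _)]mulrC.
by rewrite -scale_row_mx hsubmxK.
Qed.

End Sum.

Lemma tau_zero_abelian : abelian (tau_zero CL).
Proof.
have all0 (v : 'rV[CL]_0) : v = 0 by rewrite [v]thinmx0.
have allT (S : set 'rV[CL]_0) v : S 0 -> S v by rewrite (all0 v).
have cok (M : sheaf CL 0) (A : 'M_0) : (forall P, M P 0) ->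
    coker_dim (cl_const CL) M (fun _ => setT) A 0.
  move=> M0; exists (fun=> 0%N); split.
  - move=> P hP; exists (fun=> 0); split=> [[]//|v _].
    exists [ffun=> 0]; split; last by move=> a _; apply/ffunP => -[].
    by apply: allT; exists 0; rewrite ?mul0mx.
  - by apply: (@sub_finite_set _ _ set0) => // P [].
  by rewrite fsbig1.
have p0 P : pullback sigma (fun _ => setT : set 'rV[CL]_0) P 0.
  by exists 0%N, (fun=> 0), (fun=> 0); split=> [[]//|[]//|]; rewrite big_ord0.
split=> //=.
- move=> i P hP; exists 1%:M, set0; split=> //; first exact: unitmx1.
  by move=> P' _ _; apply/seteqP; split=> // v _; exists v; [case|rewrite mulmx1].
- by move=> i P hP v _ _; exact: all0.
- by move=> i P hP v _ _; exact: all0.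
- by move=> i; rewrite !mul0mx map_mx0 mul0mx.
- exists 1%N, 1%N; split=> // i P hP; apply/seteqP; split=> v _.
    apply: allT; exists 0%N, (fun=> 0), (fun=> 0); split=> [[]//|[]//|]; by rewrite big_ord0.
  by apply: allT; exists 0; rewrite ?mul0mx.
- by move=> i; exact: cok.
- by move=> i; exact: cok.
by move=> i P hP f _ v _; apply: allT; exists 0; rewrite ?mul0mx.
Qed.

End DirectSum.

(** * Semisimplicity *)

(* [horner_mx] requires a positive size. *)
Definition mxeval (K : fieldType) r (A : 'M[K]_r) (p : {poly K}) : 'M[K]_r :=
  \sum_(i < size p) p`_i *: A ^+ i.

Lemma mxeval_horner (K : fieldType) r (A : 'M[K]_r.+1) p : mxeval A p = horner_mx A p.
Proof.
rewrite -{2}[p]coefK poly_def raddf_sum; apply: eq_bigr => i _.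
by rewrite /= horner_mxZ rmorphXn /= horner_mx_X.
Qed.

Lemma mxeval_deriv (K : fieldType) r (A : 'M[K]_r) p :
  mxeval A p^`() = \sum_(n < size p) p`_n *: (A ^+ n.-1 *+ n).
Proof.
case: r A => [|r] A; first by apply/matrixP => -[].
rewrite mxeval_horner -{1}[p]coefK poly_def !raddf_sum; apply: eq_bigr => n _ /=.
rewrite derivZ horner_mxZ derivXn; congr (_ *: _).
by rewrite raddfMn /= rmorphXn /= horner_mx_X.
Qed.

Lemma mxeval_inverse (K : fieldType) r (A : 'M[K]_r) (g d u w : {poly K}) :
  mxeval A g = 0 -> w * g + u * d = 1 -> mxeval A d *m mxeval A u = 1%:M.
Proof.
case: r A => [|r] A; first by move=> _ _; apply/matrixP => -[].
rewrite !mxeval_horner => gA wu; rewrite -[LHS]/(_ * _) -rmorphM mulrC.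
have := congr1 (horner_mx A) wu; rewrite rmorphD [in X in X + _]rmorphM /= gA mulr0 add0r.
by rewrite rmorph1.
Qed.

Section SeparableSection.
Variables (K : fieldType) (r r' : nat) (A : 'M[K]_r) (B : 'M[K]_r') (f : 'M[K]_(r, r')).
Hypotheses (comm : A *m f = f *m B) (full : row_full f).

Lemma mulmxX_comm n : A ^+ n *m f = f *m B ^+ n.
Proof.
elim: n => [|n IH]; first by rewrite !expr0 mul1mx mulmx1.
by rewrite !exprSr -[A ^+ n * A]/(A ^+ n *m A) -mulmxA comm mulmxA IH -mulmxA.
Qed.

Lemma mxeval_comm p : mxeval A p *m f = f *m mxeval B p.
Proof.
rewrite /mxeval mulmx_suml mulmx_sumr; apply: eq_bigr => i _.
by rewrite -scalemxAl -scalemxAr mulmxX_comm.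
Qed.

(* With [g(X) - g(Y) = (X - Y) G(X, Y)] and [u] the inverse of [g'] modulo [g],
   [G(B, A)] applied to any linear section, times [u(A)], is an equivariant
   section; here [D n] is [sum_(i + j = n - 1) B^i S0 A^j]. *)
Lemma separable_section (g : {poly K}) : separable_poly g -> mxeval A g = 0 ->
  exists S : 'M_(r', r), S *m f = 1%:M /\ B *m S = S *m A.
Proof.
move=> sep gA; have [S0 S0f] := row_fullP full.
have gB : mxeval B g = 0.
  by rewrite -[LHS]mul1mx -S0f -mulmxA -mxeval_comm gA mul0mx mulmx0.
pose D := fix D n := if n is n'.+1 then B ^+ n' *m S0 + D n' *m A else 0 : 'M_(r', r).
have DB n : B *m D n - D n *m A = B ^+ n *m S0 - S0 *m A ^+ n.
  elim: n => [|n IH]; first by rewrite /= mulmx0 mul0mx !expr0 mul1mx mulmx1 !subrr.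
  have IH' : B *m D n *m A - D n *m A *m A = B ^+ n *m S0 *m A - S0 *m A ^+ n *m A.
    by rewrite -!mulmxBl IH.
  rewrite /= mulmxDr mulmxDl !mulmxA opprD addrACA IH' addrA subrK exprS exprSr.
  by rewrite -(mulmxA S0).
(* As S0 f = 1, all n terms become B^(n-1): this is G(X, X) = g'(X). *)
have Df n : D n *m f = B ^+ n.-1 *+ n.
  elim: n => [|n IH]; first by rewrite /= mul0mx.
  rewrite /= mulmxDl -!mulmxA S0f comm mulmxA IH mulmx1 mulrS; congr (_ + _).
  by case: n {IH} => [|n]; rewrite ?mul0mx // -[_ *m B]/(_ * B) mulrnAl -exprSr.
pose S1 := \sum_(n < size g) g`_n *: D n.
have S1c : B *m S1 = S1 *m A.
  apply/eqP; rewrite -subr_eq0 mulmx_sumr mulmx_suml -sumrB.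
  rewrite (eq_bigr (fun n : 'I_(size g) => g`_n *: B ^+ n *m S0 - S0 *m (g`_n *: A ^+ n))).
    by rewrite sumrB -mulmx_suml -mulmx_sumr -/(mxeval B g) -/(mxeval A g) gA gB mul0mx mulmx0 subrr.
  move=> n _; rewrite -scalemxAl -scalemxAr -!scalemxAl -!scalemxAr -!scalerBr DB //.
have S1f : S1 *m f = mxeval B g^`().
  rewrite mxeval_deriv mulmx_suml; apply: eq_bigr => n _.
  by rewrite -scalemxAl Df.
have /Bezout_eq1_coprimepP[[w u] /= wu] : coprimep g g^`() by move: sep; rewrite unlock.
exists (S1 *m mxeval A u); split.
  rewrite -mulmxA mxeval_comm mulmxA S1f.
  exact: mxeval_inverse wu.
rewrite mulmxA S1c -!mulmxA; congr (_ *m _).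
rewrite /mxeval mulmx_suml mulmx_sumr; apply: eq_bigr => i _.
rewrite -scalemxAl -scalemxAr; congr (_ *: _).
by rewrite -[LHS]/(A * _) -[RHS]/(_ * A) -exprS exprSr.
Qed.

End SeparableSection.

(* Hilbert 90 style averaging: [Psi] is a semilinear operator with [Psi ^ e = 1]
   on the equivariant sections, and [lam] has trace 1. *)
Lemma semilinear_section (F : finFieldType) (C : curve F) (L : finFieldType)
    (jL : {rmorphism F -> L}) (CL : curve_over C jL) r r'
    (A : 'M[CL]_r) (B : 'M[CL]_r') (f : 'M[CL]_(r, r')) (S : 'M[CL]_(r', r)) :
  A \in unitmx -> B \in unitmx ->
  A *m f = map_mx (cl_sigma CL) f *m B -> S *m f = 1%:M ->
  semilinear_pow (cl_sigma CL) B (cl_deg CL) *m S =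
    S *m semilinear_pow (cl_sigma CL) A (cl_deg CL) ->
  exists S' : 'M_(r', r), S' *m f = 1%:M /\ map_mx (cl_sigma CL) S' *m A = B *m S'.
Proof.
set s := cl_sigma CL; set e := cl_deg CL => uA uB Af Sf BS.
pose Psi (U : 'M[CL]_(r', r)) := invmx B *m map_mx s U *m A.
have PsiE U : B *m Psi U = map_mx s U *m A by rewrite /Psi !mulmxA mulmxV // mul1mx.
have PsiZ a U : Psi (a *: U) = s a *: Psi U.
  by rewrite /Psi map_mxZ -scalemxAr -scalemxAl.
have PsiN n : semilinear_pow s B n *m iter n Psi S = iter n (map_mx s) S *m semilinear_pow s A n.
  elim: n => [|n IH]; first by rewrite /= mul1mx mulmx1.
  by rewrite /= -mulmxA PsiE mulmxA -map_mxM IH map_mxM -mulmxA.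
have uN n : semilinear_pow s B n \in unitmx.
  by elim: n => [|n IH] /=; rewrite ?unitmx1 // unitmx_mul map_unitmx IH.
(* Equivariance for the e-th iterates says exactly that Psi^e fixes S, as sigma^e is the
   identity. *)
have Psie : iter e Psi S = S.
  apply: (can_inj (mulKmx (uN e))); rewrite PsiN map_sigma_order; exact: esym.
have Psif n : iter n Psi S *m f = 1%:M.
  elim: n => //= n IH; rewrite /Psi -!mulmxA Af (mulmxA (map_mx s _)) -map_mxM IH map_mx1 mul1mx.
  by rewrite mulVmx.
have [lam lam1] := trace1 CL.
pose S' := \sum_(i < e) iter i s lam *: iter i Psi S.
have PsiS' : Psi S' = S'.
  have -> : Psi S' = \sum_(i < e) iter i.+1 s lam *: iter i.+1 Psi S.
    rewrite /Psi raddf_sum mulmx_sumr mulmx_suml; apply: eq_bigr => i _.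
    by rewrite -[LHS]/(Psi _) PsiZ.
  have rot : forall n, iter n Psi S = S -> iter n s lam = lam ->
      \sum_(i < n) iter i.+1 s lam *: iter i.+1 Psi S = \sum_(i < n) iter i s lam *: iter i Psi S.
    case=> [|n] H1 H2; first by rewrite !big_ord0.
    by rewrite big_ord_recr H1 H2 [RHS]big_ord_recl /= addrC.
  exact: rot Psie (sigma_order lam).
exists S'; split.
  rewrite mulmx_suml (eq_bigr (fun i : 'I_e => iter i s lam *: 1%:M)).
    by rewrite -scaler_suml lam1 scale1r.
  by move=> i _; rewrite -scalemxAl Psif.
by rewrite -PsiE PsiS'.
Qed.

(** * Splitting off simple factors *)

Section Decomposition.
Variables (F : finFieldType) (C : curve F) (infty : set C).
Hypothesis infty_rat : rational_point (const C) infty.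
Variables (L : finFieldType) (jL : {rmorphism F -> L}) (CL : curve_over C jL).
Variable c : char_morphism C jL.
Local Notation sigma := (cl_sigma CL).
Local Notation e := (cl_deg CL).
Local Notation iQ := (cl_fun CL).
Local Notation abelian := (abelian_tau infty c).
Implicit Types X Y : tau_data CL.

Lemma generic_iso_sym X Y : generic_iso X Y -> generic_iso Y X.
Proof.
move=> [f [g [fg gf fPi ft]]]; exists g, f; split=> // i.
  by rewrite -[LHS]mul1mx -(gf i) -mulmxA (mulmxA (f i)) -fPi -!mulmxA fg mulmx1.
rewrite -[LHS]mul1mx -(map_mx1 sigma) -(gf i) map_mxM -mulmxA (mulmxA (map_mx _ (f i))) -ft.
by rewrite -!mulmxA fg mulmx1.
Qed.

Lemma generic_iso_trans X Y Z : generic_iso X Y -> generic_iso Y Z -> generic_iso X Z.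
Proof.
move=> [f [g [fg gf fPi ft]]] [f' [g' [fg' gf' fPi' ft']]].
exists (fun i => f i *m f' i), (fun i => g' i *m g i); split=> i.
- by rewrite -mulmxA (mulmxA (f' i)) fg' mul1mx fg.
- by rewrite -mulmxA (mulmxA (g i)) gf mul1mx gf'.
- by rewrite mulmxA fPi -mulmxA fPi' mulmxA.
by rewrite mulmxA ft -mulmxA ft' mulmxA -map_mxM.
Qed.

Lemma generic_iso_sumr X Y Y' : generic_iso Y Y' -> generic_iso (tau_sum X Y) (tau_sum X Y').
Proof.
move=> [f [g [fg gf fPi ft]]].
exists (fun i => block_mx 1%:M 0 0 (f i)), (fun i => block_mx 1%:M 0 0 (g i)).
split=> i /=; rewrite ?map_block_mx ?map_mx0 ?map_mx1 mulmx_block !(mulmx0, mul0mx, addr0, add0r, mulmx1, mul1mx).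
- by rewrite fg -scalar_mx_block.
- by rewrite gf -scalar_mx_block.
- by rewrite mulmx_block !(mulmx0, mul0mx, addr0, add0r, mulmx1, mul1mx) fPi.
by rewrite mulmx_block !(mulmx0, mul0mx, addr0, add0r, mulmx1, mul1mx) ft.
Qed.

Lemma generic_iso_rank X Y : generic_iso X Y -> rank X = rank Y.
Proof.
move=> [f [g [fg gf _ _]]]; apply/eqP; rewrite eqn_leq; apply/andP; split.
  by rewrite -(mxrank1 CL (rank X)) -(fg 0) (leq_trans (mxrankM_maxr _ _)) // rank_leq_row.
by rewrite -(mxrank1 CL (rank Y)) -(gf 0) (leq_trans (mxrankM_maxr _ _)) // rank_leq_row.
Qed.

(** Commutation with the Pi's makes the whole family one matrix between the stalks at index 0;
    commutation with the tau's is then a single equation. *)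
Lemma trivialized_hom X Y W T W' T' (f : tau_family X Y) :
  trivialization W T -> trivialization W' T' ->
  (forall i, Pi X i *m f (i + 1) = f i *m Pi Y i) ->
  (forall i, tau X i *m f (i + 1) = map_mx sigma (f i) *m tau Y i) ->
  exists fh : 'M_(rank X, rank Y), (forall i, W i *m f i = fh *m W' i) /\
    T *m fh = map_mx sigma fh *m T'.
Proof.
move=> [uW uT WS tW] [uW' uT' WS' tW'] fPi ft.
exists (W 0 *m f 0 *m invmx (W' 0)).
have H : forall i, W i *m f i = W 0 *m f 0 *m invmx (W' 0) *m W' i.
  apply: int_shift => [|i]; first by rewrite mulmxKV.
  rewrite WS WS' -(mulmxA (W i)) fPi !mulmxA; split=> [->//|E].
  have uPi : Pi Y i \in unitmx by have := uW' (i + 1); rewrite WS' unitmx_mul uW'.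
  exact: (can_inj (mulmxK uPi)).
split=> //; set fh := _ *m invmx (W' 0) in H *.
apply: (can_inj (mulmxK (uW' 1))).
rewrite -[T *m fh *m W' 1]mulmxA -H -[map_mx _ _ *m T' *m _]mulmxA.
have := tW' 0; rewrite add0r => <-; rewrite mulmxA.
have := tW 0; rewrite add0r => <-; rewrite -mulmxA.
have := ft 0; rewrite add0r => ->; by rewrite !mulmxA -!map_mxM H.
Qed.

Lemma hom_of_trivialized X Y W T W' T' (fh : 'M[CL]_(rank X, rank Y)) :
  trivialization (X := X) W T -> trivialization (X := Y) W' T' ->
  T *m fh = map_mx sigma fh *m T' ->
  let f : tau_family X Y := fun i => invmx (W i) *m fh *m W' i in
  (forall i, Pi X i *m f (i + 1) = f i *m Pi Y i) /\
  (forall i, tau X i *m f (i + 1) = map_mx sigma (f i) *m tau Y i).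
Proof.
move=> [uW uT WS tW] [uW' uT' WS' tW'] E f.
have fE i : W i *m f i = fh *m W' i by rewrite /f !mulmxA mulmxV // mul1mx.
clearbody f.
split=> i.
  apply: (can_inj (mulKmx (uW i))).
  by rewrite !mulmxA -WS !fE WS' mulmxA.
have uW1 : map_mx sigma (W i) \in unitmx by rewrite map_unitmx.
apply: (can_inj (mulKmx uW1)).
rewrite mulmxA tW -mulmxA fE mulmxA E -mulmxA -tW' !mulmxA -!map_mxM.
by rewrite fE.
Qed.

Lemma semilinear_pow_comm r r' (A : 'M[CL]_r) (B : 'M[CL]_r') (f : 'M[CL]_(r, r')) n :
  A *m f = map_mx sigma f *m B ->
  semilinear_pow sigma A n *m f = iter n (map_mx sigma) f *m semilinear_pow sigma B n.
Proof.
move=> Af; elim: n => [|n IH]; first by rewrite /= mul1mx mulmx1.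
by rewrite /= -mulmxA Af mulmxA -map_mxM IH map_mxM mulmxA.
Qed.

Lemma frobenius_comm r r' (A : 'M[CL]_r) (B : 'M[CL]_r') (f : 'M[CL]_(r, r')) :
  A *m f = map_mx sigma f *m B ->
  semilinear_pow sigma A e *m f = f *m semilinear_pow sigma B e.
Proof. by move=> /semilinear_pow_comm ->; rewrite map_sigma_order. Qed.

Lemma tau_hom_id X : tau_hom (fun i => 1%:M : 'M_(rank X)).
Proof.
split=> i; last 2 first.
- by rewrite mulmx1 mul1mx.
- by rewrite mulmx1 map_mx1 mul1mx.
by move=> P hP _ [v Xv <-]; rewrite mulmx1.
Qed.

Lemma tau_surjective_id X : tau_surjective (fun i => 1%:M : 'M_(rank X)).
Proof.
move=> i P hP; apply/seteqP; split=> v; first by move=> [w Xw <-]; rewrite mulmx1.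
by move=> Xv; exists v; rewrite ?mulmx1.
Qed.

Lemma tau_hom_comp X Y Z (f : tau_family X Y) (g : tau_family Y Z) :
  tau_hom f -> tau_hom g -> tau_hom (fun i => f i *m g i).
Proof.
move=> [f1 f2 f3] [g1 g2 g3]; split=> i.
- by move=> P hP _ [v Xv <-]; rewrite mulmxA; apply: (g1 i P hP); exists (v *m f i) => //; apply: (f1 i P hP); exists v.
- by rewrite mulmxA f2 -mulmxA g2 mulmxA.
by rewrite mulmxA f3 -mulmxA g3 mulmxA map_mxM.
Qed.

Lemma tau_surjective_comp X Y Z (f : tau_family X Y) (g : tau_family Y Z) :
  tau_surjective f -> tau_surjective g -> tau_surjective (fun i => f i *m g i).
Proof.
move=> fs gs i P hP; rewrite -(gs i P hP); apply/seteqP; split=> v.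
  move=> [w Xw <-]; exists (w *m f i); last by rewrite mulmxA.
  by rewrite -(fs i P hP); exists w.
by move=> [w]; rewrite -(fs i P hP) => -[x Xx <-] <-; exists x => //; rewrite mulmxA.
Qed.

Lemma surj_iso X Y (f : tau_family X Y) : abelian Y -> tau_hom f ->
  tau_surjective f -> rank Y = rank X -> tau_iso X Y.
Proof.
move=> aY fhom fs rk; have full := surj_row_full infty_rat aY fs.
have free i : row_free (f i) by rewrite /row_free (eqP (full i)) rk.
have /choice[g gf] : forall i, exists g, g *m f i = 1%:M by move=> i; exact: (row_fullP (full i)).
have fg i : f i *m g i = 1%:M.
  have [g' fg'] := row_freeP (free i).
  by rewrite -{1}[g i]mulmx1 -fg' (mulmxA (g i)) gf mul1mx.
exists f, g; have [f1 f2 f3] := fhom.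
split=> //; split=> i.
- move=> P hP _ [w Yw <-]; move: Yw; rewrite -(fs i P hP) => -[v Xv <-].
  by rewrite -mulmxA fg mulmx1.
- by rewrite -[LHS]mul1mx -(gf i) -mulmxA (mulmxA (f i)) -f2 -!mulmxA fg mulmx1.
rewrite -[LHS]mul1mx -(map_mx1 sigma) -(gf i) map_mxM -mulmxA (mulmxA (map_mx _ (f i))) -f3.
by rewrite -!mulmxA fg mulmx1.
Qed.

(* A factor of minimal nonzero rank is simple. *)
Lemma simple_factor X : abelian X -> rank X <> 0%N ->
  exists Y (f : tau_family X Y), [/\ simple_tau infty c Y, tau_hom f & tau_surjective f].
Proof.
move=> aX rX.
pose Q n := `[< exists Y (f : tau_family X Y),
  [/\ abelian Y, tau_hom f & tau_surjective f] /\ rank Y = n /\ n <> 0%N >].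
have exQ : exists n, Q n.
  exists (rank X); apply/asboolP; exists X, (fun=> 1%:M); split=> //; split=> //.
    exact: tau_hom_id.
  exact: tau_surjective_id.
case: (ex_minnP exQ) => n /asboolP[Y [f [[aY fhom fs] [rY n0]]]] nmin.
exists Y, f; split=> //; split=> //; first by rewrite rY.
move=> Y' g aY' ghom gs; have [r0|r0] := pselect (rank Y' = 0%N); [by left|right].
apply: (surj_iso aY' ghom gs); apply/eqP; rewrite eqn_leq.
rewrite (surj_rank infty_rat aY' gs) rY; apply: nmin; apply/asboolP.
exists Y', (fun i => f i *m g i); split=> //; split=> //.
  exact: tau_hom_comp.
exact: tau_surjective_comp.
Qed.

(** Stated for the e-th iterate in a trivialization instead of for [frobenius X]: in this form it
    passes to kernels and to base changes. *)
Definition frobenius_killed X (g : {poly C}) : Prop := exists W T,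
  trivialization (X := X) W T /\ mxeval (semilinear_pow sigma T e) (map_poly iQ g) = 0.

(** Equality of dimensions is carried along for the slope condition of [sum_abelian] and for the
    final isogeny; equality of ranks follows from the generic isomorphism. *)
Lemma decomposition (g : {poly C}) n X : separable_poly g -> (rank X <= n)%N ->
  abelian X -> frobenius_killed X g -> exists s : seq (tau_data CL),
  [/\ forall i, (i < size s)%N -> simple_tau infty c (nth (tau_zero CL) s i),
      abelian (foldr (@tau_sum _ _ _ _ CL) (tau_zero CL) s),
      generic_iso X (foldr (@tau_sum _ _ _ _ CL) (tau_zero CL) s)
    & dimn X = dimn (foldr (@tau_sum _ _ _ _ CL) (tau_zero CL) s)].
Proof.
move=> sep; elim: n X => [|n IH] X rX aX killX.
  exists [::]; rewrite leqn0 in rX; split=> //=; first exact: tau_zero_abelian.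
    exists (fun=> 0), (fun=> 0).
    have all0 p (A B : 'M[CL]_(rank X, p)) : A = B.
      by apply/matrixP => i; exfalso; move: (ltn_ord i); rewrite [Z in (_ < Z)%N](eqP rX).
    by split=> i; rewrite ?[LHS]thinmx0 ?[RHS]thinmx0 //; exact: all0.
  (* The relation l d = k r with l > 0 forces dimension 0 in rank 0. *)
  have [k [l [k0 l0 E _]]] := at_period aX.
  by apply/eqP; move/eqP: E; rewrite (eqP rX) muln0 muln_eq0 -leqn0 leqNgt l0.
have [r0|rX0] := pselect (rank X = 0%N); first by apply: IH => //; rewrite r0.
have [Y [f [simY fhom fs]]] := simple_factor aX rX0.
have [aY rY0 _] := simY.
have slope := surj_same_slope infty_rat aX aY fhom fs rY0.
have [B [B' BP]] := kernel_bases infty_rat aY fs.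
pose Z := kernel_tau B B'.
have aZ : abelian Z := kernel_abelian infty_rat aX aY fhom fs slope BP.
have [dle _] := kernel_coker_Pi infty_rat aX aY fhom fs BP 0.
have rle := surj_rank infty_rat aY fs.
have BPi := kernel_Pi fhom BP; have Btau := kernel_tauE fhom BP.
have [W [T [triv gT]]] := killX.
have [WY [TY trivY]] := trivialization_ex infty_rat aY.
have [WZ [TZ trivZ]] := trivialization_ex infty_rat aZ.
have [_ fPi ftau] := fhom.
have [fh [fhE fhT]] := trivialized_hom triv trivY fPi ftau.
have [Bh [BhE BhT]] := @trivialized_hom Z X _ _ _ _ B trivZ triv BPi Btau.
have [uW _ _ _] := triv; have [uWY uTY _ _] := trivY; have [uWZ _ _ _] := trivZ.
have [_ uT _ _] := triv.
have full : row_full fh.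
  apply/row_fullP; have [H Hf] := row_fullP (surj_row_full infty_rat aY fs 0).
  exists (WY 0 *m H *m invmx (W 0)); apply: (can_inj (mulmxK (uWY 0))).
  by rewrite mul1mx -!mulmxA -fhE (mulmxA (invmx (W 0))) mulVmx // mul1mx Hf mulmx1.
have piE := frobenius_comm fhT.
(* The inclusion of the kernel intertwines the two Frobenius maps and is injective, so g kills the
   one on the kernel. *)
have killZ : frobenius_killed Z g.
  exists WZ, TZ; split=> //; set M := mxeval _ _.
  have M0 : M *m Bh = 0 by rewrite (mxeval_comm (frobenius_comm BhT)) gT mulmx0.
  apply: (can_inj (mulmxK (uWZ 0))); rewrite mul0mx; apply: (kernel_eq0 BP (i := 0)).
  by rewrite -mulmxA BhE mulmxA M0 mul0mx.
have sep' : separable_poly (map_poly iQ g) by rewrite separable_map.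
have [S0 [S0f S0pi]] := separable_section piE full sep' gT.
have [S [Sf ST]] := semilinear_section uT uTY fhT S0f S0pi.
have [SPi Stau] := hom_of_trivialized trivY triv (esym ST).
pose Sfam : tau_family Y X := fun i => invmx (WY i) *m S *m W i.
have SfamE : (fun i => invmx (WY i) *m S *m W i) = Sfam by [].
have Sf1 i : Sfam i *m f i = 1%:M.
  by rewrite /Sfam /= -!mulmxA fhE (mulmxA S) Sf mul1mx mulVmx.
have {}SPi i : Pi Y i *m Sfam (i + 1) = Sfam i *m Pi X i by exact: SPi.
have {}Stau i : tau Y i *m Sfam (i + 1) = map_mx sigma (Sfam i) *m tau X i by exact: Stau.
clearbody Sfam.
(* X is generically the image of the section plus the kernel of f; the second component of the
   inverse is the projection 1 - f S onto the kernel, in the coordinates [B']. *)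
have isoX : generic_iso (tau_sum Y Z) X.
  exists (fun i => col_mx (Sfam i) (B i)),
    (fun i => row_mx (f i) ((1%:M - f i *m Sfam i) *m B' i)); split=> i.
  - have [Bf BB _] := BP i; rewrite mul_col_row Sf1 Bf !mulmxA !mulmxBr !mulmx1 !mulmxA.
    by rewrite Sf1 Bf mul1mx mul0mx subr0 subrr mul0mx BB -scalar_mx_block.
  - have [_ _ ker] := BP i; rewrite mul_row_col -ker; first by rewrite addrC subrK.
    by rewrite mulmxBl mul1mx -mulmxA Sf1 mulmx1 subrr.
  - rewrite [LHS]mul_block_col !mul0mx addr0 add0r SPi mul_col_mx; congr col_mx.
    exact: BPi.
  rewrite [LHS]mul_block_col !mul0mx addr0 add0r Stau map_col_mx mul_col_mx; congr col_mx.
  exact: Btau.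
have rZn : (rank Z <= n)%N.
  by rewrite /= leq_subLR (leq_trans rX) // -add1n leq_add2r lt0n; apply/eqP.
have [s [simS aS isoS dimS]] := IH Z rZn aZ killZ.
have rkS := generic_iso_rank isoS.
exists (Y :: s); split=> /=.
- by case=> [|i] //= ?; exact: simS.
- apply: sum_abelian => //; rewrite /same_slope -dimS -rkS /= !mulnBr.
  by rewrite [(rank Y * dimn X)%N]mulnC -slope [(rank Y * dimn Y)%N]mulnC [(dimn Y * rank X)%N]mulnC.
- by apply: generic_iso_trans (generic_iso_sym isoX) _; exact: generic_iso_sumr.
by rewrite -dimS /= subnKC.
Qed.

Theorem separable_semisimple (g : {poly C}) X : separable_poly g -> abelian X ->
  frobenius_killed X g -> semisimple_tau infty c X.
Proof.
move=> sep aX killX; have [s [simS aS isoS dimS]] := decomposition sep (leqnn _) aX killX.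
exists (size s), (fun j => nth (tau_zero CL) s j).
have -> : \big[@tau_sum _ _ _ _ CL/tau_zero CL]_(j < size s) nth (tau_zero CL) s j =
    foldr (@tau_sum _ _ _ _ CL) (tau_zero CL) s.
  by rewrite foldrE (big_nth (tau_zero CL)) big_mkord.
split=> //; first by move=> j; exact: simS.
exact: (quasi_isogeny_of_generic_iso infty_rat aX aS dimS isoS).
Qed.

End Decomposition.

(** * Extension of the base field *)

Section CharacteristicPoint.
Variables (F : finFieldType) (C : curve F) (L : finFieldType) (jL : {rmorphism F -> L}).
Variables (CL : curve_over C jL) (c : char_morphism C jL) (P : set CL).
Local Notation iQ := (cl_fun CL).
Local Notation cst := (cl_const CL).
Local Notation ev := (char_ev c).
Local Notation o := (char_point c).
Hypotheses (hP : is_point (cl_const CL) P) (Po : iQ @^-1` P = o).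
Hypothesis Pc : forall a, o a -> maxideal P (iQ a - cst (ev a)).

Let ho : is_point (const C) o := char_pointP c.
Local Notation m := (maxideal P).

Lemma char_ev_exp a n : o a -> ev (a ^+ n) = ev a ^+ n.
Proof.
move=> oa; have ev1 : ev 1 = 1 by rewrite -(rmorph1 (const C)) char_ev_const rmorph1.
elim: n => [|n IH]; first by rewrite !expr0.
by rewrite exprS char_evM ?IH -?exprS //; exact: (pointX ho).
Qed.

Let m_const x : m (cst x) -> x = 0.
Proof. by move=> mx; apply/eqP/negPn/negP => /(maxideal_const hP). Qed.

Let residue_mul x y a b : P x -> P y -> m (x - cst a) -> m (y - cst b) -> m (x * y - cst (a * b)).
Proof.
move=> Px Py mx my.
have -> : x * y - cst (a * b) = (x - cst a) * y + cst a * (y - cst b) by rewrite rmorphM; ring.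
apply: (maxidealD hP); first exact: (maxidealMr hP).
by apply: (maxidealMl hP) => //; exact: (point_const hP).
Qed.

(* The quotient of [a ^ s - a] by [a - c] where [c] is the value of [a] in the
   field with [s] elements; it is a unit at [P]. *)
Let cofactor a := \sum_(i < #|L|) iQ a ^+ (#|L|.-1 - i) * cst (ev a) ^+ i - 1.

Let cofactorE a : o a ->
  (iQ a - cst (ev a)) * cofactor a = iQ (a ^+ #|L| - a).
Proof.
move=> oa; rewrite /cofactor mulrBr mulr1 -subrXX.
have -> : cst (ev a) ^+ #|L| = cst (ev a) by rewrite -rmorphXn expf_card.
by rewrite rmorphB rmorphXn; ring.
Qed.

(** Modulo m the cofactor is the derivative of X^s - X at the value of a: each term of the sum
    becomes the same power, their number s is 0 in L, and -1 remains. *)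
Let cofactor_unit a : o a -> ~ m (cofactor a).
Proof.
move=> oa mc.
have Pa : P (iQ a) by move: oa; rewrite -Po.
have card0 : (#|L|%:R : L) = 0.
  have := expg_cardG (finset.in_setT (1 : L)); rewrite FinRing.zmodXgE finset.cardsT.
  by [].
have : m (cst (-1)); last by move/m_const/eqP; rewrite oppr_eq0 oner_eq0.
have -> : -1 = \sum_(i < #|L|) ev a ^+ (#|L|.-1 - i) * ev a ^+ i - 1.
  rewrite (eq_bigr (fun=> ev a ^+ #|L|.-1)).
    by rewrite sumr_const card_ord -mulr_natl card0 mul0r sub0r.
  by move=> i _; rewrite -exprD subnK // -ltnS prednK // (ltn_trans _ (card_finNzRing_gt1 L)).
rewrite -[cst _](subKr (cofactor a)); apply: (maxidealB hP) => //.
rewrite /cofactor rmorphB rmorph1 opprB addrA subrK rmorph_sum -sumrB.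
apply: (maxideal_sum hP) => i _.
rewrite rmorphM [cst (_ ^+ i)]rmorphXn -mulrBl.
apply: (maxidealMr hP); first by rewrite -rmorphXn; exact: (point_const hP).
by rewrite -char_ev_exp // -rmorphXn; apply: Pc; exact: (pointX ho).
Qed.

(** Elements of [A], the ring o (x) L, have residues in L by hypothesis; what is needed is that [P]
    has no residues beyond those of A. Cofactors turn an element of A vanishing at P into a
    combination of functions a^s - a, which vanish at o and are divisible by u. Hence every nonzero
    x in P is a power of u times quotients of units at P coming from A, and has a residue in L. *)
Lemma rational_of_characteristic : rational_point cst P.
Proof.
have [u uP] := curve_dvr ho.
have [u0 mu uU] := local_param_uniformizer ho uP.
have [_ _ uV] := uP.
have miu : m (iQ u) by apply/(maxideal_preimage _ _ hP); rewrite Po.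
have iu0 : iQ u != 0 by rewrite fmorph_eq0.
have [b ce] := cl_const_ext CL.
pose A := point_lift cst iQ b o.
have PiQ a : o a -> P (iQ a) by rewrite -Po.
have AP y : A y -> P y.
  move=> [a [oa ->]]; apply: (point_sum hP) => i _.
  by apply: (pointM hP); [exact: PiQ|exact: (point_const hP)].
have Acof a : o a -> A (cofactor a).
  move=> oa; apply: (point_liftB ho); last exact: (point_lift1 ce ho).
  apply: (point_lift_sum ce ho) => i _; rewrite -!rmorphXn.
  apply: (point_lift_phiM ho); first exact: (pointX ho).
  exact: (point_lift_const ce ho).
have Ares y : A y -> exists x, m (y - cst x).
  move=> [a [oa ->]]; exists (\sum_i ev (a i) * b i).
  rewrite rmorph_sum -sumrB; apply: (maxideal_sum hP) => i _.
  rewrite rmorphM -mulrBl; apply: (maxidealMr hP); last exact: Pc.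
  exact: (point_const hP).
have main N y : A y -> ~ P (y / iQ u ^+ N) -> exists n z w,
    [/\ A z, A w, ~ m z, ~ m w & y * w = iQ u ^+ n * z].
  elim: N y => [|N IH] y Ay nP; first by exfalso; apply: nP; rewrite divr1; exact: AP.
  have [my|nmy] := pselect (m y); last first.
    exists 0%N, y, 1; rewrite mulr1 mul1r; split=> //; first exact: (point_lift1 ce ho).
    exact: (maxideal1 hP).
  have [a [oa yE]] := Ay.
  (* The residue of y is the sum of the ev(a i) b i; it is 0 since y lies in m, and subtracting it
     leaves a combination of the generators of the graph ideal. *)
  have y_res : y = \sum_i (iQ (a i) - cst (ev (a i))) * cst (b i).
    have : m (cst (\sum_i ev (a i) * b i)).
      rewrite -[cst _](subKr y); apply: (maxidealB hP) => //.
      rewrite {1}yE rmorph_sum -sumrB; apply: (maxideal_sum hP) => i _.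
      rewrite rmorphM -mulrBl; apply: (maxidealMr hP); last exact: Pc.
      exact: (point_const hP).
    move/m_const/(congr1 cst); rewrite rmorph0 rmorph_sum => E.
    rewrite -[LHS]subr0 -[in LHS]E {1}yE -sumrB; apply: eq_bigr => i _.
    by rewrite rmorphM mulrBl.
  (* Multiplying by all cofactors at once makes every summand divisible by u, at the cost of a unit
     at P. *)
  pose W := \prod_i cofactor (a i).
  have AW : A W by apply: (point_lift_prod ce ho) => i _; exact: Acof.
  have nW : ~ m W.
    suff [] : P W /\ ~ m W by [].
    rewrite /W; elim/big_ind : _ => [|x z [Px nx] [Pz nz]|i _].
    - by split; [exact: (point1 hP)|exact: (maxideal1 hP)].
    - by split; [exact: (pointM hP)|move=> /(maxidealM hP)[]].
    by split; [apply/AP/Acof|exact: cofactor_unit].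
  have [y' [Ay' y'E]] : exists y', A y' /\ y * W = iQ u * y'.
    have ex i : exists r, o r /\ (iQ (a i) - cst (ev (a i))) * cofactor (a i) = iQ u * iQ r.
      exists ((a i ^+ #|L| - a i) / u); split.
        have oX : o (a i ^+ #|L| - a i) by apply: (pointB ho) => //; exact: (pointX ho).
        apply/uU/(char_ev_local oX).
        have evN : ev (- a i) = - ev (a i).
          rewrite -mulN1r char_evM //; last by apply/(pointN ho)/(point1 ho).
          by rewrite -(rmorph1 (const C)) -rmorphN char_ev_const rmorphN rmorph1 mulN1r.
        rewrite char_evD; [|exact: (pointX ho)|exact: (pointN ho)].
        by rewrite evN char_ev_exp // expf_card subrr.
      by rewrite cofactorE // -rmorphM mulrC divfK.
    have [r rP] := choice ex.
    exists (\sum_i iQ (r i) * (cst (b i) * \prod_(l < cl_deg CL | l != i) cofactor (a l))); split.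
      apply: (point_lift_sum ce ho) => i _; have [or _] := rP i.
      apply: (point_lift_phiM ho) => //; apply: (point_liftM ce ho).
        exact: (point_lift_const ce ho).
      by apply: (point_lift_prod ce ho) => l _; exact: Acof.
    rewrite y_res mulr_suml mulr_sumr; apply: eq_bigr => i _.
    have [_ rE] := rP i; rewrite /W (bigD1 i) //= [RHS]mulrA -rE; ring.
  clearbody W; have [|n [z [w [Az Aw nz nw E]]]] := IH y' Ay'.
    move=> Py'; apply: nP.
    have W0 := unit_neq0 hP nW.
    have -> : y / iQ u ^+ N.+1 = (y' / iQ u ^+ N) * W^-1.
      have -> : y = iQ u * y' / W by rewrite -y'E (mulfK W0).
      by rewrite exprS; field; rewrite ?W0 ?iu0 ?expf_neq0.
    by apply: (pointM hP) => //; apply: (unit_inv hP) => //; exact: AP.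
  exists n.+1, z, (W * w); split=> //.
  - exact: (point_liftM ce ho).
  - by move=> /(maxidealM hP); case=> //; exact: AP.
  by rewrite mulrA y'E -mulrA E exprS mulrA.
split=> // x Px.
have [->|x0] := eqVneq x 0; first by exists 0; rewrite rmorph0 subr0; exact: (maxideal0 hP).
have [q [a [q0 oa xE [l al]]]] := point_lift_factor ce ho x0.
set y := \sum_i _ in xE.
have Ay : A y by exists a.
have y0 : y != 0 by apply: contra_neq x0 => y0; rewrite xE y0 mulr0.
have [t tP] := cl_dvr hP.
(* y^-1 has a pole bounded by u^N, so y is not divisible by u^(N+1): this is where the successive
   divisions by u must stop. *)
have [N PN] := absorb hP y^-1 tP miu.
have [|n [z [w [Az Aw nz nw E]]]] := main N.+1 y Ay.
  move=> H; have := pointM hP PN H.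
  have -> : iQ u ^+ N * y^-1 * (y / iQ u ^+ N.+1) = (iQ u)^-1.
    by rewrite exprS; field; rewrite iu0 y0 expf_neq0.
  by apply: maxideal_inv.
have [j [oj nj]] := uV _ q0.
set q1 := q / u ^ j in oj nj.
have w0 := unit_neq0 hP nw.
have xE' : x = iQ u ^ (j + n%:Z) * (iQ q1 * z / w).
  rewrite xE -[y](mulfK w0) E expfzDr // /q1 rmorphM fmorphV.
  have -> : iQ (u ^ j) = iQ u ^ j by rewrite rmorphXz // unitfE.
  rewrite -exprnP; field; by rewrite expfz_neq0 // w0.
have nq1 : ~ m (iQ q1) by move/(maxideal_preimage _ _ hP); rewrite Po.
have Pr : P (iQ q1 * z / w).
  apply: (pointM hP); last by apply: (unit_inv hP) => //; exact: AP.
  by apply: (pointM hP); [exact: PiQ|exact: AP].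
have nr : ~ m (iQ q1 * z / w).
  move=> H; have := maxidealMl hP (AP _ Aw) H; rewrite mulrC divfK //.
  by move/(maxidealM hP); case=> //; [exact: PiQ|exact: AP].
case: (j + n%:Z) xE' => [[|d]|d] xE'.
- have [cz mz] := Ares _ Az; have [cw mw] := Ares _ Aw.
  have cw0 : cw != 0 by apply: contra_notN nw => /eqP cw0; move: mw; rewrite cw0 rmorph0 subr0.
  exists (ev q1 * cz / cw); rewrite xE' expr0z mul1r; apply: residue_mul => //.
  + by apply: (pointM hP); [exact: PiQ|exact: AP].
  + by apply: (unit_inv hP) => //; exact: AP.
  + by apply: residue_mul => //; [exact: PiQ|exact: AP|exact: Pc].
  have -> : w^-1 - cst cw^-1 = - ((w - cst cw) * (w^-1 * cst cw^-1)).
    by rewrite fmorphV; field; rewrite ?fmorph_eq0 ?w0 ?cw0.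
  apply/(maxidealN hP)/(maxidealMr hP) => //.
  by apply: (pointM hP); [apply: (unit_inv hP) => //; exact: AP|exact: (point_const hP)].
- exists 0; rewrite rmorph0 subr0 xE' -exprnP.
  by apply: (maxidealMr hP) => //; exact: (maxidealXS hP).
exfalso; apply: nr.
have -> : iQ q1 * z / w = iQ u ^+ d.+1 * x.
  by rewrite xE' NegzE -exprnN mulrA mulfV ?mul1r // expf_neq0.
by apply: (maxidealMr hP) => //; exact: (maxidealXS hP).
Qed.

End CharacteristicPoint.

(** * Pullback of stalks and of cokernels *)

Section PullbackImage.
Variables (k' K K' : fieldType) (h' : {rmorphism k' -> K'}) (phi : {rmorphism K -> K'}).

Lemma pullback_hom r r' (M : sheaf K r) (N : sheaf K r') (A : 'M_(r, r')) P :
  (forall w, M (phi @^-1` P) w -> N (phi @^-1` P) (w *m A)) ->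
  forall v, pullback phi M P v -> pullback phi N P (v *m map_mx phi A).
Proof.
move=> H v [n [a [w [Pa Sw ->]]]].
exists n, a, (fun i => w i *m map_mx phi A); split=> // [i|].
  by have [u Mu <-] := Sw i; exists (u *m A); [exact: H|rewrite map_mxM].
by rewrite mulmx_suml; apply: eq_bigr => i _; rewrite scalemxAl.
Qed.

Lemma pullback_iff r (M N : sheaf K r) (A : 'M_r) P : A \in unitmx ->
  (forall w, M (phi @^-1` P) w <-> N (phi @^-1` P) (w *m A)) ->
  forall v, pullback phi M P v <-> pullback phi N P (v *m map_mx phi A).
Proof.
move=> uA H v; split; first by apply: pullback_hom => w /H.
rewrite -{2}[v](mulmxK (_ : map_mx phi A \in unitmx)) ?map_unitmx // -map_invmx.
by apply: pullback_hom => w; rewrite H mulmxKV.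
Qed.

Lemma pullback_image r (M : sheaf K r) (A : 'M_r) P : A \in unitmx ->
  forall v, sheaf_image (pullback phi M) (map_mx phi A) P v <->
            pullback phi (sheaf_image M A) P v.
Proof.
move=> uA v; split=> [[w Mw <-]|].
  by move: Mw; apply: pullback_hom => u Mu; exists u.
move=> Mv; exists (v *m map_mx phi (invmx A)); last first.
  by rewrite -mulmxA -map_mxM mulVmx // map_mx1 mulmx1.
by move: Mv; apply: pullback_hom => _ [u Mu <-]; rewrite mulmxK.
Qed.

Lemma pullback_sub r (M N : sheaf K r) P :
  (forall w, M (phi @^-1` P) w -> N (phi @^-1` P) w) ->
  forall v, pullback phi M P v -> pullback phi N P v.
Proof.
move=> H v Mv; rewrite -[v]mulmx1 -(map_mx1 phi); move: Mv; apply: pullback_hom => w.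
by rewrite mulmx1; exact: H.
Qed.

End PullbackImage.

Lemma image_lattice (K : fieldType) (O : set K) r (S : sheaf K r) (A : 'M_r) :
  A \in unitmx -> is_lattice O (S O) -> is_lattice O (sheaf_image S A O).
Proof.
move=> uA [B uB SB]; exists (invmx A *m B); first by rewrite unitmx_mul unitmx_inv uA.
move=> v; rewrite mulmxA -SB; split=> [[w Sw <-]|Sv]; first by rewrite mulmxK.
by exists (v *m invmx A); rewrite ?mulmxKV.
Qed.

Section ConstExtSheaf.
Variables (k k' K K' : fieldType) (j : {rmorphism k -> k'}).
Variables (h : {rmorphism k -> K}) (h' : {rmorphism k' -> K'}) (phi : {rmorphism K -> K'}).
Variables (n : nat) (b : 'I_n -> k').
Hypothesis ce : const_ext j h h' phi b.

Section RationalStalk.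
Variables (P : set K') (r : nat) (M : sheaf K r).
Hypotheses (hP : is_point h' P) (rP : rational_point h (phi @^-1` P)).
Hypothesis lM : is_lattice (phi @^-1` P) (M (phi @^-1` P)).

(** Above a rational point the local ring is [point_lift], so the stalk of the pullback is the stalk
    below tensored with k', and membership is tested on coordinates. *)
Lemma pullback_coords (v : 'I_n -> 'rV[K]_r) :
  pullback phi M P (\sum_i h' (b i) *: map_mx phi (v i)) <->
  forall i, M (phi @^-1` P) (v i).
Proof.
have [B uB MB] := lM; rewrite (pullback_latticeE hP uB MB).
have PE := point_lift_unique ce rP hP erefl.
have E l : (\sum_i h' (b i) *: map_mx phi (v i) *m map_mx phi B) 0 l =
    \sum_i phi ((v i *m B) 0 l) * h' (b i).
  by rewrite summxE; apply: eq_bigr => i _; rewrite -scalemxAl -map_mxM !mxE mulrC.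
rewrite mulmx_suml; split=> H.
  move=> i; apply/MB => l; move: i; apply/(point_liftE ce).
  by rewrite -E -PE; exact: H.
by move=> l; rewrite E PE; apply/(point_liftE ce) => i; exact: (MB _).1.
Qed.

End RationalStalk.

Lemma vector_coords r (v : 'rV[K']_r) : exists w : 'I_n -> 'rV[K]_r,
  v = \sum_i h' (b i) *: map_mx phi (w i).
Proof.
have /choice[a aP] := fun l => const_ext_ex ce (v 0 l).
exists (fun i => \row_l a l i); apply/rowP => l; rewrite summxE aP.
by apply: eq_bigr => i _; rewrite !mxE mulrC.
Qed.

(** A k-basis of N/M stays a basis over k': spanning and independence are checked on each coordinate
    with respect to [b]. *)
Lemma quotient_dim_pullback (P : set K') r (M N : sheaf K r) d :
  is_point h' P -> rational_point h (phi @^-1` P) ->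
  is_lattice (phi @^-1` P) (M (phi @^-1` P)) -> is_lattice (phi @^-1` P) (N (phi @^-1` P)) ->
  quotient_dim h (N (phi @^-1` P)) (M (phi @^-1` P)) d ->
  quotient_dim h' (pullback phi N P) (pullback phi M P) d.
Proof.
move=> hP rP lM lN; have hP0 := rP.1.
have kM := lattice_ksubmod hP0 lM; have kN := lattice_ksubmod hP0 lN.
have kM' := lattice_ksubmod hP (pullback_lattice hP lM).
have kN' := lattice_ksubmod hP (pullback_lattice hP lN).
move=> /(quotient_dimP _ kN kM)[w [Nw ex un]].
apply/(quotient_dimP _ kN' kM'); exists (map_mx phi w).
have [_ bb _] := ce.
have combE (a : 'I_n -> 'rV[k]_d) :
    map_mx h' (\sum_i b i *: map_mx j (a i)) *m map_mx phi w =
    \sum_i h' (b i) *: map_mx phi (map_mx h (a i) *m w).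
  rewrite raddf_sum mulmx_suml; apply: eq_bigr => i _.
  rewrite /= map_mxZ -scalemxAl map_mxM; congr (_ *: (_ *m _)).
  by apply/matrixP => x y; rewrite !mxE (const_ext_agree ce).
split=> [l|v Nv|a Ma].
- by rewrite -map_row; apply/(pullback_map hP lN).
- have [v' vE] := vector_coords v; rewrite vE in Nv *.
  have Nv' := (pullback_coords hP rP lN v').1 Nv.
  have /choice[a aP] := fun i => ex _ (Nv' i).
  exists (\sum_i b i *: map_mx j (a i)); rewrite combE -sumrB.
  rewrite (eq_bigr (fun i => h' (b i) *: map_mx phi (v' i - map_mx h (a i) *m w))).
    exact/(pullback_coords hP rP lM).
  by move=> i _; rewrite raddfB scalerBr.
have /choice[a' a'P] := fun l => basis_ex bb (a 0 l).
have aE : a = \sum_i b i *: map_mx j (\row_l a' l i).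
  by apply/rowP => l; rewrite summxE a'P; apply: eq_bigr => i _; rewrite !mxE mulrC.
move: Ma; rewrite aE combE => /(pullback_coords hP rP lM) Ma.
by rewrite big1 // => i _; rewrite (un _ (Ma i)) map_mx0 scaler0.
Qed.

(** Each point of the support is rational, so exactly one point lies above it, with the same local
    dimension; the sum is reindexed along this bijection. *)
Lemma coker_dim_pullback r (M N : sheaf K r) (A : 'M_r) d : A \in unitmx ->
  (forall P, is_point h P -> is_lattice P (M P)) ->
  (forall P, is_point h P -> is_lattice P (N P)) ->
  sheaf_hom h M N A ->
  (forall P, is_point h P -> (exists v, N P v /\ ~ sheaf_image M A P v) -> rational_point h P) ->
  coker_dim h M N A d -> coker_dim h' (pullback phi M) (pullback phi N) (map_mx phi A) d.
Proof.
move=> uA lM lN MN rat [delta [dP fin ->]].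
have lI P : is_point h P -> is_lattice P (sheaf_image M A P).
  by move=> hP; apply: image_lattice => //; exact: lM.
have ratd P : is_point h P -> delta P <> 0%N -> rational_point h P.
  move=> hP d0; apply: rat => //; apply: contrapT => H; apply: d0.
  have NI v : N P v -> sheaf_image M A P v by move=> Nv; apply: contrapT => ?; apply: H; exists v.
  have := dP P hP; case: (delta P) => // d' /(quotient_dimP _
    (lattice_ksubmod hP (lN P hP)) (lattice_ksubmod hP (lI P hP)))[w [Nw _ un]].
  have := un (delta_mx 0 0); rewrite map_delta_mx -rowE => /(_ (NI _ (Nw 0)))/rowP /(_ 0).
  by rewrite !mxE !eqxx => /eqP; rewrite oner_eq0.
pose S := [set P | is_point h P /\ delta P <> 0%N].
pose S' := [set P | is_point h' P /\ delta (phi @^-1` P) <> 0%N].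
have S'E : S' `<=` point_lift h' phi b @` S.
  move=> P [hP d0]; have hP0 := const_ext_point ce hP; exists (phi @^-1` P); first by split.
  by rewrite -(point_lift_unique ce (ratd _ hP0 d0) hP erefl).
have finS' : finite_set S' by apply: sub_finite_set S'E _; exact: finite_image.
exists (fun P => delta (phi @^-1` P)); split=> //.
  move=> P hP; have hP0 := const_ext_point ce hP.
  apply: (@quotient_dim_ext _ _ _ _ (pullback phi N P) (pullback phi (sheaf_image M A) P)) => //.
    by move=> v; rewrite pullback_image.
  have [d0|d0] := eqVneq (delta (phi @^-1` P)) 0%N; last first.
    apply: quotient_dim_pullback => //; [|exact: lI|exact: lN|exact: dP].
    by apply: ratd => //; exact/eqP.
  have q0 := dP _ hP0; rewrite d0 in q0 *.
  have kN := lattice_ksubmod hP (pullback_lattice hP (lN _ hP0)).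
  apply: quotient_dim_ext (quotient_dim0 kN) => // v; split.
    by apply: pullback_sub => w; exact: (quotient_dim0_eq q0).
  by apply: pullback_sub => w Iw; apply: (MN _ hP0).
rewrite -(@fsbig_widen _ _ _ _ S) //; last 2 first.
- by move=> P [].
- by move=> P [hP nS] /=; apply: contrapT => d0; apply: nS; split.
rewrite -(@fsbig_widen _ _ _ _ S' [set P | is_point h' P]) //; last 2 first.
- by move=> P [].
- by move=> P [hP nS] /=; apply: contrapT => d0; apply: nS; split.
apply: reindex_fsbig; split.
- by move=> P [hP d0]; split=> //; exact: (const_ext_point ce hP).
- move=> P P' /set_mem[hP d0] /set_mem[hP' d0'] E.
  rewrite (point_lift_unique ce (ratd _ (const_ext_point ce hP) d0) hP erefl).
  by rewrite [RHS](point_lift_unique ce (ratd _ (const_ext_point ce hP) d0) hP') // E.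
move=> P [hP d0]; exists (point_lift h' phi b P).
  have [hl _] := rational_point_lift ce (ratd _ hP d0); split=> //.
  by rewrite (point_lift_preimage ce (ratd _ hP d0)).
exact: (point_lift_preimage ce (ratd _ hP d0)).
Qed.

End ConstExtSheaf.

(** * Abelian tau-sheaves under base change *)

Section BaseChange.
Variables (F : finFieldType) (C : curve F) (infty : set C).
Hypothesis infty_rat : rational_point (const C) infty.
Variables (L L' : finFieldType) (jL : {rmorphism F -> L}) (h : {rmorphism L -> L'}).
Variables (CL : curve_over C jL) (CL' : curve_over C (h \o jL : {rmorphism F -> L'})).
Variables (c : char_morphism C jL) (phi : {rmorphism CL -> CL'}).
Hypothesis proj : is_projection phi.
Variables (n : nat) (b : 'I_n -> L').
Hypothesis ce : const_ext h (cl_const CL) (cl_const CL') phi b.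
Local Notation pointL := (is_point (cl_const CL)).
Local Notation pointL' := (is_point (cl_const CL')).
Local Notation sigma := (cl_sigma CL).
Local Notation sigma' := (cl_sigma CL').
Local Notation iQ := (cl_fun CL).
Local Notation iQ' := (cl_fun CL').

Lemma proj_sigma x : sigma' (phi x) = phi (sigma x).
Proof.
have [b0 ce0] := cl_const_ext CL; have [a ->] := const_ext_ex ce0 x.
have [pf pc] := proj.
rewrite !rmorph_sum; apply: eq_bigr => i _.
by rewrite !rmorphM pf pc !cl_sigma_fun pf !cl_sigma_const pc !rmorphXn.
Qed.

Lemma proj_preimage (P : set CL') : iQ @^-1` (phi @^-1` P) = iQ' @^-1` P.
Proof. by have [pf _] := proj; apply/seteqP; split=> x /=; rewrite pf. Qed.

Lemma map_proj_sigma m p (A : 'M_(m, p)) :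
  map_mx sigma' (map_mx phi A) = map_mx phi (map_mx sigma A).
Proof. by apply/matrixP => x y; rewrite !mxE proj_sigma. Qed.

Lemma sigma_proj_preimage (P : set CL') : phi @^-1` (sigma' @^-1` P) = sigma @^-1` (phi @^-1` P).
Proof. by apply/seteqP; split=> x /=; rewrite proj_sigma. Qed.

Lemma graph_ideal_base_change (P : set CL') x : pointL' P ->
  graph_ideal (char_base_change h c) P x -> exists m (a : 'I_m -> CL') (w : 'I_m -> CL),
  [/\ forall l, P (a l), forall l, graph_ideal c (phi @^-1` P) (w l)
    & x = \sum_l a l * phi (w l)].
Proof.
move=> hP [Px H]; have hP0 := const_ext_point ce hP; have [pf pc] := proj.
have [E|ne] := pselect (iQ @^-1` (phi @^-1` P) = char_point c); last first.
  (* Away from the characteristic point the graph ideal below is the whole local ring and contains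
     1. *)
  exists 1%N, (fun=> x), (fun=> 1); split=> // [_|].
    by split=> //; exact: (point1 hP0).
  by rewrite big_ord1 rmorph1 mulr1.
have [|m [a [w [Pa Sw ->]]]] := H; first by rewrite -proj_preimage.
have /choice[g gP] : forall l, exists y, char_point c y /\
    w l = iQ' y - cl_const CL' (h (char_ev c y)).
  by move=> l; have [y oy <-] := Sw l; exists y.
exists m, a, (fun l => iQ (g l) - cl_const CL (char_ev c (g l))); split=> // [l|].
  have [og _] := gP l; split.
    apply: (pointB hP0); last exact: (point_const hP0).
    by move: og; rewrite -E.
  move=> _; exists 1%N, (fun=> 1), (fun=> iQ (g l) - cl_const CL (char_ev c (g l))).
  split=> [_|_|]; [exact: (point1 hP0)|by exists (g l)|].
  by rewrite big_ord1 scale1r.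
by apply: eq_bigr => l _; have [_ ->] := gP l; rewrite rmorphB pf pc.
Qed.

(* The graph ideal on [C_{L'}] is generated by the one on [C_L]; [T] is any submodule. *)
Lemma graph_ideal_prod (P : set CL') (T : set CL') d : pointL' P ->
  T 0 -> (forall x y, T x -> T y -> T (x + y)) -> (forall a x, P a -> T x -> T (a * x)) ->
  (forall g : 'I_d -> CL, (forall l, graph_ideal c (phi @^-1` P) (g l)) ->
    T (phi (\prod_l g l))) ->
  forall f : 'I_d -> CL', (forall l, graph_ideal (char_base_change h c) P (f l)) ->
  T (\prod_l f l).
Proof.
move=> hP; elim: d T => [|d IH] T T0 TD TM H f fJ.
  by have := H (fun=> 0) => /(_ _)/wrap[]; [case|rewrite !big_ord0 rmorph1].
rewrite big_ord_recl; have [m [a [w [Pa wJ ->]]]] := graph_ideal_base_change hP (fJ ord0).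
rewrite mulr_suml; apply: (big_ind T T0 TD) => l _; rewrite -mulrA; apply: (TM _ _ (Pa l)).
(* The factor already expanded is absorbed into the submodule, which is why the statement is made
   for an arbitrary T. *)
apply: (IH [set y | T (phi (w l) * y)]) => /=.
- by rewrite mulr0.
- by move=> x y Tx Ty; rewrite mulrDr; exact: TD.
- by move=> x y Px Ty; rewrite mulrCA; exact: TM.
- move=> g gJ; rewrite -rmorphM.
  have := H (fun i => if unlift ord0 i is Some i' then g i' else w l).
  rewrite big_ord_recl /= unlift_none; under eq_bigr => i0 _ do rewrite /= liftK.
  by apply=> i; case: unliftP.
by move=> i; exact: fJ.
Qed.

Variable X : tau_data CL.
Hypothesis aX : abelian_tau infty c X.
Local Notation X' := (tau_base_change phi X).

Let lX i P (hP : pointL P) := at_lattice aX i hP.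
Let hp P (hP : pointL' P) : pointL (phi @^-1` P) := const_ext_point ce hP.
Let lX' i P (hP : pointL' P) : is_lattice P (shf X' i P) := pullback_lattice hP (lX i (hp hP)).

Let sX i : sheaf CL (rank X) := pullback sigma (shf X i).
Let lsX i P (hP : pointL P) : is_lattice P (sX i P) := at_pullback aX i hP.

Lemma base_change_pullback i P : pointL' P ->
  pullback sigma' (shf X' i) P = pullback phi (sX i) P.
Proof.
move=> hP; have hP0 := hp hP; have hsP := sigma_point hP; have hsP0 := sigma_point hP0.
have [B uB XB] := lX i hsP0.
apply/seteqP; suff H v : pullback sigma' (shf X' i) P v <-> pullback phi (sX i) P v.
  by split=> v /H.
rewrite (pullback_latticeE (B := map_mx phi B) hP) ?map_unitmx //; last first.
  move=> w; apply: (pullback_latticeE hsP uB); rewrite sigma_proj_preimage; exact: XB.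
rewrite (pullback_latticeE (B := map_mx sigma B) hP) ?map_unitmx //; last first.
  by move=> w; exact: (pullback_latticeE hP0 uB XB).
by rewrite map_proj_sigma.
Qed.

Lemma base_change_free i : locally_free (cl_const CL') (shf X' i).
Proof.
have [y [d dep]] := cl_dep CL'; apply/(locally_freeP dep); split; first by move=> P; exact: lX'.
apply: (@sub_finite_set _ _ (\bigcup_(P0 in
    [set P0 | pointL P0 /\ ~ (forall v, shf X i P0 v <-> intvec P0 v)])
    [set P | pointL' P /\ phi @^-1` P = P0])).
  move=> P [hP nX]; exists (phi @^-1` P) => //; split; first exact: hp.
  move=> H; apply: nX => v.
  rewrite /= (pullback_latticeE (B := 1%:M) hP (unitmx1 _ _)) ?map_mx1 ?mulmx1 //.
  by move=> w; rewrite mulmx1 H.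
apply: bigcup_finite => [|P0 [hP0 _]]; first exact: (at_finite aX).
(* All points above [P0] are poles of phi x for one x outside [P0], hence finite in number. *)
have [x nx] : exists x, ~ P0 x by case: hP0.
apply: sub_finite_set (cl_finite_poles (phi x)) => P [hP E]; split=> // Px.
by apply: nx; rewrite -E.
Qed.

(** Away from [infty] the period makes a composite of consecutive Pi's bijective on stalks, so its
    last factor is onto. Above [infty] lies a single point, and it is rational. *)
Lemma coker_Pi_rational i P : pointL P ->
  (exists v, shf X (i + 1) P v /\ ~ sheaf_image (shf X i) (Pi X i) P v) ->
  rational_point (cl_const CL) P.
Proof.
move=> hP [v [Xv nv]].
have [b0 ce0] := cl_const_ext CL.
have [E|ne] := pselect (iQ @^-1` P = infty).
  by rewrite (point_lift_unique ce0 infty_rat hP E); exact: (rational_point_lift ce0 infty_rat).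
exfalso; apply: nv.
have [t /(local_param_uniformizer infty_rat.1) tP] := curve_dvr infty_rat.1.
have [k [l [k0 l0 _ per]]] := period_ex infty_rat tP aX.
have pf1 : pole_factor infty t P k = 1.
  by rewrite /pole_factor /point_divisor; case: asboolP => // _; rewrite expr0z rmorph1.
case: l l0 per => // l _ per.
have hom m i0 w : shf X i0 P w -> shf X (i0 + m%:Z) P (w *m Pi_iter X m i0).
  move=> Xw; elim: m => [|m IH] /=; first by rewrite addr0 mulmx1.
  rewrite mulmxA -addn1 PoszD addrA; apply: (at_Pi_hom aX hP).
  by exists (w *m Pi_iter X m i0).
(* The period has length l + 1, so the composite starting at i - l ends with [Pi X i]. *)
pose i0 : int := i - l%:Z.
have uPi := Pi_iter_unit infty_rat aX l.+1 i0.
pose w := v *m invmx (Pi_iter X l.+1 i0).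
have i0E : i0 + l%:Z = i by rewrite subrK.
have Xw : shf X i0 P w.
  apply/(per i0 P hP); rewrite pf1 scale1r /w mulmxKV //.
  by rewrite -addn1 PoszD addrA i0E.
exists (w *m Pi_iter X l i0); first by have := hom l _ _ Xw; rewrite i0E.
have : w *m Pi_iter X l.+1 i0 = v by rewrite mulmxKV.
by rewrite /= i0E mulmxA.
Qed.

(** If the graph ideal contained 1 at P, its power would annihilate the cokernel only if that is 0.
    So P lies over the characteristic point, and no generator of the ideal is a unit at P, which is
    the hypothesis of [rational_of_characteristic]. *)
Lemma coker_tau_rational i P : pointL P ->
  (exists v, shf X (i + 1) P v /\ ~ sheaf_image (sX i) (tau X i) P v) ->
  rational_point (cl_const CL) P.
Proof.
move=> hP [v [Xv nv]].
have nJ : ~ graph_ideal c P 1.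
  move=> J1; apply: nv; have := at_char aX hP (f := fun=> 1) (fun=> J1) Xv.
  by rewrite prodr_const expr1n scale1r.
have PE : iQ @^-1` P = char_point c.
  by apply: contrapT => ne; apply: nJ; split=> //; exact: (point1 hP).
apply: (rational_of_characteristic (c := c) hP PE) => a oa.
have Pa : P (iQ a - cl_const CL (char_ev c a)).
  by apply: (pointB hP); [rewrite -PE in oa|exact: (point_const hP)].
apply: contrapT => nm; apply: nJ; split; first exact: (point1 hP).
move=> _; exists 1%N, (fun=> (iQ a - cl_const CL (char_ev c a))^-1),
  (fun=> iQ a - cl_const CL (char_ev c a)); split=> [_|_|].
- exact: (unit_inv hP).
- by exists a.
by rewrite big_ord1 /GRing.scale /= mulVf // (unit_neq0 hP nm).
Qed.

Lemma base_change_Pi_iter l i : Pi_iter X' l i = map_mx phi (Pi_iter X l i).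
Proof. by elim: l => [|l IH] /=; rewrite ?map_mx1 // IH map_mxM. Qed.

Lemma base_change_abelian : abelian_tau infty (char_base_change h c) X'.
Proof.
have uPi i := at_Pi_unit infty_rat aX i; have utau i := at_tau_unit infty_rat aX i.
have inj (A : 'M[CL]_(rank X)) : A \in unitmx ->
    forall v : 'rV_(rank X), v *m map_mx phi A = 0 -> v = 0.
  move=> uA v /(congr1 (mulmx^~ (invmx (map_mx phi A)))).
  by rewrite mulmxK ?map_unitmx // mul0mx.
split.
- exact: base_change_free.
- move=> i P hP _ [v Xv <-]; move: Xv; apply: pullback_hom => w Xw.
  by apply: (at_Pi_hom aX (hp hP)); exists w.
- by move=> i P hP v _; exact: inj.
- move=> i P hP _ [v + <-]; rewrite base_change_pullback //; apply: pullback_hom => w Xw.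
  by apply: (at_tau_hom aX (hp hP)); exists w.
- by move=> i P hP v _; exact: inj.
- by move=> i; rewrite /= map_proj_sigma -!map_mxM (at_comm aX).
- have [t /(local_param_uniformizer infty_rat.1) tP] := curve_dvr infty_rat.1.
  have [k [l [k0 l0 E per]]] := period_ex infty_rat tP aX.
  exists k, l; split=> //.
  apply/(period_spec tP) => [i P|i|i P hP v]; first exact: lX'.
    by rewrite base_change_Pi_iter map_unitmx; exact: (Pi_iter_unit infty_rat aX).
  have pfE : pole_factor infty t P k = phi (pole_factor infty t (phi @^-1` P) k).
    by have [pf _] := proj; rewrite /pole_factor pf proj_preimage.
  rewrite base_change_Pi_iter pfE scalemxAr -map_mxZ.
  apply: pullback_iff => [|w].
    by rewrite unitmxZ ?(Pi_iter_unit infty_rat aX) // unitfE (pole_factor_neq0 tP).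
  by rewrite (per i _ (hp hP)) scalemxAr.
- move=> i; apply: (coker_dim_pullback ce (uPi i)).
  + by move=> P; exact: lX.
  + by move=> P; exact: lX.
  + exact: (at_Pi_hom aX).
  + exact: coker_Pi_rational.
  exact: (at_coker_Pi aX).
- move=> i.
  have : coker_dim (cl_const CL') (pullback phi (sX i)) (shf X' (i + 1)) (tau X' i) (dimn X').
    apply: (coker_dim_pullback ce (utau i)).
    + by move=> P; exact: lsX.
    + by move=> P; exact: lX.
    + exact: (at_tau_hom aX).
    + exact: coker_tau_rational.
    exact: (at_coker_tau aX).
  move=> [d [dP fin dE]]; exists d; split=> // P hP.
  by rewrite /sheaf_image base_change_pullback //; exact: dP.
move=> i P hP f fJ v [m [a [w [Pa Sw ->]]]].
rewrite /sheaf_image base_change_pullback //.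
have lI : is_lattice P (sheaf_image (pullback phi (sX i)) (map_mx phi (tau X i)) P).
  apply: image_lattice; first by rewrite map_unitmx.
  by apply: (pullback_lattice hP); exact: lsX (hp hP).
rewrite scaler_sumr; apply: (lattice_sum hP lI) => l _.
rewrite scalerA mulrC -scalerA; apply: (latticeZ hP lI) => //.
have [w0 Xw0 <-] := Sw l.
(* The scalars moving a fixed vector into the image form a submodule, so it is enough to test
   products of elements of the graph ideal of C_L. *)
apply: (graph_ideal_prod (T := [set y | sheaf_image (pullback phi (sX i)) (map_mx phi (tau X i)) P
  (y *: map_mx phi w0)]) hP _ _ _ _ fJ) => /=.
- by rewrite scale0r; exact: (lattice0 hP lI).
- by move=> x y Ix Iy; rewrite scalerDl; exact: (latticeD hP lI).
- by move=> x y Px Iy; rewrite -scalerA; exact: (latticeZ hP lI).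
move=> g gJ; rewrite -map_mxZ; apply/pullback_image; first exact: utau.
apply/(pullback_map hP); first by apply: image_lattice => //; exact: lsX (hp hP).
exact: (at_char aX (hp hP) gJ).
Qed.

End BaseChange.

(** * Separable polynomials and the Frobenius endomorphism *)

Section Ideals.
Variable E : fieldType.

Lemma ideal_generator (J : set {poly E}) : is_ideal J -> (exists2 g, g != 0 & J g) ->
  exists m, forall x, J x <-> m %| x.
Proof.
move=> [J0 JD JM] [g g0 Jg].
pose Q s := `[< exists2 x : {poly E}, x != 0 & J x /\ size x = s >].
have exQ : exists s, Q s by exists (size g); apply/asboolP; exists g.
case: (ex_minnP exQ) => s /asboolP[m m0 [Jm sm]] smin; exists m => x; split=> [Jx|/divpK <-].
  rewrite /dvdp; apply: contraT => r0; have : Q (size (x %% m)).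
    apply/asboolP; exists (x %% m) => //; split=> //.
    have -> : x %% m = x + (- (x %/ m)) * m by rewrite {2}(divp_eq x m) mulNr addrC addKr.
    by apply: JD => //; exact: JM.
  by move/smin; rewrite leqNgt -sm ltn_modp m0.
exact: JM.
Qed.

(** Let I = (m) and J = (a) with m = a b. As a divisor of g, m is separable, so a and b are coprime
    and (b) is a complement of J by Bezout. *)
Lemma separable_semisimple_quotient (I : set {poly E}) g : is_ideal I -> I g ->
  separable_poly g -> semisimple_quotient I.
Proof.
move=> idI Ig sg J idJ IJ; have g0 := separable_poly_neq0 sg.
have [m mP] := ideal_generator idI (ex_intro2 _ _ g g0 Ig).
have [a aP] := ideal_generator idJ (ex_intro2 _ _ g g0 (IJ _ Ig)).
have am : a %| m by apply/aP/IJ/mP.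
have mE := divpK am; set b := m %/ a in mE.
have : separable_poly m by apply: dvdp_separable sg; apply/mP.
rewrite -mE separable_mul => /and3P[_ _ cop].
exists [set x | b %| x]; split.
- split=> [|x y|x y] /=; [exact: dvdp0|exact: dvdp_add|exact: dvdp_mull].
- by move=> x /mP; rewrite -mE; apply: dvdp_trans; exact: dvdp_mulr.
- by move=> x [/aP ax bx]; apply/mP; rewrite -mE Gauss_dvdp // bx.
move=> x; have /Bezout_eq1_coprimepP[[u v] /= uv] := cop.
exists (x * v * a), (x * u * b); split.
- by apply/aP; exact: dvdp_mull.
- exact: dvdp_mull.
by rewrite -!mulrA -mulrDr addrC uv mulr1.
Qed.

Lemma linspan_ideal (S : set {poly E}) : is_ideal (linspan (V := ({poly E})^o) setT S).
Proof.
split.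
- by exists 0%N, (fun=> 0), (fun=> 0); split=> [[]|[]|] //; rewrite big_ord0.
- move=> x y [n [a [w [_ Sw ->]]]] [n' [a' [w' [_ Sw' ->]]]].
  exists (n + n')%N, (fun j : 'I_(n + n') => match fintype.split j with inl i => a i | inr i => a' i end),
    (fun j : 'I_(n + n') => match fintype.split j with inl i => w i | inr i => w' i end); split=> //.
    by move=> j; case: (fintype.split j).
  rewrite big_split_ord; congr (_ + _); apply: eq_bigr => i _.
    by rewrite (unsplitK (inl i)).
  by rewrite (unsplitK (inr i)).
move=> y x [n [a [w [_ Sw ->]]]]; exists n, (fun j => y * a j), w; split=> //.
rewrite mulr_sumr; apply: eq_bigr => i _; exact: mulrA.
Qed.

End Ideals.

Section PthPowers.
Variables (K : fieldType) (p : nat).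
Hypothesis pcharK : p \in [pchar K].
Local Notation frob := (pFrobenius_aut pcharK).

Let p_prime : prime p := pcharf_prime pcharK.

Lemma comp_polyXn_pth (g : {poly K}) q :
  (g \Po 'X^q) ^+ p = map_poly frob g \Po 'X^(q * p).
Proof.
have pcharP : p \in [pchar {poly K}] by rewrite pchar_poly.
rewrite -(pFrobenius_autE pcharP) !comp_polyE raddf_sum size_map_poly.
apply: eq_bigr => i _ /=; rewrite pFrobenius_autE exprZn coef_map /= pFrobenius_autE.
by rewrite -!exprM mulnAC.
Qed.

Lemma separable_frobenius g : separable_poly g -> separable_poly (map_poly frob g).
Proof. by rewrite separable_map. Qed.

Definition sep_dvd (f : {poly K}) m : Prop :=
  exists2 g : {poly K}, separable_poly g & f %| g \Po 'X^(p ^ m).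

(** The p-th power of g(X^(p^m)) is the Frobenius twist of g taken at X^(p^(m+1)), and the twist is
    again separable. *)
Lemma sep_dvdS f m : sep_dvd f m -> sep_dvd f m.+1.
Proof.
move=> [g sg fg]; exists (map_poly frob g); first exact: separable_frobenius.
by rewrite expnSr -comp_polyXn_pth; apply: dvdp_exp => //; exact: prime_gt0.
Qed.

Lemma sep_dvd_leq f m m' : (m <= m')%N -> sep_dvd f m -> sep_dvd f m'.
Proof.
move/subnK <-; elim: (m' - m)%N => [//|d IH] /IH; rewrite addSn; exact: sep_dvdS.
Qed.

(** The cofactor q of the gcd in g2 is prime to g1: a common divisor would divide both q and the
    gcd, whose product g2 is separable. *)
Lemma separable_lcm (g1 g2 : {poly K}) : separable_poly g1 -> separable_poly g2 ->
  exists g, [/\ separable_poly g, g1 %| g & g2 %| g].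
Proof.
move=> s1 s2; pose d := gcdp g1 g2; pose q := g2 %/ d.
have E : q * d = g2 := divpK (dvdp_gcdr g1 g2).
have := s2; rewrite -{1}E separable_mul => /and3P[sq _ cop].
exists (q * g1); split; last 2 first.
- exact: dvdp_mull.
- by rewrite -E; apply: dvdp_mul => //; exact: dvdp_gcdl.
rewrite separable_mul sq s1 /=.
rewrite coprimep_sym; apply/coprimepP => t tg1 tq.
have td : t %| d by rewrite dvdp_gcd tg1 (dvdp_trans tq) // -E dvdp_mulr.
by move/coprimepP: cop; apply.
Qed.

(** With g the lcm, both factors divide h = g(X^(p^m)); their product divides h^2, hence h^p since p
    >= 2, and h^p has the required form. *)
Lemma sep_dvd_mul f1 f2 m : sep_dvd f1 m -> sep_dvd f2 m -> sep_dvd (f1 * f2) m.+1.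
Proof.
move=> [g1 s1 d1] [g2 s2 d2]; have [g [sg g1g g2g]] := separable_lcm s1 s2.
exists (map_poly frob g); first exact: separable_frobenius.
rewrite expnSr -comp_polyXn_pth.
apply: (@dvdp_trans _ ((g \Po 'X^(p ^ m)) ^+ 2)); last exact: dvdp_exp2l (prime_gt1 p_prime).
rewrite expr2; apply: dvdp_mul.
  by apply: dvdp_trans d1 _; exact: dvdp_comp_poly.
by apply: dvdp_trans d2 _; exact: dvdp_comp_poly.
Qed.

Lemma deriv_eq0_comp (f : {poly K}) : f^`() = 0 -> exists f1, f = f1 \Po 'X^p.
Proof.
move=> f'0; exists (\poly_(i < size f) f`_(i * p)).
apply/polyP => i; rewrite coef_comp_poly_Xn ?prime_gt0 // coef_poly.
case: ifP => [pi|npi].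
  rewrite divnK //; case: ltnP => // le; apply: nth_default.
  by rewrite (leq_trans le) // leq_divLR // leq_pmulr // prime_gt0.
case: i npi => [|i] npi; first by rewrite dvdn0 in npi.
have := congr1 (fun g : {poly K} => g`_i) f'0; rewrite coef_deriv coef0 => /eqP.
by rewrite -mulr_natr mulf_eq0 -(dvdn_pcharf pcharK) npi orbF => /eqP.
Qed.

(** Induction on the degree. If f' = 0, then f is a polynomial in X^p; otherwise f is separable or
    is a product of two smaller factors, one of them gcd(f, f'). *)
Lemma separable_pth_multiple (f : {poly K}) : f != 0 -> exists m, sep_dvd f m.
Proof.
have [s] := ubnP (size f); elim: s f => // s IH f; rewrite ltnS => sf f0.
have [s1|s1] := leqP (size f) 1.
  exists 0%N, 1; first by rewrite unlock /separable_poly coprime1p.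
  rewrite comp_polyC dvdp1 eqn_leq s1 /=.
  by rewrite lt0n size_poly_eq0.
have [f'0|f'0] := eqVneq f^`() 0.
  have [f1 f1E] := deriv_eq0_comp f'0.
  have f10 : f1 != 0 by apply: contraNneq f0 => E; rewrite f1E E comp_poly0.
  have lt : (size f1 < size f)%N.
    have sE : (size f).-1 = ((size f1).-1 * p)%N by rewrite f1E size_comp_poly size_polyXn.
    have p1 := prime_gt1 p_prime; have : (0 < size f1)%N by rewrite lt0n size_poly_eq0.
    by move: s1 sE p1; move: (size f) (size f1) => a b; nia.
  have [|m [g sg fg]] := IH f1 _ f10; first exact: leq_trans lt sf.
  exists m.+1, g => //; rewrite f1E.
  have -> : g \Po 'X^(p ^ m.+1) = (g \Po 'X^(p ^ m)) \Po 'X^p.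
    by rewrite -comp_polyA comp_Xn_poly -exprM -expnS.
  exact: dvdp_comp_poly.
have [cop|ncop] := boolP (coprimep f f^`()).
  by exists 0%N, f; [rewrite unlock|rewrite expn0 expr1 comp_polyXr].
pose d := gcdp f f^`(); have fE : (f %/ d) * d = f := divpK (dvdp_gcdl f f^`()).
have d0 : d != 0 by rewrite gcdp_eq0 negb_and f0.
have q0 : f %/ d != 0 by apply: contraNneq f0 => E; rewrite -fE E mul0r.
have sd : (size d < size f)%N.
  apply: leq_ltn_trans (lt_size_deriv f0).
  by apply: dvdp_leq => //; exact: dvdp_gcdr.
have sq : (size (f %/ d)%R < size f)%N.
  have sd1 : size d != 1%N by [].
  have : (0 < size d)%N by rewrite lt0n size_poly_eq0.
  by rewrite size_divp //; move: s1 sd1; move: (size f) (size d) => a b; lia.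
have [m1 h1] := IH _ (leq_trans sq sf) q0; have [m2 h2] := IH _ (leq_trans sd sf) d0.
exists (maxn m1 m2).+1; rewrite -fE; apply: sep_dvd_mul.
  by apply: sep_dvd_leq h1; exact: leq_maxl.
by apply: sep_dvd_leq h2; exact: leq_maxr.
Qed.
End PthPowers.

Section MatrixEvaluation.
Variables (K : fieldType) (r : nat) (A : 'M[K]_r).

Lemma mxeval_dvd (p q : {poly K}) : p %| q -> mxeval A p = 0 -> mxeval A q = 0.
Proof.
case: r A => [|n] B; first by move=> _ _; apply/matrixP => -[].
by move=> /divpK <-; rewrite !mxeval_horner rmorphM /= => ->; exact: mulr0.
Qed.

Lemma mxeval_pow n p : mxeval (A ^+ n) p = mxeval A (p \Po 'X^n).
Proof.
case: r A => [|m] B; first by apply/matrixP => -[].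
rewrite (mxeval_horner B) comp_polyE raddf_sum; apply: eq_bigr => i _ /=.
by rewrite horner_mxZ !rmorphXn /= horner_mx_X.
Qed.

Lemma mxeval_wide n (p : {poly K}) : (size p <= n)%N -> mxeval A p = \sum_(i < n) p`_i *: A ^+ i.
Proof.
move=> le; rewrite /mxeval (big_ord_widen n (fun i => p`_i *: A ^+ i) le) big_mkcond.
by apply: eq_bigr => i _; case: ltnP => // le_i; rewrite nth_default // scale0r.
Qed.

(** K is finite over k, so the powers of A lie in a k-space of dimension r^2 n and are dependent
    over k. Cayley-Hamilton would only give a polynomial with coefficients in K. *)
Lemma mxeval_annihilator (k : fieldType) (f : {rmorphism k -> K}) n (b : 'I_n -> K) :
  is_basis f b -> exists2 p : {poly k}, p != 0 & mxeval A (map_poly f p) = 0.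
Proof.
move=> hb; have /choice[c cP] := basis_ex hb.
pose N := #|{: 'I_r * 'I_r * 'I_n}|.
have [u [[s0 us0] uP]] := idomain_dependent (fun (s : 'I_N.+1) (t : 'I_N) =>
  c ((A ^+ s) (enum_val t).1.1 (enum_val t).1.2) (enum_val t).2).
pose p := \poly_(s < N.+1) u (inord s).
have pE (s : 'I_N.+1) : p`_s = u s by rewrite coef_poly ltn_ord inord_val.
exists p; first by apply: contraNneq us0 => p0; rewrite -pE p0 coef0.
rewrite (@mxeval_wide N.+1) ?size_map_poly ?size_poly //.
apply/matrixP => x y; rewrite summxE mxE.
under eq_bigr => s _ do rewrite mxE coef_map /= pE (cP ((A ^+ s) x y)) mulr_sumr.
rewrite exchange_big big1 // => j _.
have := uP (enum_rank (x, y, j)); rewrite enum_rankK /= => /(congr1 f).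
rewrite rmorph_sum rmorph0 => E.
under eq_bigr => s _ do rewrite mulrA -rmorphM.
by rewrite -mulr_suml E mul0r.
Qed.

End MatrixEvaluation.

Lemma mxeval_map (K K' : fieldType) (f : {rmorphism K -> K'}) r (A : 'M[K]_r) p :
  map_mx f (mxeval A p) = mxeval (map_mx f A) (map_poly f p).
Proof.
case: r A => [|r] A; first by apply/matrixP => -[].
by rewrite !mxeval_horner map_horner_mx.
Qed.

(** * The Frobenius after base change *)

Section FrobeniusBaseChange.
Variables (F : finFieldType) (C : curve F).
Variables (L L' : finFieldType) (jL : {rmorphism F -> L}) (h : {rmorphism L -> L'}).
Variables (CL : curve_over C jL) (CL' : curve_over C (h \o jL : {rmorphism F -> L'})).
Variables (phi : {rmorphism CL -> CL'}).
Hypothesis proj : is_projection phi.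
Variables (X : tau_data CL) (W : int -> 'M[CL]_(rank X)) (T : 'M[CL]_(rank X)).
Hypothesis tX : trivialization W T.
Local Notation sigma := (cl_sigma CL).
Local Notation sigma' := (cl_sigma CL').
Local Notation X' := (tau_base_change phi X).

Lemma semilinear_pow_map n :
  semilinear_pow sigma' (map_mx phi T) n = map_mx phi (semilinear_pow sigma T n).
Proof.
elim: n => [|n IH] /=; first by rewrite map_mx1.
by rewrite IH (map_proj_sigma proj) map_mxM.
Qed.

Lemma semilinear_pow_order n :
  semilinear_pow sigma T (cl_deg CL * n) = semilinear_pow sigma T (cl_deg CL) ^+ n.
Proof.
elim: n => [|n IH]; first by rewrite muln0.
by rewrite mulnS addnC semilinear_powD map_sigma_order IH exprSr.
Qed.

Lemma trivialization_base_change :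
  @trivialization _ _ _ _ CL' X' (fun i => map_mx phi (W i)) (map_mx phi T).
Proof.
have [uW uT WS Wtau] := tX; split=> [i||i|i].
- by rewrite map_unitmx.
- by rewrite map_unitmx.
- by rewrite WS map_mxM.
by rewrite /= (map_proj_sigma proj) -!map_mxM Wtau.
Qed.

Lemma frobenius_killed_base_change n (g p : {poly C}) : #|L'| = (#|L| ^ n)%N ->
  mxeval (semilinear_pow sigma T (cl_deg CL)) (map_poly (cl_fun CL) p) = 0 ->
  p %| g \Po 'X^n -> frobenius_killed X' g.
Proof.
move=> cL' pT pg; exists (fun i => map_mx phi (W i)), (map_mx phi T).
split; first exact: trivialization_base_change.
have -> : cl_deg CL' = (cl_deg CL * n)%N.
  by apply/eqP; rewrite -(eqn_exp2l _ _ (card_finNzRing_gt1 F)) expnM -(cl_card CL) -cL' -(cl_card CL').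
have [pf _] := proj.
have -> : map_poly (cl_fun CL') g = map_poly phi (map_poly (cl_fun CL) g).
  by rewrite -map_poly_comp; apply: eq_map_poly => x /=; rewrite pf.
rewrite semilinear_pow_map -mxeval_map semilinear_pow_order mxeval_pow.
have -> : map_poly (cl_fun CL) g \Po 'X^n = map_poly (cl_fun CL) (g \Po 'X^n).
  by rewrite map_comp_poly /= map_polyXn.
rewrite (mxeval_dvd _ pT) ?map_mx0 //; by rewrite dvdp_map.
Qed.

End FrobeniusBaseChange.

Section AbsolutelySemisimple.
Variables (F : finFieldType) (C : curve F) (L : finFieldType) (jL : {rmorphism F -> L}).
Variables (CL : curve_over C jL) (X : tau_data CL) (g : {poly C}).

Lemma frobenius_killed_relation : frobenius_killed X g -> frobenius_relations X g.
Proof.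
move=> [W [T [tX gT]]] i.
rewrite -(size_map_poly (cl_fun CL)).
under eq_bigr => j _ do rewrite -coef_map.
rewrite -/(mxeval (frobenius X i) (map_poly (cl_fun CL) g)).
have [uW _ _ _] := tX; rewrite (frobeniusE tX).
set A := semilinear_pow _ _ _ in gT *.
have H := @mxeval_comm _ _ _ A (invmx (W i) *m A *m W i) (W i) _ (map_poly (cl_fun CL) g).
apply: (can_inj (mulKmx (uW i))); rewrite -H ?gT ?mul0mx ?mulmx0 //.
by rewrite !mulmxA mulmxV // mul1mx.
Qed.

Lemma frobenius_killed_abs_semisimple : separable_poly g -> frobenius_killed X g ->
  frobenius_abs_semisimple X.
Proof.
move=> sep killed E f; apply: (@separable_semisimple_quotient _ _ (map_poly f g)).
- exact: linspan_ideal.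
- exists 1%N, (fun=> 1), (fun=> map_poly f g); split=> // [_|].
    by exists g => //; exact: frobenius_killed_relation.
  by rewrite big_ord1 scale1r.
by rewrite separable_map.
Qed.

End AbsolutelySemisimple.

(** * Construction of the field extensions *)

Lemma rmorphism_ex (A B : nzRingType) (f : A -> B) :
  zmod_morphism f -> GRing.monoid_morphism f -> exists g : {rmorphism A -> B}, g =1 f.
Proof.
move=> add mul.
pose fa := GRing.isZmodMorphism.Build A B f add.
pose fm := GRing.isMonoidMorphism.Build A B f mul.
pose g : {rmorphism A -> B} := HB.pack f fa fm.
by exists g.
Qed.

Section SimpleExtension.
Variables (k A : fieldType) (f : {rmorphism k -> A}) (p : {poly k}) (t : A).

(** Presents A as k[X]/(p) with t the class of X, so that homomorphisms out of A correspond to roots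
    of p. *)
Definition simple_ext : Prop :=
  [/\ irreducible_poly p, root (map_poly f p) t & forall x, exists q, x = (map_poly f q).[t]].

Lemma irreducible_root q : irreducible_poly p -> root (map_poly f p) t ->
  (map_poly f q).[t] = 0 -> p %| q.
Proof.
move=> irr pt qt; apply: contraT; rewrite -irreducible_poly_coprime //.
move=> /Bezout_eq1_coprimepP[[u v] /= /(congr1 (fun q => (map_poly f q).[t]))].
rewrite rmorphD !rmorphM rmorph1 /= hornerD !hornerM hornerC (rootP pt) qt !mulr0 addr0.
by move/eqP; rewrite eq_sym oner_eq0.
Qed.

Lemma is_basis_intro n (b : 'I_n -> A) :
  (forall x, exists a : 'I_n -> k, x = \sum_i f (a i) * b i) ->
  (forall a : 'I_n -> k, \sum_i f (a i) * b i = 0 -> forall i, a i = 0) -> is_basis f b.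
Proof.
move=> ex un x; have [a ->] := ex x; exists [ffun i => a i]; split=> [|a' E].
  by apply: eq_bigr => i _; rewrite ffunE.
apply/ffunP => i; rewrite ffunE; apply/eqP; rewrite -subr_eq0; apply/eqP.
apply: (un (fun i => a i - a' i)).
by under eq_bigr => j _ do rewrite rmorphB mulrBl; rewrite sumrB E subrr.
Qed.

Lemma simple_ext_basis : simple_ext -> is_basis f (fun i : 'I_(size p).-1 => t ^+ i).
Proof.
move=> [irr pt gen]; have p0 := irredp_neq0 irr.
have lt q : (size q <= (size p).-1)%N = (size q < size p)%N.
  by rewrite -ltnS prednK // lt0n size_poly_eq0.
apply: is_basis_intro => [x|a E i].
  have [q ->] := gen x; exists (fun i => (q %% p)`_i).
  rewrite {1}(divp_eq q p) rmorphD rmorphM /= hornerD hornerM (rootP pt) mulr0 add0r.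
  rewrite (@horner_coef_wide _ (size p).-1) ?size_map_poly ?lt ?ltn_modp //.
  by apply: eq_bigr => i _; rewrite coef_map.
pose r := rVpoly (\row_i a i).
have ra j : r`_(nat_of_ord j) = a j by rewrite coef_rVpoly_ord mxE.
have sr : (size r <= (size p).-1)%N by exact: size_poly.
have : p %| r.
  apply: irreducible_root => //; rewrite -E (@horner_coef_wide _ (size p).-1) ?size_map_poly //.
  by apply: eq_bigr => j _; rewrite coef_map /= ra.
move=> pr; rewrite -ra; have [->|r0] := eqVneq r 0; first by rewrite coef0.
by have := dvdp_leq r0 pr; rewrite leqNgt -lt sr.
Qed.

Lemma simple_ext_hom (B : fieldType) (g : {rmorphism k -> B}) z : simple_ext ->
  root (map_poly g p) z ->
  exists psi : {rmorphism A -> B}, forall q, psi (map_poly f q).[t] = (map_poly g q).[z].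
Proof.
move=> [irr pt /choice[c cP]] pz.
have wd q q' : (map_poly f q).[t] = (map_poly f q').[t] ->
    (map_poly g q).[z] = (map_poly g q').[z].
  move=> E; apply/eqP; rewrite -subr_eq0 -hornerN -hornerD -!rmorphB /=.
  have /divpK <- : p %| q - q'.
    by apply: irreducible_root => //; rewrite rmorphB hornerD hornerN E subrr.
  by rewrite rmorphM /= hornerM (rootP pz) mulr0.
have [||psi psiE] := @rmorphism_ex _ _ (fun x => (map_poly g (c x)).[z]).
- move=> x y; rewrite -hornerN -hornerD -rmorphB; apply: wd.
  by rewrite -cP rmorphB hornerD hornerN -!cP.
- split=> [|x y].
    rewrite -[RHS](hornerC 1 z) -[1%:P](rmorph1 (map_poly g)); apply: wd.
    by rewrite -cP rmorph1 (hornerC 1 t).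
  by rewrite -hornerM -rmorphM; apply: wd; rewrite -cP rmorphM hornerM -!cP.
by exists psi => q; rewrite psiE; apply: wd; rewrite -cP.
Qed.

End SimpleExtension.

Lemma simple_ext_ex (k : fieldType) (p : {poly k}) : irreducible_poly p ->
  exists (A : fieldType) (f : {rmorphism k -> A}) t, simple_ext f p t.
Proof.
move=> irr; have [A _ [z pz gen]] := irredp_FAdjoin irr.
exists A, (in_alg A), z; split=> // x.
have /Fadjoin_polyP[q /polyOver1P[q' ->] ->] : x \in <<1; z>>%VS by rewrite gen memvf.
by exists q'.
Qed.

Lemma minimal_polynomial (k A : fieldType) (f : {rmorphism k -> A}) t :
  (exists2 q, q != 0 & root (map_poly f q) t) ->
  exists p, irreducible_poly p /\ root (map_poly f p) t.
Proof.
move=> [q q0 qt]; pose Q s := `[< exists2 q : {poly k}, q != 0 & root (map_poly f q) t /\ size q = s >].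
have exQ : exists s, Q s by exists (size q); apply/asboolP; exists q.
case: (ex_minnP exQ) => s /asboolP[p p0 [pt sp]] smin; exists p; split=> //.
have small r : r != 0 -> root (map_poly f r) t -> (size p <= size r)%N.
  by move=> r0 rt; rewrite sp; apply: smin; apply/asboolP; exists r.
split=> [|r r1 /divpK pE].
  rewrite ltnNge; apply/negP => /size1_polyC pE; move: p0 pt.
  by rewrite pE polyC_eq0 map_polyC rootC fmorph_eq0 => /negPf->.
have [r0 q'0] : r != 0 /\ p %/ r != 0.
  by apply/andP; rewrite andbC -negb_or -mulf_eq0 pE.
rewrite -dvdp_size_eqp; last by rewrite -pE dvdp_mull.
rewrite eqn_leq dvdp_leq //; last by rewrite -pE dvdp_mull.
move: pt; rewrite -{1}pE rmorphM rootM /= => /orP[qt'|rt]; last exact: small.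
have sE : size p = (size (p %/ r)%R + size r).-1 by rewrite -size_mul // pE.
have sq : (0 < size (p %/ r)%R)%N by rewrite lt0n size_poly_eq0.
have sr : (0 < size r)%N by rewrite lt0n size_poly_eq0.
have le := small _ q'0 qt'; move: r1 sE sq sr le => /eqP.
by move: (size p) (size r) (size (p %/ r)%R) => a b d; lia.
Qed.

(** A generator of the cyclic group of units generates L over F; every nonzero element is one of its
    powers. *)
Lemma finite_simple_ext (F L : finFieldType) (j : {rmorphism F -> L}) :
  exists p t, simple_ext j p t.
Proof.
have /cyclicP[u uP] := field_unit_group_cyclic [set: {unit L}]%G.
have [|p [irr pt]] := @minimal_polynomial _ _ j (val u).
  exists ('X^#|L| - 'X).
    rewrite -size_poly_eq0 size_polyDl size_polyXn ?size_polyN ?size_polyX //.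
    by rewrite ltnS; exact: card_finNzRing_gt1.
  by rewrite /root rmorphB /= map_polyXn map_polyX hornerD hornerN hornerXn hornerX expf_card subrr.
exists p, (val u); split=> // x; have [->|x0] := eqVneq x 0; first by exists 0; rewrite rmorph0 horner0.
have : finField_unit x0 \in <[u]>%g by rewrite -uP inE.
move=> /cycleP[i /(congr1 val) /= E]; exists 'X^i.
by rewrite map_polyXn hornerXn E FinRing.val_unitX.
Qed.

Lemma card_natr0 (F : finFieldType) : #|F|%:R = 0 :> F.
Proof. by apply/eqP; rewrite -FinRing.zmodXgE -cardsT expg_cardG ?inE. Qed.

Lemma exprD_card (F : finFieldType) (A : fieldType) (f : {rmorphism F -> A}) (x y : A) :
  (x + y) ^+ #|F| = x ^+ #|F| + y ^+ #|F|.
Proof.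
apply: exprDn_pchar; have [p p_prime pF] := finPcharP F.
have := abelian.abelem_pgroup (abelian.fin_ring_pchar_abelem pF); rewrite /pgroup cardsT.
by apply: sub_in_pnat => q _ /eqP ->; rewrite (fmorph_pchar f).
Qed.

Lemma horner_frobenius (F : finFieldType) (A : fieldType) (f : {rmorphism F -> A}) q z :
  (map_poly f q).[z ^+ #|F|] = (map_poly f q).[z] ^+ #|F|.
Proof.
elim/poly_ind: q => [|q c IH].
  by rewrite rmorph0 !horner0 expr0n; case: #|F| (card_finNzRing_gt1 F).
rewrite rmorphD rmorphM /= map_polyX map_polyC !hornerMXaddC IH (exprD_card f) exprMn.
by rewrite -rmorphXn expf_card.
Qed.

(** M is the splitting field of X^m - X, whose roots are distinct because its derivative is -1. The
    m-th power map is an automorphism fixing the roots, which generate M, so M consists of exactly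
    these m roots. *)
Lemma finite_extension (L : finFieldType) n : (0 < n)%N ->
  exists (L' : finFieldType) (h : {rmorphism L -> L'}), #|L'| = (#|L| ^ n)%N.
Proof.
move=> n0; set m := (#|L| ^ n)%N; have m1 : (1 < m)%N.
  by rewrite -(expn0 #|L|) ltn_exp2l // card_finNzRing_gt1.
pose q (A : fieldType) : {poly A} := 'X^m - 'X.
have sq A : size (q A) = m.+1.
  by rewrite size_polyDl size_polyXn ?size_polyN ?size_polyX.
have /FinSplittingFieldFor[/= M [zs qM genM]] : q L != 0 by rewrite -size_poly_eq0 sq.
rewrite rmorphB /= map_polyXn map_polyX -/(q M) in qM.
have m0 : m%:R = 0 :> M.
  rewrite /m natrX -(rmorph_nat (in_alg M)) card_natr0 rmorph0 expr0n.
  by rewrite -[n]prednK.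
have uzs : uniq zs.
  rewrite -separable_prod_XsubC -(eqp_separable qM) unlock /separable_poly derivB derivXn derivX.
  by rewrite -mulr_natr -polyC_natr m0 polyC0 mulr0 sub0r -scaleN1r coprimepZr ?coprimep1 // oppr_eq0 oner_eq0 //.
pose L' : finFieldType := FinFieldExtType M.
have [/= a _ Da] := finField_galois_generator (sub1v {:M}).
have powa x : (a ^+ n)%g x = x ^+ m.
  rewrite /m; elim: (n) x => [|i IH] x; first by rewrite gal_id expr1.
  by rewrite expgSr galM ?memvf // IH Da ?memvf // dimv1 expn1 -exprM -expnSr.
have fixed (x : M) : x ^+ m = x.
  have : x \in <<1 & zs>>%VS by rewrite genM memvf.
  have /subvP sub : (<<1 & zs>> <= fixedSpace (a ^+ n)%g)%VS.
    rewrite -[fixedSpace _]subfield_closed agenvS // subv_add sub1v; apply/span_subvP => z.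
    rewrite -root_prod_XsubC -(eqp_root qM) /root !hornerE subr_eq0 => /eqP zE.
    by apply/fixedSpaceP; rewrite powa.
  by move=> /sub /fixedSpaceP; rewrite powa.
exists L', (in_alg M).
have /eq_card -> : L' =i zs.
  move=> x; apply/esym; rewrite -root_prod_XsubC -(eqp_root qM) /root !hornerE.
  by rewrite (fixed x) subrr eqxx.
apply: succn_inj; rewrite (card_uniqP _) //= -(size_prod_XsubC _ id) -(eqp_size qM); exact: sq.
Qed.

Section ConstExtBasis.
Variables (k k' K K' : fieldType) (j : {rmorphism k -> k'}).
Variables (h : {rmorphism k -> K}) (h' : {rmorphism k' -> K'}) (phi : {rmorphism K -> K'}).

(** The matrices between the bases [b] and [v] have entries in k, so they also change bases over
    K. *)
Lemma const_ext_basis n (b : 'I_n -> k') m (v : 'I_m -> k') :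
  const_ext j h h' phi b -> is_basis j v -> const_ext j h h' phi v.
Proof.
move=> ce hv; have [ag hb hK] := ce; split=> //.
have /choice[M MP] : forall t, exists a : 'I_n -> k, v t = \sum_i j (a i) * b i.
  by move=> t; exact: (basis_ex hb).
have /choice[N NP] : forall i, exists a : 'I_m -> k, b i = \sum_t j (a t) * v t.
  by move=> i; exact: (basis_ex hv).
have MN t t' : \sum_i M t i * N i t' = (t == t')%:R.
  move: t'; apply: (basis_inj hv).
  rewrite [RHS](bigD1 t) //= eqxx rmorph1 mul1r [X in _ + X]big1 ?addr0; last first.
    by move=> t' ne; rewrite eq_sym (negPf ne) rmorph0 mul0r.
  rewrite [RHS]MP; under eq_bigr => t' _ do rewrite rmorph_sum mulr_suml.
  rewrite exchange_big; apply: eq_bigr => i _; rewrite NP mulr_sumr.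
  by apply: eq_bigr => t' _; rewrite rmorphM mulrA.
apply: is_basis_intro => [x|a E t'].
  have [c ->] := basis_ex hK x; exists (fun t => \sum_i c i * h (N i t)).
  apply/esym; under eq_bigr => t _ do rewrite rmorph_sum mulr_suml.
  rewrite exchange_big; apply: eq_bigr => i _; rewrite NP rmorph_sum mulr_sumr.
  by apply: eq_bigr => t _; rewrite !rmorphM ag mulrA.
have aM i : \sum_t a t * h (M t i) = 0.
  move: i; apply: (basis_eq0 hK); rewrite -[RHS]E.
  under eq_bigr => i _ do rewrite rmorph_sum mulr_suml.
  rewrite exchange_big; apply: eq_bigr => t _; rewrite MP rmorph_sum mulr_sumr.
  by apply: eq_bigr => i _; rewrite !rmorphM ag mulrA.
have -> : a t' = \sum_t a t * h (\sum_i M t i * N i t').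
  rewrite (bigD1 t') //= MN eqxx rmorph1 mulr1 big1 ?addr0 // => t ne.
  by rewrite MN (negPf ne) rmorph0 mulr0.
under eq_bigr => t _ do rewrite rmorph_sum mulr_sumr.
rewrite exchange_big big1 // => i _.
under eq_bigr => t _ do rewrite rmorphM mulrA.
by rewrite -mulr_suml aM mul0r.
Qed.

End ConstExtBasis.

Section Tower.
Variables (k A B : fieldType) (f : {rmorphism k -> A}) (g : {rmorphism A -> B}).
Variable gf : {rmorphism k -> B}.
Hypothesis gfE : forall x, gf x = g (f x).
Variables (n m : nat) (a : 'I_n -> A) (b : 'I_m -> B).
Local Notation ab :=
  (fun s : 'I_#|{: 'I_n * 'I_m}| => g (a (enum_val s).1) * b (enum_val s).2).

Lemma sum_pair (c : 'I_n -> 'I_m -> k) :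
  \sum_(s < #|{: 'I_n * 'I_m}|) gf (c (enum_val s).1 (enum_val s).2) * ab s =
  \sum_j g (\sum_i f (c i j) * a i) * b j.
Proof.
rewrite -(big_enum_val (A := {: 'I_n * 'I_m}) (fun u => gf (c u.1 u.2) * (g (a u.1) * b u.2))) /=.
rewrite -(pair_big predT predT (fun i j => gf (c i j) * (g (a i) * b j))) exchange_big.
apply: eq_bigr => j _; rewrite rmorph_sum mulr_suml.
by apply: eq_bigr => i _; rewrite rmorphM gfE mulrA.
Qed.

Lemma tower_basis : is_basis f a -> is_basis g b -> is_basis gf ab.
Proof.
move=> ha hb; apply: is_basis_intro => [x|c E s].
  have [y ->] := basis_ex hb x; have /choice[c cP] : forall j, _ := fun j => basis_ex ha (y j).
  exists (fun s => c (enum_val s).2 (enum_val s).1); rewrite (sum_pair (fun i j => c j i)).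
  by apply: eq_bigr => j _; rewrite cP.
pose c' i j := c (enum_rank (i, j)).
have cE u : c u = c' (enum_val u).1 (enum_val u).2 by rewrite /c' -surjective_pairing enum_valK.
have c'0 j : \sum_i f (c' i j) * a i = 0.
  move: j; apply: (basis_eq0 hb).
  by rewrite -sum_pair -[RHS]E; apply: eq_bigr => u _; rewrite cE.
by rewrite cE; exact: (basis_eq0 ha (c'0 _)).
Qed.

(** The function fields of C_L and C_{L'} are described over Q only; this recovers the second as a
    constant extension of the first. *)
Lemma tower_top : is_basis f a -> is_basis gf ab -> is_basis g b.
Proof.
move=> ha hab; apply: is_basis_intro => [x|y E j].
  have [c ->] := basis_ex hab x.
  exists (fun j => \sum_i f (c (enum_rank (i, j))) * a i); rewrite -sum_pair.
  by apply: eq_bigr => u _; rewrite -surjective_pairing enum_valK.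
have /choice[c cP] : forall j, _ := fun j => basis_ex ha (y j).
rewrite cP big1 // => i _.
suff -> : c j i = 0 by rewrite rmorph0 mul0r.
have := basis_eq0 hab (a := fun s => c (enum_val s).2 (enum_val s).1) _ (enum_rank (i, j)).
rewrite enum_rankK; apply; rewrite (sum_pair (fun i j => c j i)) -[RHS]E.
by apply: eq_bigr => l _; rewrite cP.
Qed.

End Tower.

Section CurveExtension.
Variables (F : finFieldType) (C : curve F).

Lemma const_horner (L : finFieldType) (jL : {rmorphism F -> L}) (CL : curve_over C jL) q t :
  (map_poly (cl_fun CL) (map_poly (const C) q)).[cl_const CL t] =
  cl_const CL (map_poly jL q).[t].
Proof.
rewrite -horner_map -!map_poly_comp; congr _.[_].
by apply: eq_map_poly => a; exact: cl_agree.
Qed.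

Lemma simple_ext_curve (L : finFieldType) (jL : {rmorphism F -> L}) (CL : curve_over C jL) p t :
  simple_ext jL p t -> simple_ext (cl_fun CL) (map_poly (const C) p) (cl_const CL t).
Proof.
move=> [irr pt gen]; split=> [||x].
- exact: curve_geom_irr.
- by rewrite /root const_horner (rootP pt) rmorph0.
have [b ce] := cl_const_ext CL; have [a ->] := const_ext_ex ce x.
have /choice[q qP] : forall i, _ := fun i => gen (b i).
exists (\sum_i a i *: map_poly (const C) (q i)); rewrite rmorph_sum horner_sum.
by apply: eq_bigr => i _; rewrite /= map_polyZ hornerZ const_horner qP.
Qed.

(** Write L = F[X]/(p). By geometric irreducibility Q[X]/(p) is a field; sigma fixes Q and sends the
    root z to z^q, which is again a root because p has coefficients in F. *)
Lemma curve_over_ex (L : finFieldType) (jL : {rmorphism F -> L}) : inhabited (curve_over C jL).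
Proof.
have [p [t se]] := finite_simple_ext jL; have [irr pt gen] := se.
have [K [iQ [z sz]]] := simple_ext_ex (curve_geom_irr C irr); have [_ pz _] := sz.
have compE q : map_poly (iQ \o const C) q = map_poly iQ (map_poly (const C) q).
  exact: map_poly_comp.
have [|g gE] := @simple_ext_hom _ _ _ _ _ _ (iQ \o const C : {rmorphism F -> K}) z se.
  by rewrite compE.
have [|s sE] := @simple_ext_hom _ _ _ _ _ _ iQ (z ^+ #|F|) sz.
  rewrite -compE /root (horner_frobenius (iQ \o const C)) compE (rootP pz).
  by rewrite expr0n; case: #|F| (card_finNzRing_gt1 F).
have gt : g t = z by have := gE 'X; rewrite !map_polyX !hornerX.
have agree a : iQ (const C a) = g (jL a).
  by have := gE a%:P; rewrite !map_polyC !hornerC.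
have sfun f : s (iQ f) = iQ f by have := sE f%:P; rewrite !map_polyC !hornerC.
have sconst x : s (g x) = g (x ^+ #|F|).
  have [q ->] := gen x.
  by rewrite rmorphXn gE -(horner_frobenius (iQ \o const C)) !compE sE.
have tensor : exists b : 'I_(size p).-1 -> L, is_basis jL b /\ is_basis iQ (fun j => g (b j)).
  exists (fun i => t ^+ i); split; first exact: simple_ext_basis.
  have -> : (fun j : 'I_(size p).-1 => g (t ^+ j)) = fun j => z ^+ j.
    by apply/funext => j; rewrite rmorphXn gt.
  by have := simple_ext_basis sz; rewrite size_map_poly.
exact: (inhabits (CurveOver agree tensor sfun sconst)).
Qed.

Section Projection.
Variables (L L' : finFieldType) (jL : {rmorphism F -> L}) (h : {rmorphism L -> L'}).
Variables (CL : curve_over C jL) (CL' : curve_over C (h \o jL : {rmorphism F -> L'})).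

Lemma projection_ex : exists phi : {rmorphism CL -> CL'}, is_projection phi.
Proof.
have [p [t se]] := finite_simple_ext jL; have [irr pt gen] := se.
have hE q : (map_poly (h \o jL) q).[h t] = h (map_poly jL q).[t].
  by rewrite map_poly_comp horner_map.
have [|phi phiE] := @simple_ext_hom _ _ _ _ _ _ (cl_fun CL') (cl_const CL' (h t))
  (simple_ext_curve CL se).
  by rewrite /root const_horner hE (rootP pt) !rmorph0.
exists phi; split=> [f|x]; first by have := phiE f%:P; rewrite !map_polyC !hornerC.
by have [q ->] := gen x; rewrite -const_horner phiE const_horner hE.
Qed.

Lemma projection_const_ext (phi : {rmorphism CL -> CL'}) n (b : 'I_n -> L') :
  is_projection phi -> is_basis h b -> const_ext h (cl_const CL) (cl_const CL') phi b.
Proof.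
move=> [pf pc] hb; have [a [_ ha haK]] := cl_const_ext CL.
have [b' ce'] := cl_const_ext CL'.
split=> //; have hab := tower_basis (gf := h \o jL) (fun=> erefl) ha hb.
have [_ _ habK] := const_ext_basis ce' hab.
apply: (tower_top (fun f => esym (pf f)) haK).
set u := (X in is_basis _ X) in habK *; set v := (X in is_basis _ X).
suff -> : v = u by [].
by apply/funext => s; rewrite /u /v /= pc rmorphM.
Qed.

End Projection.
End CurveExtension.

(* Separability of the Frobenius after an extension of p-power degree *)
Local Close Scope classical_set_scope.

Theorem theorem6p15 (F : finFieldType) (C : curve F)
    (infty : set C) (infty_rat : rational_point (const C) infty)
    (L : finFieldType) (jL : {rmorphism F -> L}) (CL : curve_over C jL)
    (c : char_morphism C jL)
    (X : tau_data CL) (X_ab : abelian_tau infty c X)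
    (p : nat) (p_char : p \in [pchar L]) :
  exists (L' : finFieldType) (h : {rmorphism L -> L'})
         (CL' : curve_over C (h \o jL : {rmorphism F -> L'}))
         (phi : {rmorphism CL -> CL'}) (m : nat),
    [/\ ext_degree h (p ^ m),
        is_projection phi,
        frobenius_abs_semisimple (tau_base_change phi X)
      & char_point c <> infty ->
        semisimple_tau infty (char_base_change h c) (tau_base_change phi X)].
Proof.
have pC : p \in [pchar C] by rewrite (fmorph_pchar (const C)) -(fmorph_pchar jL).
have [W [T tX]] := trivialization_ex infty_rat X_ab.
have [b0 [_ _ b0K]] := cl_const_ext CL.
have [f f0 fT] := mxeval_annihilator (semilinear_pow (cl_sigma CL) T (cl_deg CL)) b0K.
have [m [g sep_g fg]] := separable_pth_multiple pC f0.
have pm0 : (0 < p ^ m)%N by rewrite expn_gt0 prime_gt0 // (pcharf_prime p_char).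
have [L' [h cardL']] := finite_extension L pm0.
have [CL'] := curve_over_ex C (h \o jL).
have [phi proj] := projection_ex CL CL'.
have [q [t /simple_ext_basis hb]] := finite_simple_ext h.
(* L' is known through its cardinality, from which the degree of the minimal polynomial q of a
   generator is read off. *)
have dimh : (size q).-1 = (p ^ m)%N.
  by apply/eqP; rewrite -(eqn_exp2l _ _ (card_finNzRing_gt1 L)) -cardL' -(basis_card hb).
have ce := projection_const_ext proj hb.
have killed := frobenius_killed_base_change proj tX cardL' fT fg.
exists L', h, CL', phi, m; split=> //.
- by rewrite -dimh; exists (fun i => t ^+ i).
- exact: frobenius_killed_abs_semisimple sep_g killed.
by move=> _; apply: (separable_semisimple infty_rat sep_g (base_change_abelian infty_rat proj ce X_ab)).
Qed.
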